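(* Let $P$ be a simple polygon all of whose interior angles are at least $120^\circ$. Then there is no quadrilateral mesh of $P$ in which every angle of every quadrilateral is less than $120^\circ$.
   Context: A quadrilateral mesh of $P$ is a subdivision of $P$ into quadrilaterals, any two of which are disjoint or meet in a common vertex or a common edge; mesh vertices may lie in the interior of $P$ or on its boundary. *)

(* Defs.v *)
From HB Require Import structures.
From mathcomp Require Import all_boot all_order all_algebra.
From mathcomp Require Import all_classical all_reals all_analysis.
Set Implicit Arguments. Unset Strict Implicit. Unset Printing Implicit Defensive.
Import Order.TTheory GRing.Theory Num.Theory numFieldNormedType.Exports.
Local Open Scope classical_set_scope.
Local Open Scope ring_scope.

Section Plane.
Variable R : realType.
Notation pt := (R * R)%type.

Definition vsub (a b : pt) : pt := (a.1 - b.1, a.2 - b.2).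
Definition dot (a b : pt) : R := a.1 * b.1 + a.2 * b.2.
Definition cross (a b : pt) : R := a.1 * b.2 - a.2 * b.1.
Definition vnorm (a : pt) : R := Num.sqrt (dot a a).

Definition seg (a b : pt) : set pt :=
  [set x | exists2 t : R, 0 <= t <= 1 &
           x = (a.1 + t * (b.1 - a.1), a.2 + t * (b.2 - a.2))].

Definition vtx (p : seq pt) (i : nat) : pt := nth (0, 0) p (i %% size p).
Definition edge (p : seq pt) (i : nat) : set pt := seg (vtx p i) (vtx p i.+1).

Definition simple_polygon (p : seq pt) : Prop :=
  [/\ (3 <= size p)%N, uniq p &
      forall i j, (i < size p)%N -> (j < size p)%N -> i != j ->
        if j == (i.+1 %% size p)%N then edge p i `&` edge p j = [set vtx p j]
        else if i == (j.+1 %% size p)%N then edge p i `&` edge p j = [set vtx p i]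
        else edge p i `&` edge p j = set0].

Definition boundary (p : seq pt) : set pt :=
  [set x | exists2 i, (i < size p)%N & edge p i x].

Definition bounded_pts (A : set pt) : Prop :=
  exists M : R, forall y, A y -> `|y.1| <= M /\ `|y.2| <= M.

Definition region (p : seq pt) : set pt :=
  boundary p `|`
  [set x | ~ boundary p x /\ bounded_pts (@connected_component (R * R)%type (~` boundary p) x)].

(* twice the signed area; positive iff the vertices are listed counterclockwise *)
Definition area2 (p : seq pt) : R :=
  \sum_(i < size p) cross (vtx p i) (vtx p i.+1).

(* counterclockwise angle, in [0, 2 pi), from direction a to direction b *)
Definition ccw_angle (a b : pt) : R :=
  let c := acos (dot a b / (vnorm a * vnorm b)) in
  if 0 <= cross a b then c else 2 * pi - c.

Definition interior_angle (p : seq pt) (i : nat) : R :=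
  let u := vsub (vtx p i.+1) (vtx p i) in
  let w := vsub (vtx p (i + size p).-1) (vtx p i) in
  if 0 < area2 p then ccw_angle u w else ccw_angle w u.

Definition quad_mesh (p : seq pt) (Qs : seq (seq pt)) : Prop :=
  [/\ forall q, q \in Qs -> size q = 4%N /\ simple_polygon q,
      [set x | exists2 q, q \in Qs & region q x] = region p &
      forall i j, (i < size Qs)%N -> (j < size Qs)%N -> i != j ->
        let qi := nth [::] Qs i in let qj := nth [::] Qs j in
        region qi `&` region qj = set0
        \/ (exists k l, [/\ (k < 4)%N, (l < 4)%N, vtx qi k = vtx qj l &
                           region qi `&` region qj = [set vtx qi k]])
        \/ (exists k l, [/\ (k < 4)%N, (l < 4)%N, edge qi k = edge qj l &
                           region qi `&` region qj = edge qi k])].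

End Plane.

(* Main.v *)
(* Each quadrilateral has angle sum 2 pi and four corners, so over all mesh
   vertices the number of incident quadrilaterals minus (2 / pi) times the local
   angle sums to 0. Since all angles are below 2 pi / 3, an inner vertex lies on
   at least 4 quadrilaterals and every other vertex on at least 2; hence the
   contributions are nonnegative off the corners of P and at least
   2 - 2 angle / pi at a corner. By the Umlaufsatz the latter add up to 4, which
   is a contradiction.

   No Jordan curve theorem is needed to know the local angles: the sum of the
   counterclockwise boundaries of the quadrilaterals is a 1-cycle carried by the
   boundary of P, inner edges being shared by two quadrilaterals, so it is m times
   the boundary of P with m in {-1, 0, 1}. Comparing areas gives m = sign of the
   signed area of P. Comparing angles seen from x, the local angle of the mesh at x
   is m times the winding angle of P around x, which determines it modulo 2 pi;
   and it is at most 2 pi because the quadrilaterals do not overlap. *)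
Require Import Defs.
From HB Require Import structures.
From mathcomp Require Import all_boot all_order all_algebra.
From mathcomp Require Import all_classical all_reals all_analysis.
From mathcomp Require Import ring lra zify.
Set Implicit Arguments.
Unset Strict Implicit.
Unset Printing Implicit Defensive.
Import Order.TTheory GRing.Theory Num.Theory numFieldNormedType.Exports.
Local Open Scope classical_set_scope.
Local Open Scope ring_scope.

(** * Signed angles *)

Section Angles.
Variable R : realType.
Notation pt := (R * R)%type.
Implicit Types u v w a b c x : pt.

(** The obstacle is orientation. [interior_angle] is selected by the sign of [area2 p], and that
    this sign agrees with the sense in which the boundary turns is usually drawn from the Jordan
    curve theorem. Here the mesh supplies it: its local angles are nonnegative and equal
    [orientation p * wind p x], and at a farthest vertex of P this winding angle is the signed angle
    between the two edges, which settles the sign in the Umlaufsatz. The multiple m is small because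
    P, cut open at a farthest vertex, carries a primitive of every additive functional; only mesh
    edges entering or leaving the cut along the last edge of P see its jump, and there is at most
    one of each kind. Mesh edges on the boundary need not follow single edges of P: a corner of
    angle pi may lie inside a mesh edge and be no mesh vertex. It adds nothing to the turning, so
    the count survives. Angles below 2 pi / 3 are below pi, so the quadrilaterals are convex and
    their regions are intersections of four half-planes. At a corner of P, one angle below 2 pi / 3
    cannot fill an angle of at least 2 pi / 3. *)

Definition nonanti u v := cross u v != 0 \/ 0 < dot u v.

(* The signed angle in (-pi, pi), with junk value 0 when [u] and [v] are
   antiparallel or one of them vanishes. This choice keeps [ang] antisymmetric,
   and the angle under which a segment is seen additive, even for segments
   containing the viewpoint. *)
Definition ang u v : R :=
  Num.sg (cross u v) * acos (dot u v / (vnorm u * vnorm v)).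

Lemma crossC u v : cross v u = - cross u v.
Proof. by rewrite /cross; ring. Qed.

Lemma dotC u v : dot v u = dot u v.
Proof. by rewrite /dot; ring. Qed.

Lemma angC u v : ang v u = - ang u v.
Proof.
by rewrite /ang crossC dotC sgrN mulNr; congr (- (_ * acos (_ / _))); rewrite mulrC.
Qed.

Lemma ang_collinear u v : cross u v = 0 -> ang u v = 0.
Proof. by move=> h; rewrite /ang h sgr0 mul0r. Qed.

Lemma vnorm_ge0 u : 0 <= vnorm u.
Proof. exact: sqrtr_ge0. Qed.

Lemma sqr_vnorm u : vnorm u ^+ 2 = dot u u.
Proof. by rewrite sqr_sqrtr// /dot addr_ge0// -expr2 sqr_ge0. Qed.

Lemma vnorm_gt0 u : u != (0, 0) -> 0 < vnorm u.
Proof.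
move=> u0; rewrite sqrtr_gt0 /dot; case: u u0 => x y /=.
rewrite xpair_eqE negb_and => /orP[] h.
  by rewrite ltr_pwDl// -?expr2 ?sqr_ge0 ?exprn_even_gt0.
by rewrite ltr_wpDl// -?expr2 ?sqr_ge0 ?exprn_even_gt0.
Qed.

Lemma nonanti_neq0l u v : nonanti u v -> u != (0, 0).
Proof.
by move=> h; apply/eqP => u0; move: h;
  rewrite u0 /nonanti /cross/dot /= !mul0r subr0 addr0 eqxx ltxx => -[].
Qed.

Lemma nonantiC u v : nonanti u v -> nonanti v u.
Proof. by rewrite /nonanti crossC dotC oppr_eq0. Qed.

Lemma nonanti_neq0r u v : nonanti u v -> v != (0, 0).
Proof. by move=> /nonantiC/nonanti_neq0l. Qed.

Lemma lagrange u v :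
  dot u v ^+ 2 + cross u v ^+ 2 = (vnorm u * vnorm v) ^+ 2.
Proof. by rewrite exprMn !sqr_vnorm /dot /cross; ring. Qed.

Lemma cos_ratio u v : -1 <= dot u v / (vnorm u * vnorm v) <= 1.
Proof.
have [->|u0] := eqVneq u (0, 0).
  by rewrite /dot /= !mul0r addr0 mul0r lerN10 ler01.
have [->|v0] := eqVneq v (0, 0).
  by rewrite /dot /= !mulr0 addr0 mul0r lerN10 ler01.
have P : 0 < vnorm u * vnorm v by rewrite mulr_gt0 ?vnorm_gt0.
rewrite ler_pdivlMr// ler_pdivrMr// mul1r mulN1r -ler_norml.
rewrite -(@ler_pXn2r _ 2) ?nnegrE ?(ltW P)//.
by rewrite real_normK ?num_real// -lagrange lerDl sqr_ge0.
Qed.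

Lemma sqrt_ratio u v : u != (0, 0) -> v != (0, 0) ->
  Num.sqrt (1 - (dot u v / (vnorm u * vnorm v)) ^+ 2) =
  `|cross u v| / (vnorm u * vnorm v).
Proof.
move=> u0 v0; have P : 0 < vnorm u * vnorm v by rewrite mulr_gt0 ?vnorm_gt0.
rewrite -[RHS]ger0_norm ?divr_ge0 ?(ltW P)// -sqrtr_sqr; congr Num.sqrt.
rewrite !expr_div_n real_normK ?num_real//.
have := lagrange u v; set N := vnorm u * vnorm v in P *.
have N0 : N ^+ 2 != 0 by rewrite expf_neq0// gt_eqF.
by move=> <-; rewrite -[1](@divff _ (N ^+ 2))// -lagrange -/N -mulrBl; congr (_ / _); ring.
Qed.

Lemma cross0_dot u v : cross u v = 0 -> 0 < dot u v ->
  dot u v = vnorm u * vnorm v.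
Proof.
move=> c0 d0; apply/eqP.
rewrite -(@eqrXn2 _ 2) ?mulr_ge0 ?vnorm_ge0 ?(ltW d0)//.
by rewrite -lagrange c0 expr0n/= addr0.
Qed.

Lemma cos_ang u v : nonanti u v ->
  vnorm u * vnorm v * cos (ang u v) = dot u v.
Proof.
move=> h; have u0 := nonanti_neq0l h; have v0 := nonanti_neq0r h.
have P : 0 < vnorm u * vnorm v by rewrite mulr_gt0 ?vnorm_gt0.
have [c0|c0] := eqVneq (cross u v) 0.
  case: h => [|d0]; first by rewrite c0 eqxx.
  by rewrite ang_collinear// cos0 mulr1 cross0_dot.
by rewrite /ang cos_sg// acosK ?in_itv/= ?cos_ratio// mulrC divfK// gt_eqF.
Qed.

Lemma sin_ang u v : nonanti u v ->
  vnorm u * vnorm v * sin (ang u v) = cross u v.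
Proof.
move=> h; have u0 := nonanti_neq0l h; have v0 := nonanti_neq0r h.
have P : 0 < vnorm u * vnorm v by rewrite mulr_gt0 ?vnorm_gt0.
rewrite /ang sin_sg sin_acos ?cos_ratio// sqrt_ratio// mulrCA.
by rewrite (mulrC (_ * _) (_ / _)) divfK ?gt_eqF// -numEsg.
Qed.

Lemma ang_bound u v : nonanti u v -> - pi < ang u v < pi.
Proof.
move=> h; have u0 := nonanti_neq0l h; have v0 := nonanti_neq0r h.
have P : 0 < vnorm u * vnorm v by rewrite mulr_gt0 ?vnorm_gt0.
have [c0|c0] := eqVneq (cross u v) 0.
  by rewrite ang_collinear// oppr_lt0 pi_gt0.
have r := cos_ratio u v.
have lt : acos (dot u v / (vnorm u * vnorm v)) < pi.
  apply: acos_ltpi; move: r => /andP[r1 ->]; rewrite andbT lt_neqAle r1 andbT.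
  apply/eqP => e; have := lagrange u v.
  have -> : dot u v = - (vnorm u * vnorm v).
    by rewrite -[LHS](divfK (lt0r_neq0 P)) -e mulN1r.
  rewrite sqrrN -[RHS]addr0 => /addrI /eqP; rewrite sqrf_eq0.
  by rewrite (negbTE c0).
rewrite -ltr_norml /ang normrM normr_sg c0 mul1r ger0_norm//.
exact: acos_ge0.
Qed.

Lemma ang_gt0 u v : 0 < cross u v -> 0 < ang u v < pi.
Proof.
move=> c0; have h : nonanti u v by left; rewrite gt_eqF.
have u0 := nonanti_neq0l h; have v0 := nonanti_neq0r h.
have P : 0 < vnorm u * vnorm v by rewrite mulr_gt0 ?vnorm_gt0.
have /andP[_ ->] := ang_bound h; rewrite andbT.
rewrite /ang gtr0_sg// mul1r; apply: acos_gt0.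
have /andP[-> r1] := cos_ratio u v; rewrite lt_neqAle r1 andbT/=.
apply/eqP => e; have := lagrange u v.
have -> : dot u v = vnorm u * vnorm v by rewrite -[LHS](divfK (lt0r_neq0 P)) e mul1r.
rewrite -[RHS]addr0 => /addrI /eqP; rewrite sqrf_eq0.
by rewrite gt_eqF.
Qed.

Lemma ang_lt0 u v : cross u v < 0 -> - pi < ang u v < 0.
Proof.
by move=> c; rewrite -[ang u v]opprK -angC ltrN2 oppr_lt0 andbC ang_gt0// crossC oppr_gt0.
Qed.

(* The Gaussian product [conj u * v = dot u v + i cross u v] turns a sum of
   angles along a path into a product of complex numbers. *)
Lemma path_ang (W : nat -> pt) n : W 0%N != (0, 0) ->
  (forall i, (i < n)%N -> nonanti (W i) (W i.+1)) ->
  vnorm (W 0%N) * vnorm (W n) * cos (\sum_(i < n) ang (W i) (W i.+1)) =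
    dot (W 0%N) (W n) /\
  vnorm (W 0%N) * vnorm (W n) * sin (\sum_(i < n) ang (W i) (W i.+1)) =
    cross (W 0%N) (W n).
Proof.
move=> W0; elim: n => [_|n IH H].
  rewrite big_ord0 cos0 sin0 mulr1 mulr0 -expr2 sqr_vnorm; split => //.
  by rewrite /cross mulrC subrr.
have [] := IH (fun i h => H i (leqW h)).
have Hn := H n (leqnn _); have := cos_ang Hn; have := sin_ang Hn.
rewrite big_ord_recr /= cosD sinD.
have := vnorm_gt0 (nonanti_neq0l Hn); have := sqr_vnorm (W n).
set S := \sum_(i < n) _; move: (cos S) (sin S) (cos _) (sin _) => {S} C S c s.
move: (vnorm (W n)) (vnorm (W n.+1)) (vnorm (W 0%N)) => N N1 N0.
rewrite /dot /cross => E P.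
case: (W n) E (W n.+1) (W 0%N) => [a b] /= E [p q] [e f] /= h1 h2 h3 h4.
have N20 : N ^+ 2 != 0 by rewrite expf_neq0// gt_eqF.
split; apply: (mulfI N20).
  transitivity ((N0 * N * C) * (N * N1 * c) - (N0 * N * S) * (N * N1 * s)).
    by ring.
  by rewrite h1 h2 h3 h4 E; ring.
transitivity ((N0 * N * S) * (N * N1 * c) + (N0 * N * C) * (N * N1 * s)).
  by ring.
by rewrite h1 h2 h3 h4 E; ring.
Qed.

Lemma cos_eq1_0 (t : R) : cos t = 1 -> - (2 * pi) < t < 2 * pi -> t = 0.
Proof.
wlog t0 : t / 0 <= t => [W|].
  case: (leP 0 t) => t0 c b; first exact: W.
  apply/eqP; rewrite -oppr_eq0; apply/eqP; apply: W; rewrite ?cosN//; lra.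
move=> c b; have p0 := pi_gt0 R; have := @cos_inj R.
case: (leP t pi) => tp inj.
  by apply: inj; rewrite ?cos0 // in_itv/= ?t0 ?lexx ?tp ?(ltW p0).
have : 2 * pi - t = 0.
  apply: inj; rewrite ?in_itv/= ?lexx ?(ltW p0)//.
    by move: b => /andP[_ b2]; apply/andP; split; lra.
  by rewrite cos0 addrC mulr_natl cosD2pi cosN.
lra.
Qed.

Lemma cos_eq1_3pi (t : R) : cos t = 1 -> - (3 * pi) < t < 3 * pi ->
  [\/ t = 0, t = 2 * pi | t = - (2 * pi)].
Proof.
move=> c b; have p0 := pi_gt0 R.
case: (ltP t (2 * pi)) => t1; last first.
  have : t - 2 * pi = 0.
    apply: cos_eq1_0; last lra.
    by rewrite -[LHS]cosD2pi mulr_natl subrK.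
  by move=> e; constructor 2; lra.
case: (ltP (- (2 * pi)) t) => t2; last first.
  have : t + 2 * pi = 0.
    by apply: cos_eq1_0; [rewrite mulr_natl cosD2pi|lra].
  by move=> e; constructor 3; lra.
by constructor 1; apply: cos_eq1_0 => //; apply/andP.
Qed.

Lemma ang3_mod u v w : nonanti u v -> nonanti v w -> nonanti w u ->
  [\/ ang u v + ang v w + ang w u = 0,
      ang u v + ang v w + ang w u = 2 * pi |
      ang u v + ang v w + ang w u = - (2 * pi)].
Proof.
move=> uv vw wu; apply: cos_eq1_3pi; last first.
  by have := ang_bound uv; have := ang_bound vw; have := ang_bound wu; lra.
pose W i := nth u [:: u; v; w; u] i.
have [] := @path_ang W 3 (nonanti_neq0l uv).
  by case=> [|[|[|]]].
rewrite !big_ord_recr big_ord0 /= add0r /W /= -expr2 sqr_vnorm => h _.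
have N : dot u u != 0.
  by rewrite -sqr_vnorm expf_neq0// gt_eqF// vnorm_gt0// (nonanti_neq0l uv).
by apply: (mulfI N); rewrite h mulr1.
Qed.

Lemma ang3_pos u v w : 0 < cross u v -> 0 < cross v w -> 0 < cross w u ->
  ang u v + ang v w + ang w u = 2 * pi.
Proof.
move=> uv vw wu; have := ang_gt0 uv; have := ang_gt0 vw; have := ang_gt0 wu.
have p0 := pi_gt0 R.
have [] : [\/ ang u v + ang v w + ang w u = 0,
      ang u v + ang v w + ang w u = 2 * pi |
      ang u v + ang v w + ang w u = - (2 * pi)].
  by apply: ang3_mod; left; rewrite gt_eqF.
all: lra.
Qed.

Definition comb3 (x y z : R) u v w : pt :=
  (x * u.1 + y * v.1 + z * w.1, x * u.2 + y * v.2 + z * w.2).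

Definition origin_in_hull u v w := exists x y z : R,
  [/\ 0 <= x, 0 <= y, 0 <= z, 0 < x + y + z & comb3 x y z u v w = (0, 0)].

Lemma origin_in_hullC u v w : origin_in_hull v w u -> origin_in_hull u v w.
Proof.
move=> [x [y [z [x0 y0 z0 s e]]]]; exists z, x, y; split => //; first by lra.
by case: e; rewrite /comb3 => e1 e2; congr (_, _); [rewrite -e1; ring|rewrite -e2; ring].
Qed.

Lemma nonanti_hull u v w : ~ origin_in_hull u v w -> nonanti u v.
Proof.
move=> H; have [c0|c0] := eqVneq (cross u v) 0; last by left.
have [d0|d0] := ltP 0 (dot u v); first by right.
exfalso; apply: H.
have [v0|v0] := eqVneq v (0, 0).
  exists 0, 1, 0; split; [lra|lra|lra|lra|].
  by rewrite /comb3 v0 /= !mul0r mulr0 !addr0.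
(* For collinear vectors [(dot v v) u = (dot u v) v], and [dot u v <= 0] makes both weights
   nonnegative. *)
exists (dot v v), (- dot u v), 0.
have P : 0 < dot v v by rewrite -sqr_vnorm exprn_gt0 ?vnorm_gt0.
split; [lra|lra|lra|lra|].
rewrite /comb3 !mul0r !addr0.
move: c0; rewrite /dot /cross => c0; congr (_, _).
  transitivity ((u.1 * v.2 - u.2 * v.1) * v.2); first by ring.
  by rewrite c0 mul0r.
transitivity (- (u.1 * v.2 - u.2 * v.1) * v.1); first by ring.
by rewrite c0 oppr0 mul0r.
Qed.

(** The sum is 0 or plus or minus [2 * pi]. In the last two cases all three angles have the same
    sign, each being below [pi] in absolute value; then the three cross products, up to that sign
    [s], are positive weights of a vanishing combination of [u], [v], [w]. *)
Lemma ang_cocycle u v w : ~ origin_in_hull u v w -> ang u v + ang v w + ang w u = 0.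
Proof.
move=> H.
have uv := nonanti_hull H.
have vw : nonanti v w.
  by apply: (@nonanti_hull v w u) => K; apply: H; apply: origin_in_hullC.
have wu : nonanti w u.
  by apply: (@nonanti_hull w u v) => K; apply: H; do 2 apply: origin_in_hullC.
have p0 := pi_gt0 R.
have bary (s : R) : 0 < s * cross u v -> 0 < s * cross v w -> 0 < s * cross w u -> False.
  move=> a b c; apply: H; exists (s * cross v w), (s * cross w u), (s * cross u v).
  by split; [lra|lra|lra|lra|]; rewrite /comb3 /cross; congr (_, _); ring.
have := ang_bound uv; have := ang_bound vw; have := ang_bound wu.
have sgn a b : nonanti a b -> (0 < ang a b -> 0 < 1 * cross a b) /\
    (ang a b < 0 -> 0 < -1 * cross a b).
  move=> ab; case: (ltrgtP (cross a b) 0) => c.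
  - by have := ang_lt0 c; split; lra.
  - by have := ang_gt0 c; split; lra.
  - by rewrite (ang_collinear c); split; lra.
have [suv suv'] := sgn _ _ uv; have [svw svw'] := sgn _ _ vw.
have [swu swu'] := sgn _ _ wu.
move=> b1 b2 b3; case: (ang3_mod uv vw wu) => // e; exfalso.
  by apply: (bary 1); [apply: suv|apply: svw|apply: swu]; lra.
by apply: (bary (-1)); [apply: suv'|apply: svw'|apply: swu']; lra.
Qed.

(** A linear form positive on all three vectors keeps the origin out of their convex hull. *)
Lemma ang3_half (n1 n2 : R) u v w : 0 < n1 * u.1 + n2 * u.2 ->
  0 < n1 * v.1 + n2 * v.2 -> 0 < n1 * w.1 + n2 * w.2 ->
  ang u v + ang v w = ang u w.
Proof.
move=> hu hv hw; suff : ang u v + ang v w + ang w u = 0 by rewrite (angC u w); lra.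
apply: ang_cocycle => -[x [y [z [x0 y0 z0 s [e1 e2]]]]].
have : x * (n1 * u.1 + n2 * u.2) + y * (n1 * v.1 + n2 * v.2)
  + z * (n1 * w.1 + n2 * w.2) = 0.
  transitivity (n1 * (x * u.1 + y * v.1 + z * w.1) + n2 * (x * u.2 + y * v.2 + z * w.2)).
    by ring.
  by rewrite e1 e2; ring.
have := mulr_ge0 x0 (ltW hu); have := mulr_ge0 y0 (ltW hv); have := mulr_ge0 z0 (ltW hw).
case: (ltrgtP x 0) => xx; [lra| |].
  by have := mulr_gt0 xx hu; lra.
case: (ltrgtP y 0) => yy; [lra| |].
  by have := mulr_gt0 yy hv; lra.
have zz : 0 < z by lra.
by have := mulr_gt0 zz hw; lra.
Qed.

Lemma angNN u v : ang (vsub (0, 0) u) (vsub (0, 0) v) = ang u v.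
Proof.
rewrite /ang /vnorm /dot /cross /vsub /= !sub0r !mulrNN.
by congr (Num.sg _ * _); ring.
Qed.

Lemma ang_suppl u v : 0 < cross u v -> ang v (vsub (0, 0) u) = pi - ang u v.
Proof.
move=> c; have c' : 0 < cross v (vsub (0, 0) u).
  by move: c; rewrite /cross /vsub /=; lra.
rewrite /ang !gtr0_sg// !mul1r -acosN ?cos_ratio//; congr acos.
rewrite -mulNr; congr (_ / _); first by rewrite /dot /vsub/=; ring.
by rewrite mulrC; congr (_ * _); rewrite /vnorm /dot /vsub /= !sub0r !mulrNN.
Qed.

End Angles.

(** * The Umlaufsatz for polygons *)

Section Loops.
Variable R : realType.
Notation pt := (R * R)%type.
Implicit Types u v w a b c d x : pt.

Lemma seg_l a b : seg a b a.
Proof.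
by exists 0; rewrite ?lexx ?ler01// !mul0r !addr0 -surjective_pairing.
Qed.

Lemma seg_sym a b x : seg a b x -> seg b a x.
Proof.
move=> [t tb ->]; exists (1 - t); first by lra.
by congr (_, _); ring.
Qed.

Lemma seg_r a b : seg a b b.
Proof. exact/seg_sym/seg_l. Qed.

(** Both sides equal the angle from [vsub c a] to [vsub d b]: this diagonal cuts the square of
    secants into two triangles. Each satisfies [ang_cocycle], because a vanishing convex combination
    of its secants is a common point of the two segments. *)
Lemma ang_para a b c d : (forall x, seg a b x -> seg c d x -> False) ->
  ang (vsub c a) (vsub d a) + ang (vsub d a) (vsub d b) =
  ang (vsub c a) (vsub c b) + ang (vsub c b) (vsub d b).
Proof.
move=> H.
have H1 : ~ origin_in_hull (vsub c a) (vsub d a) (vsub d b).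
  move=> [x [y [z [x0 y0 z0 s [e1 e2]]]]].
  have s0 : x + y + z != 0 by rewrite gt_eqF.
  apply: (H (a.1 + z / (x + y + z) * (b.1 - a.1), a.2 + z / (x + y + z) * (b.2 - a.2))).
    by exists (z / (x + y + z)) => //; rewrite divr_ge0 ?(ltW s)//= ler_pdivrMr//; lra.
  exists ((y + z) / (x + y + z)).
    by rewrite divr_ge0 ?(ltW s) ?addr_ge0//= ler_pdivrMr//; lra.
  move: e1 e2; rewrite /vsub /= => e1 e2.
  congr (_, _); apply: (mulfI s0); apply/eqP; rewrite -subr_eq0; apply/eqP.
    by rewrite -[RHS]oppr0 -e1; field.
  by rewrite -[RHS]oppr0 -e2; field.
have H2 : ~ origin_in_hull (vsub c a) (vsub c b) (vsub d b).
  move=> [x [y [z [x0 y0 z0 s [e1 e2]]]]].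
  have s0 : x + y + z != 0 by rewrite gt_eqF.
  apply: (H (a.1 + (y + z) / (x + y + z) * (b.1 - a.1), a.2 + (y + z) / (x + y + z) * (b.2 - a.2))).
    exists ((y + z) / (x + y + z)) => //.
    by rewrite divr_ge0 ?(ltW s) ?addr_ge0//= ler_pdivrMr//; lra.
  exists (z / (x + y + z)).
    by rewrite divr_ge0 ?(ltW s)//= ler_pdivrMr//; lra.
  move: e1 e2; rewrite /vsub /= => e1 e2.
  congr (_, _); apply: (mulfI s0); apply/eqP; rewrite -subr_eq0; apply/eqP.
    by rewrite -[RHS]oppr0 -e1; field.
  by rewrite -[RHS]oppr0 -e2; field.
by have := ang_cocycle H1; have := ang_cocycle H2; lra.
Qed.

(** The degenerate, triangular cell of the secant grid. A vanishing combination of the three secants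
    is again a common point of the segments, hence [b], and this forces all weights to be 0. *)
Lemma ang_adj a b c : a != b -> b != c ->
  (forall x, seg a b x -> seg b c x -> x = b) ->
  ang (vsub b a) (vsub c a) + ang (vsub c a) (vsub c b) =
  ang (vsub b a) (vsub c b).
Proof.
move=> ab bc H.
suff : ang (vsub b a) (vsub c a) + ang (vsub c a) (vsub c b) +
    ang (vsub c b) (vsub b a) = 0 by rewrite (angC (vsub b a) (vsub c b)); lra.
apply: ang_cocycle; move=> [x [y [z [x0 y0 z0 s [e1 e2]]]]].
have s0 : x + y + z != 0 by rewrite gt_eqF.
move: e1 e2; rewrite /vsub /= => e1 e2.
pose p := (a.1 + z / (x + y + z) * (b.1 - a.1), a.2 + z / (x + y + z) * (b.2 - a.2)).
have p1 : seg a b p.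
  by exists (z / (x + y + z)) => //; rewrite divr_ge0 ?(ltW s)//= ler_pdivrMr//; lra.
have pE : p = (b.1 + (y + z) / (x + y + z) * (c.1 - b.1),
               b.2 + (y + z) / (x + y + z) * (c.2 - b.2)).
  congr (_, _); apply: (mulfI s0); apply/eqP; rewrite -subr_eq0; apply/eqP.
    by rewrite -[RHS]oppr0 -e1; field.
  by rewrite -[RHS]oppr0 -e2; field.
have p2 : seg b c p.
  exists ((y + z) / (x + y + z)) => //.
  by rewrite divr_ge0 ?(ltW s) ?addr_ge0//= ler_pdivrMr//; lra.
have pb := H _ p1 p2.
have K (k : R) (f g : pt) : f != g ->
    f.1 + k / (x + y + z) * (g.1 - f.1) = f.1 ->
    f.2 + k / (x + y + z) * (g.2 - f.2) = f.2 -> k = 0.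
  move=> fg /eqP; rewrite -subr_eq0 addrC addKr mulf_eq0 => h1.
  move=> /eqP; rewrite -subr_eq0 addrC addKr mulf_eq0 => h2.
  have [k0|k0] := eqVneq (k / (x + y + z)) 0.
    by rewrite -[LHS](divfK s0) k0 mul0r.
  move: h1 h2; rewrite (negbTE k0) /= !subr_eq0 => /eqP h1 /eqP h2.
  by move: fg; rewrite (surjective_pairing f) (surjective_pairing g) h1 h2 eqxx.
have yz : y + z = 0.
  by apply: (K _ b c bc); [move: (congr1 fst pE)|move: (congr1 snd pE)]; rewrite pb.
have xy : x + y = 0.
  apply: (K _ b a); first by rewrite eq_sym.
    rewrite -[RHS](congr1 fst pb) /=; field; exact: s0.
  rewrite -[RHS](congr1 snd pb) /=; field; exact: s0.
lra.
Qed.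

Lemma seg_ray a b c : b != c ->
  (forall x, seg a b x -> seg b c x -> x = b) ->
  cross (vsub c b) (vsub a b) = 0 -> dot (vsub c b) (vsub a b) <= 0.
Proof.
move=> bc H c0; rewrite leNgt; apply/negP => D0.
set u := vsub c b in c0 D0; set w := vsub a b in c0 D0.
have w0 : w != (0, 0).
  by apply/eqP => e; move: D0; rewrite e /dot /= !mulr0 addr0 ltxx.
have W0 : 0 < dot w w by rewrite -sqr_vnorm exprn_gt0 ?vnorm_gt0.
(* If [u] and [w] pointed the same way, both segments would contain the point [b + (dot w w / m) u =
   b + (dot u w / m) w]; dividing by the maximum brings both parameters into the unit interval. *)
pose m := Num.max (dot u w) (dot w w).
have mD : dot u w <= m by rewrite le_max lexx.
have mW : dot w w <= m by rewrite le_max lexx orbT.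
have m0 : 0 < m by exact: lt_le_trans W0 mW.
have bd (k : R) : 0 < k -> k <= m -> 0 <= k / m <= 1.
  by move=> k0 km; rewrite divr_ge0 ?(ltW m0) ?(ltW k0)//= ler_pdivrMr ?mul1r.
have e1 : dot w w * u.1 = dot u w * w.1.
  apply/eqP; rewrite -subr_eq0; apply/eqP.
  by transitivity (w.2 * cross u w); [rewrite /cross /dot; ring|rewrite c0 mulr0].
have e2 : dot w w * u.2 = dot u w * w.2.
  apply/eqP; rewrite -subr_eq0; apply/eqP.
  by transitivity (- w.1 * cross u w); [rewrite /cross /dot; ring|rewrite c0 mulr0].
have : seg a b (b.1 + dot w w / m * u.1, b.2 + dot w w / m * u.2).
  apply: seg_sym; exists (dot u w / m); first exact: bd.
  by rewrite ![dot w w / m * _]mulrAC ![dot u w / m * _]mulrAC e1 e2.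
move=> /H /(_ _) E; have {}E := E _.
have /E : seg b c (b.1 + dot w w / m * u.1, b.2 + dot w w / m * u.2).
  by exists (dot w w / m); first exact: bd.
have hWm : dot w w / m != 0 by rewrite mulf_neq0// ?gt_eqF// invr_gt0.
move=> /[dup] /(congr1 fst) /= /eqP.
rewrite -subr_eq0 addrC addKr mulf_eq0 (negbTE hWm)/= subr_eq0 => /eqP u1.
move=> /(congr1 snd) /= /eqP.
rewrite -subr_eq0 addrC addKr mulf_eq0 (negbTE hWm)/= subr_eq0 => /eqP u2.
by move: bc; rewrite (surjective_pairing b) (surjective_pairing c) u1 u2 eqxx.
Qed.

(* Periodicity lets any vertex of the polygon serve as [V 0]. *)
Record simple_loop n (V : nat -> pt) : Prop := SimpleLoop {
  loop_size : (3 <= n)%N;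
  loop_periodic : forall i, V (i + n)%N = V i;
  loop_inj : forall i j, (i < n)%N -> (j < n)%N -> V i = V j -> i = j;
  loop_adj : forall i x,
    seg (V i) (V i.+1) x -> seg (V i.+1) (V i.+2) x -> x = V i.+1;
  loop_far : forall i j, (i.+1 < j)%N -> (j < n)%N ->
    ~~ ((i == 0%N) && (j == n.-1)) ->
    forall x, seg (V i) (V i.+1) x -> seg (V j) (V j.+1) x -> False }.

Lemma loop_mod n V i : simple_loop n V -> V i = V (i %% n)%N.
Proof.
move=> L; rewrite {1}(divn_eq i n) addnC.
elim: (i %/ n)%N => [|q IH]; first by rewrite mul0n addn0.
by rewrite mulSn addnCA addnC (loop_periodic L).
Qed.

Lemma loop_neq n V i : simple_loop n V -> V i != V i.+1.
Proof.
move=> L; have n3 := loop_size L.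
apply/eqP; rewrite (loop_mod _ L) (loop_mod i.+1 L) => /(loop_inj L).
rewrite !ltn_mod (leq_trans _ n3)// => /(_ isT isT).
move/eqP; rewrite -[X in X == _](@modn_small _ n) ?ltn_mod ?(leq_trans _ n3)//.
rewrite modn_mod -addn1 -[X in X == _ %[mod _]]addn0 eqn_modDl.
by rewrite mod0n modn_small//; lia.
Qed.

Section Hopf.
Variables (n : nat) (V : nat -> pt).
Hypothesis L : simple_loop n V.

Let A s t := vsub (V t) (V s).
Let h s t := ang (A s t) (A s t.+1).
Let v s t := ang (A s t) (A s.+1 t).
Definition turn s := ang (vsub (V s.+1) (V s)) (vsub (V s.+2) (V s.+1)).

(* Hopf's secant argument: the angle form, evaluated along [V t - V s], is closed
   on the cells of the grid [s < t]; this is one row of cells. *)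
Lemma hopf_row s k : (s.+2 <= k <= n)%N -> (s == 0 -> k < n)%N ->
  \sum_(s.+1 <= t < k) h s t + v s k =
  turn s + \sum_(s.+2 <= t < k) h s.+1 t.
Proof.
case/andP; elim: k => // k IH sk kn s0.
rewrite ltnS leq_eqVlt in sk; case/orP: sk => [/eqP<-|sk].
  rewrite big_nat1 big_geq// addr0; apply: ang_adj (loop_neq _ L) (loop_neq _ L) _.
  exact: (loop_adj L).
have {}IH := IH sk (ltnW kn) (fun e => ltn_trans (ltnSn k) (s0 e)).
rewrite !big_nat_recr/=; [|lia|lia].
rewrite addrA -IH.
(* [loop_far] leaves out the edges [0] and [n.-1], which meet in [V 0]; the condition for [s = 0]
   keeps their cell out of the row. *)
have := @ang_para (V s) (V s.+1) (V k) (V k.+1) (loop_far L _ _ _).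
rewrite -/(h s k) -/(v s k.+1) -/(v s k) -/(h s.+1 k) => E.
have {}E : h s k + v s k.+1 = v s k + h s.+1 k.
  apply: E; [lia|lia|].
  by apply/negP => /andP[e]; move: (s0 e) => ? /eqP; lia.
by rewrite -addrA E addrA.
Qed.

Variables n1 n2 : R.
Hypothesis half : forall t, (0 < t < n)%N ->
  0 < n1 * (vsub (V t) (V 0%N)).1 + n2 * (vsub (V t) (V 0%N)).2.

Lemma sum_ang_half k : (0 < k < n)%N ->
  \sum_(1 <= t < k) ang (vsub (V t) (V 0%N)) (vsub (V t.+1) (V 0%N)) =
  ang (vsub (V 1%N) (V 0%N)) (vsub (V k) (V 0%N)).
Proof.
elim: k => // k IH kn.
have [->|k0] := posnP k.
  by rewrite big_geq// ang_collinear// /cross; ring.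
rewrite big_nat_recr//= IH; last lia.
apply: (ang3_half (n1 := n1) (n2 := n2)); apply: half; lia.
Qed.

(** On the diagonal of the grid the secants are the edges, so the left side is the sum along the
    diagonal. Moving it to the two legs gives twice the angle swept from [V 0]. The corner of the
    grid where the secant from [V 0] to [V n] vanishes is cut off; this costs the turn at [V 0],
    which also occurs once on the diagonal itself. *)
Lemma hopf_sum :
  \sum_(i < n) turn i =
    2 * ang (vsub (V 1%N) (V 0%N)) (vsub (V n.-1) (V 0%N)) +
    2 * ang (vsub (V 0%N) (V n.-1)) (vsub (V 1%N) (V 0%N)).
Proof.
have n3 := loop_size L.
have Vn : V n = V 0%N by rewrite -[n]add0n (loop_periodic L).
have Vn1 : V n.+1 = V 1%N by rewrite -[n.+1]add1n (loop_periodic L).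
set al := ang (vsub (V 1%N) _) _; set t0 := ang (vsub (V 0%N) (V n.-1)) _.
have nE : n = n.-1.+1 by lia.
have tl : turn n.-1 = t0 by rewrite /turn -nE Vn Vn1.
have r0 : \sum_(1 <= t < n.-1) h 0 t + v 0 n.-1 =
    turn 0 + \sum_(2 <= t < n.-1) h 1 t.
  by apply: hopf_row; lia.
have rs j : (1 <= j < n)%N ->
    \sum_(2 <= t < n) h 1 t + \sum_(1 <= s < j) v s n =
    \sum_(1 <= s < j) turn s + \sum_(j.+1 <= t < n) h j t.
  elim: j => // j IH jn.
  have [->|j0] := posnP j; first by rewrite [X in _ + X = _]big_geq// [X in _ = X + _]big_geq//
      addr0 add0r.
  rewrite !(@big_nat_recr _ _ _ j)//= addrA IH; last lia.
  by rewrite -addrA hopf_row; [rewrite addrA|lia|lia].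
have {rs} := rs n.-1; rewrite -nE => /(_ ltac:(lia)).
rewrite [X in _ = _ + X]big_geq// addr0.
have -> : \sum_(1 <= s < n.-1) v s n = al.
  rewrite /al -sum_ang_half; last lia.
  apply: eq_bigr => s _; rewrite /v /A Vn -[RHS]angNN /vsub /= !sub0r !opprB//.
rewrite {1}nE big_nat_recr /=; last lia.
(* The cell at the cut-off corner: its edges are adjacent in [V 0], so it is triangular. *)
have lc : v 0 n.-1 + h 1 n.-1 = t0.
  have ab : V n.-1 != V 0%N by rewrite -Vn [X in _ != V X]nE; exact: loop_neq L.
  have H x : seg (V n.-1) (V 0%N) x -> seg (V 0%N) (V 1%N) x -> x = V 0%N.
    by have := @loop_adj _ _ L n.-1 x; rewrite -nE Vn Vn1.
  have := ang_adj ab (loop_neq 0 L) H.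
  rewrite -[ang _ (vsub (V 1%N) (V n.-1))]angNN -[ang _ (vsub (V 1%N) (V 0%N))]angNN.
  by rewrite /t0 /v /h /A -nE Vn /vsub /= !sub0r !opprB.
have a1 : \sum_(1 <= t < n.-1) h 0 t = al by apply: sum_ang_half; lia.
rewrite a1 in r0.
have -> : \sum_(i < n) turn i = turn 0 + \sum_(1 <= s < n.-1) turn s + t0.
  rewrite -(big_mkord xpredT turn) [X in \sum_(0 <= i < X) _]nE big_nat_recr//= tl; congr (_ + _).
  by rewrite big_ltn//; lia.
by move: r0 lc; lra.
Qed.

(* [V 0] lies strictly on one side of all other vertices, so the first and
   last edge form there an angle [al] with [al + turning = pi] or [- pi]. *)
Lemma hopf (s : R) : s * s = 1 ->
  0 <= s * ang (vsub (V 1%N) (V 0%N)) (vsub (V n.-1) (V 0%N)) ->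
  s * \sum_(i < n) turn i = 2 * pi.
Proof.
move=> s1; rewrite hopf_sum.
set u := vsub (V 1%N) _; set w := vsub (V n.-1) _.
have -> : vsub (V 0%N) (V n.-1) = vsub (0, 0) w.
  by rewrite /w /vsub /= !sub0r !opprB.
have n3 := loop_size L; have p0 := pi_gt0 R.
(* Opposite directions are excluded by the half-plane, equal directions by simplicity of the
   loop. *)
have c0 : cross u w != 0.
  apply/eqP => c0.
  have hu : 0 < n1 * u.1 + n2 * u.2 by apply: half; lia.
  have hw : 0 < n1 * w.1 + n2 * w.2 by apply: half; lia.
  have Vn : V n = V 0%N by rewrite -[n]add0n (loop_periodic L).
  have nE : n.-1.+1 = n by lia.
  have := @seg_ray (V n.-1) (V 0%N) (V 1%N) (loop_neq 0 L).
  rewrite -/u -/w => /(_ _ c0) K.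
  have {K} : dot u w <= 0.
    apply: K => x; have := @loop_adj _ _ L n.-1 x.
    by rewrite nE -[n.+1]add1n (loop_periodic L) Vn.
  apply/negP; rewrite -ltNge.
  have E : (n1 * w.1 + n2 * w.2) * dot u w = (n1 * u.1 + n2 * u.2) * dot w w.
    apply/eqP; rewrite -subr_eq0; apply/eqP.
    transitivity ((n2 * w.1 - n1 * w.2) * cross u w); first by rewrite /cross /dot; ring.
    by rewrite c0 mulr0.
  have w0 : w != (0, 0).
    by apply/eqP => e; move: hw; rewrite e /= !mulr0 addr0 ltxx.
  rewrite -(pmulr_rgt0 _ hw) E mulr_gt0//.
  by rewrite -sqr_vnorm exprn_gt0 ?vnorm_gt0.
case: (ltrgtP (cross u w) 0) c0 => // c _.
  have c' : 0 < cross w u by rewrite crossC oppr_gt0.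
  have := ang_lt0 c; move=> al sa.
  have -> : ang (vsub (0, 0) w) u = - pi - ang u w.
    by have := ang_suppl c'; rewrite (angC u w) (angC (vsub (0,0) w) u); lra.
  have : (s - 1) * (s + 1) = 0 by lra.
  move/eqP; rewrite mulf_eq0 => /orP[] /eqP h1; [have hs: s = 1 by lra|have hs: s = -1 by lra].
    by move: sa; rewrite hs; lra.
  by rewrite hs; lra.
have := ang_gt0 c; move=> al sa.
have -> : ang (vsub (0, 0) w) u = pi - ang u w.
  have c' : 0 < cross (vsub (0,0) w) u by move: c; rewrite /cross /vsub /=; lra.
  have := ang_suppl c'; rewrite (angC (vsub (0, 0) (vsub (0, 0) w)) u).
  by have -> : vsub (0, 0) (vsub (0, 0) w) = w;
    [rewrite /vsub /= !sub0r !opprK|rewrite (angC u w); lra].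
have : (s - 1) * (s + 1) = 0 by lra.
move/eqP; rewrite mulf_eq0 => /orP[] /eqP h1; [have hs: s = 1 by lra|have hs: s = -1 by lra].
  by rewrite hs; lra.
by move: sa; rewrite hs; lra.
Qed.

End Hopf.
End Loops.

(** * Additive functionals on a closed polygon *)

Section Chain.
Variable R : realType.
Notation pt := (R * R)%type.
Implicit Types u v w a b c d x y z : pt.

Lemma seg_refl a x : seg a a x -> x = a.
Proof. by move=> [t _ ->]; rewrite !subrr !mulr0 !addr0 -surjective_pairing. Qed.

Lemma seg_conv c d a b x : seg c d a -> seg c d b -> seg a b x -> seg c d x.
Proof.
move=> [s s01 ->] [t t01 ->] [r r01 ->]; exists ((1 - r) * s + r * t).
  by nra.
by congr (_, _) => /=; ring.
Qed.

Lemma seg_split a b c : seg a c b -> forall x, seg a c x -> seg a b x \/ seg b c x.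
Proof.
move=> [t t01 ->] x [s s01 ->]; case: (leP s t) => st.
  left; have [t0|t0] := eqVneq t 0.
    have -> : s = 0 by lra.
    by exists 0; rewrite ?lexx ?ler01 ?t0// !mul0r !addr0.
  have tp : 0 < t by rewrite lt0r t0; lra.
  exists (s / t); first by rewrite divr_ge0 ?ler_pdivrMr//; lra.
  by congr (_, _) => /=; field.
right; have tp : 1 - t != 0 by rewrite gt_eqF//; lra.
exists ((s - t) / (1 - t)); first by rewrite divr_ge0 ?ler_pdivrMr//; lra.
by congr (_, _) => /=; field.
Qed.

(** A 1-cochain compatible with subdivision. The instances that matter are [cross], which integrates
    to the area, and the angle seen from a fixed point, which integrates to the winding angle. *)
Record seg_additive (f : pt -> pt -> R) : Prop := SegAdditive {
  seg_anti : forall a b, f b a = - f a b;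
  seg_add : forall a b c, seg a c b -> f a c = f a b + f b c }.

Lemma seg_add0 f a : seg_additive f -> f a a = 0.
Proof. by move=> F; have := seg_anti F a a; lra. Qed.

Lemma cross_additive : seg_additive (@cross R).
Proof.
split; first exact: crossC.
by move=> a b c [t _ ->]; rewrite /cross /=; ring.
Qed.

Lemma ang_additive x : seg_additive (fun a b => ang (vsub a x) (vsub b x)).
Proof.
split; first by move=> a b; rewrite angC.
move=> a b c abc.
have [c0|c0] := eqVneq (cross (vsub a x) (vsub c x)) 0.
  case: abc => t _ ->; rewrite !ang_collinear ?addr0//; last first.
    transitivity (t * cross (vsub a x) (vsub c x)); last by rewrite c0 mulr0.
    by rewrite /cross /vsub /=; ring.
  transitivity ((1 - t) * cross (vsub a x) (vsub c x)); last by rewrite c0 mulr0.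
  by rewrite /cross /vsub /=; ring.
suff : ang (vsub a x) (vsub b x) + ang (vsub b x) (vsub c x) + ang (vsub c x) (vsub a x) = 0.
  by rewrite (angC (vsub a x) (vsub c x)); lra.
case: abc => t t01 ->.
apply: ang_cocycle => -[p [q [r [p0 q0 r0 s [e1 e2]]]]].
move: e1 e2; rewrite /vsub /= => e1 e2.
have k : (p + q * (1 - t)) * cross (vsub a x) (vsub c x) = 0.
  have := congr1 (fun z : R => z * (c.2 - x.2)) e1; have := congr1 (fun z : R => z * (c.1 -
      x.1)) e2.
  by rewrite /= !mul0r /cross /vsub /=; lra.
have k' : (r + q * t) * cross (vsub a x) (vsub c x) = 0.
  have := congr1 (fun z : R => z * (a.2 - x.2)) e1; have := congr1 (fun z : R => z * (a.1 -
      x.1)) e2.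
  by rewrite /= !mul0r /cross /vsub /=; lra.
move: k k' => /eqP; rewrite mulf_eq0 (negbTE c0) orbF => /eqP k.
by move=> /eqP; rewrite mulf_eq0 (negbTE c0) orbF => /eqP k'; lra.
Qed.

Section Potential.
Variables (n : nat) (V : nat -> pt) (n1 n2 : R).
Hypothesis L : simple_loop n V.
Hypothesis half : forall t, (0 < t < n)%N ->
  0 < n1 * (vsub (V t) (V 0%N)).1 + n2 * (vsub (V t) (V 0%N)).2.

Let n3 : (3 <= n)%N := loop_size L.
Let Vn : V n = V 0%N.
Proof. by rewrite -[n]add0n (loop_periodic L). Qed.

Definition trace x := exists2 i, (i < n)%N & seg (V i) (V i.+1) x.

Lemma trace_half y : trace y -> y = V 0%N \/
  0 < n1 * (vsub y (V 0%N)).1 + n2 * (vsub y (V 0%N)).2.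
Proof.
move=> [i iN [t t01 ->]].
pose phi y := n1 * (vsub y (V 0%N)).1 + n2 * (vsub y (V 0%N)).2.
have e : phi ((V i).1 + t * ((V i.+1).1 - (V i).1), (V i).2 + t * ((V i.+1).2 - (V i).2))
  = (1 - t) * phi (V i) + t * phi (V i.+1) by rewrite /phi /vsub /=; ring.
rewrite -/(phi _) e.
have phi0 : phi (V 0%N) = 0 by rewrite /phi /vsub /=; ring.
have [i0|i0] := posnP i.
  subst i; rewrite phi0; have h := half (t := 1%N) ltac:(lia); rewrite -/(phi _) in h.
  have [->|t0] := eqVneq t 0.
    by left; rewrite !mul0r !addr0 -surjective_pairing.
  by right; rewrite mulr0 add0r mulr_gt0// lt0r t0; lra.
have hi := half (t := i) ltac:(lia); rewrite -/(phi _) in hi.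
have [i1|i1] := eqVneq i.+1 n.
  rewrite i1 Vn phi0.
  have [->|t0] := eqVneq t 1.
    by left; rewrite [RHS]surjective_pairing; congr (_, _); ring.
  right; rewrite mulr0 addr0 mulr_gt0// subr_gt0 lt_neqAle t0; lra.
have hi' := half (t := i.+1) ltac:(lia); rewrite -/(phi _) in hi'.
by right; nra.
Qed.

(** [V 0] is a strictly extreme point of the loop, so a segment contained in the loop cannot pass
    through it. This is why the loop is cut there: boundary segments may start or end at the cut but
    never cross it. *)
Lemma extreme a b : trace a -> trace b -> seg a b (V 0%N) ->
  a = V 0%N \/ b = V 0%N.
Proof.
move=> /trace_half[->|ha]; first by left.
move=> /trace_half[->|hb]; first by right.
move=> [t t01 e]; exfalso.
have e1 := congr1 fst e; have e2 := congr1 snd e.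
move: ha hb e1 e2; rewrite /vsub /= => ha hb e1 e2.
have : (1 - t) * (n1 * (a.1 - (V 0%N).1) + n2 * (a.2 - (V 0%N).2)) +
  t * (n1 * (b.1 - (V 0%N).1) + n2 * (b.2 - (V 0%N).2)) = 0.
  transitivity (n1 * (a.1 + t * (b.1 - a.1) - (V 0%N).1) +
    n2 * (a.2 + t * (b.2 - a.2) - (V 0%N).2)); first by ring.
  by rewrite -e1 -e2; ring.
set A := n1 * _ + _ in ha *; set B := n1 * (b.1 - _) + _ in hb *.
by nra.
Qed.

Lemma loop_meet i j x : (i < j < n)%N -> seg (V i) (V i.+1) x ->
  seg (V j) (V j.+1) x ->
  (j = i.+1 /\ x = V j) \/ [/\ i = 0%N, j = n.-1 & x = V 0%N].
Proof.
move=> ij xi xj.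
have [e|e] := eqVneq j i.+1.
  by left; split => //; rewrite e; rewrite e in xj; exact: (loop_adj L) xi xj.
right; case: (boolP ((i == 0%N) && (j == n.-1))) => [/andP[/eqP i0 /eqP j0]|h].
  subst i j; split => //; rewrite -Vn.
  have := loop_adj L (i := n.-1) (x := x).
  have -> : n.-1.+1 = n by lia.
  rewrite -[n.+1]add1n (loop_periodic L) Vn; apply => //.
  by rewrite -Vn; have <- : n.-1.+1 = n by lia.
by exfalso; apply: (loop_far L _ _ h xi xj); lia.
Qed.

Section Functional.
Variable f : pt -> pt -> R.
Hypothesis F : seg_additive f.

(* On the loop [f] has the primitive [pot], which is multivalued at [V 0]: a step
   arriving there along the last edge gains [circ], see [jump] below. *)
Definition circ := \sum_(j < n) f (V j) (V j.+1).
Definition pot x : R :=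
  if x == V 0%N then 0 else
  let i := xget 0%N [set i | (i < n)%N /\ seg (V i) (V i.+1) x] in
  \sum_(j < i) f (V j) (V j.+1) + f (V i) x.

(** The edge picked by [xget] does not matter: two edges meet only in consecutive vertices, where
    the partial sums agree. The exception is [V 0] as the end of the last edge, where the whole of
    [circ] has accumulated while [pot] is 0. *)
Lemma pot_edge i x : (i < n)%N -> seg (V i) (V i.+1) x ->
  \sum_(j < i) f (V j) (V j.+1) + f (V i) x =
  pot x + circ * ((i == n.-1) && (x == V 0%N))%:R.
Proof.
move=> iN ix; rewrite /pot; have [x0|x0] := eqVneq x (V 0%N).
  rewrite andbT add0r; have [->|i0] := posnP i.
    rewrite big_ord0 add0r x0 seg_add0//.
    by rewrite (_ : (0%N == n.-1) = false) ?mulr0//; lia.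
  have s0 : seg (V 0%N) (V 1%N) x by rewrite x0; exact: seg_l.
  have [[_ e]|[_ -> _]] := loop_meet (i := 0%N) (j := i) ltac:(lia) s0 ix.
    have := loop_inj L (i := 0%N) (j := i); rewrite -x0 -e => /(_ _ _ erefl).
    by lia.
  rewrite eqxx mulr1 x0 /circ -[in RHS](@prednK n) ?big_ord_recr/=; last lia.
  by rewrite prednK ?Vn//; lia.
rewrite andbF mulr0 addr0.
case: xgetP => [k _ [kN kx]|/(_ i)]; last by case.
have step (a b : nat) : (a < b < n)%N -> seg (V a) (V a.+1) x -> seg (V b) (V b.+1) x ->
  \sum_(j < a) f (V j) (V j.+1) + f (V a) x = \sum_(j < b) f (V j) (V j.+1) + f (V b) x.
  move=> ab xa xb; have [[-> ->]|[_ _ /eqP]] := loop_meet ab xa xb.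
    by rewrite (seg_add0 (V a.+1) F) addr0 big_ord_recr.
  by rewrite (negbTE x0).
have [ik|ki|->//] := ltngtP i k; first by apply: step => //; apply/andP.
by apply/esym/step => //; apply/andP.
Qed.

End Functional.

(** The segment from [a] arrives at [V 0] in the direction of the last edge; since both end in
    [V 0], one further common point says so. For [a = V 0] it fails, as it should. *)
Definition overlap a := exists x, [/\ x != V 0%N, seg a (V 0%N) x & seg (V n.-1) (V 0%N) x].

Definition jump a b : R :=
  ((b == V 0%N) && `[< overlap a >])%:R - ((a == V 0%N) && `[< overlap b >])%:R.

Lemma pot_seg_edge f a b i : seg_additive f -> (i < n)%N ->
  seg (V i) (V i.+1) a -> seg (V i) (V i.+1) b ->
  f a b = pot f b - pot f a + circ f * jump a b.
Proof.
move=> F iN ia ib.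
have -> : f a b = f (V i) b - f (V i) a.
  have [[s s01 ea] [t t01 eb]] := (ia, ib).
  have E (p q : pt) (k l : R) : 0 <= k <= l -> l <= 1 ->
      p = ((V i).1 + k * ((V i.+1).1 - (V i).1), (V i).2 + k * ((V i.+1).2 - (V i).2)) ->
      q = ((V i).1 + l * ((V i.+1).1 - (V i).1), (V i).2 + l * ((V i.+1).2 - (V i).2)) ->
      seg (V i) q p.
    move=> kl l1 -> ->; have [l0|l0] := eqVneq l 0.
      have -> : k = 0 by lra.
      by exists 0; rewrite ?lexx ?ler01// l0 !mul0r !addr0.
    have lp : 0 < l by rewrite lt0r l0; lra.
    exists (k / l); first by rewrite divr_ge0 ?ler_pdivrMr//; lra.
    by congr (_, _) => /=; field.
  case: (leP s t) => st.
    have := seg_add F (E a b s t ltac:(lra) ltac:(lra) ea eb); lra.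
  have := seg_add F (E b a t s ltac:(lra) ltac:(lra) eb ea); rewrite (seg_anti F a b); lra.
have := pot_edge F iN ia; have := pot_edge F iN ib.
suff -> : jump a b = ((i == n.-1) && (b == V 0%N))%:R - ((i == n.-1) && (a == V 0%N))%:R by lra.
(* Only the edges [0] and [n.-1] contain [V 0], and the former meets the last edge nowhere else; so
   arriving along the last edge means [i = n.-1]. *)
have J c d : seg (V i) (V i.+1) c -> seg (V i) (V i.+1) d -> d != c ->
    (c == V 0%N) && `[< overlap d >] = (i == n.-1) && (c == V 0%N).
  move=> ic id dc; have [c0|] := eqVneq c (V 0%N); last by rewrite andbF.
  rewrite andbT /=; have [ei|ei] := eqVneq i n.-1.
    apply/asboolP; exists d; split; [by rewrite -c0|exact: seg_l|].
    by move: id; rewrite ei prednK ?Vn//; lia.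
  apply/asboolPn => -[x [x0 dx lx]].
  have i0 : i = 0%N.
    apply/eqP; rewrite -leqn0 leqNgt; apply/negP => ip.
    have ic0 : seg (V i) (V i.+1) (V 0%N) by rewrite -c0.
    have [[_ e]|[_ e _]] := loop_meet (i := 0%N) (j := i) ltac:(lia) (seg_l _ _) ic0.
    - by have := loop_inj L (i := 0%N) (j := i) ltac:(lia) iN e; lia.
    - by rewrite e eqxx in ei.
  have xi : seg (V 0%N) (V 1%N) x.
    by rewrite i0 in id; apply: seg_conv dx; [exact: id|exact: seg_l].
  have lx' : seg (V n.-1) (V n.-1.+1) x by rewrite prednK ?Vn//; lia.
  have [[e1 _]|[_ _ e]] := loop_meet (i := 0%N) (j := n.-1) ltac:(lia) xi lx'.
  - lia.
  - by rewrite e eqxx in x0.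
rewrite /jump; have [->|ab] := eqVneq a b; first by rewrite !subrr.
by rewrite (J b a)// (J a b)// eq_sym.
Qed.

(** Pigeonhole: among [n.+1] points inside the segment two lie on the same of the [n] edges, which
    is therefore collinear with the segment. As neither end of that edge is interior to the segment,
    the edge covers all of it. *)
Lemma trace_seg_edge a b : a != b ->
  (forall x, seg a b x -> trace x) ->
  (forall i, seg a b (V i) -> V i = a \/ V i = b) ->
  exists2 i, (i < n)%N & seg (V i) (V i.+1) a /\ seg (V i) (V i.+1) b.
Proof.
move=> ab H NV.
pose l (t : R) : pt := (a.1 + t * (b.1 - a.1), a.2 + t * (b.2 - a.2)).
pose tt (j : 'I_n.+1) : R := j.+1%:R / n.+2%:R.
have tt01 j : 0 < tt j < 1.
  by rewrite divr_gt0//= ltr_pdivrMr// mul1r ltr_nat ltnS ltn_ord.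
have tt_inj : injective tt.
  move=> j k /(mulIf _) => /(_ ltac:(by rewrite invr_eq0 pnatr_eq0)) /eqP.
  by rewrite eqr_nat eqSS => /eqP; exact: val_inj.
have l_inj : injective l.
  move=> s t [/addrI e1 /addrI e2].
  apply/eqP; apply: contraNT ab => st.
  move: e1 e2 => /eqP; rewrite -subr_eq0 -mulrBl mulf_eq0 subr_eq0 (negbTE st)/= subr_eq0.
  move=> /eqP e1 /eqP; rewrite -subr_eq0 -mulrBl mulf_eq0 subr_eq0 (negbTE st)/= subr_eq0.
  by move=> /eqP e2; rewrite (surjective_pairing a) (surjective_pairing b) e1 e2.
have /fin_all_exists[g Hg] : forall j : 'I_n.+1,
    exists i : 'I_n, seg (V i) (V i.+1) (l (tt j)).
  move=> j; have [|i iN ?] := H (l (tt j)).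
    by exists (tt j) => //; have := tt01 j; lra.
  by exists (Ordinal iN).
have /injectivePn[j [k jk gjk]] : ~~ injectiveb g.
  apply/negP => /injectiveP gi; have := leq_card g gi.
  by rewrite !card_ord ltnn.
have [[r r01 er] [s s01 es]] := (Hg j, Hg k).
rewrite -gjk in es; set i := g j in er es.
have rs : r != s.
  apply: contraNneq jk => rs; apply/eqP/tt_inj/l_inj.
  by rewrite er es rs.
pose P := V i; pose Q := V i.+1.
have PQ k' : seg a b (V k') -> exists2 t : R, t = 0 \/ t = 1 & V k' = l t.
  move=> /NV[->|->]; [exists 0|exists 1]; rewrite /l; [by left| |by right|].
    by rewrite !mul0r !addr0 -surjective_pairing.
  by rewrite [LHS]surjective_pairing; congr (_, _); ring.
have rs0 : s - r != 0 by rewrite subr_eq0 eq_sym.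
(* Solving for the ends of edge [i] on the line through [a] and [b]: they have parameters [al] and
   [al + dl]. *)
pose dl := (tt k - tt j) / (s - r).
pose al := tt j - r * dl.
have eP : V i = l al.
  move: er es; rewrite /l => -[x1 y1] [x2 y2]; rewrite [LHS]surjective_pairing /al /dl.
  congr (_, _); apply: (mulfI rs0).
    transitivity (s * ((V i).1 + r * ((V i.+1).1 - (V i).1)) - r * ((V i).1 + s * ((V i.+1).1 -
        (V i).1))); first by ring.
    by rewrite -x1 -x2; field.
  transitivity (s * ((V i).2 + r * ((V i.+1).2 - (V i).2)) - r * ((V i).2 + s * ((V i.+1).2 -
      (V i).2))); first by ring.
  by rewrite -y1 -y2; field.
have eQ : V i.+1 = l (al + dl).
  move: er es; rewrite /l => -[x1 y1] [x2 y2]; rewrite [LHS]surjective_pairing /al /dl.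
  congr (_, _); apply: (mulfI rs0).
    transitivity ((s - 1) * ((V i).1 + r * ((V i.+1).1 - (V i).1)) - (r -
        1) * ((V i).1 + s * ((V i.+1).1 - (V i).1))); first by ring.
    by rewrite -x1 -x2; field.
  transitivity ((s - 1) * ((V i).2 + r * ((V i.+1).2 - (V i).2)) - (r -
      1) * ((V i).2 + s * ((V i.+1).2 - (V i).2))); first by ring.
  by rewrite -y1 -y2; field.
have tj : tt j = al + r * dl by rewrite /al; ring.
have tk : tt k = al + s * dl by rewrite /al /dl; field.
have dl0 : dl != 0.
  rewrite /dl mulf_neq0 ?invr_eq0// subr_eq0.
  by apply: contraNneq jk => /tt_inj ->.
have out t : (exists k', V k' = l t) -> t <= 0 \/ 1 <= t.
  move=> [k' e]; case: (leP t 0) => t0; first by left.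
  case: (leP 1 t) => t1; first by right.
  have [|u u01] := PQ k'; first by rewrite e; exists t => //; lra.
  by rewrite e => /l_inj; lra.
have := out al (ex_intro _ _ (esym (esym eP))).
have := out (al + dl) (ex_intro _ _ eQ).
have := tt01 j; have := tt01 k.
have seg_l' t : 0 <= (t - al) / dl <= 1 -> seg (V i) (V i.+1) (l t).
  move=> h; exists ((t - al) / dl) => //; rewrite eP eQ /l /=.
  by congr (_, _); field.
have la : l 0 = a by rewrite /l !mul0r !addr0 -surjective_pairing.
have lb : l 1 = b by rewrite /l [RHS]surjective_pairing; congr (_, _); ring.
move=> k01 j01 o1 o2; exists i => //; rewrite -la -lb.
have [dp|dn] : 0 < dl \/ dl < 0 by move: dl0; rewrite neq_lt => /orP[]; [right|left].
  have a0 : al <= 0 by case: o2 => //; nra.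
  have a1 : 1 <= al + dl by case: o1 => //; nra.
  by split; apply: seg_l'; rewrite divr_ge0 ?ler_pdivrMr ?(ltW dp)//; lra.
have a0 : 1 <= al by case: o2 => //; nra.
have a1 : al + dl <= 0 by case: o1 => //; nra.
by split; apply: seg_l'; rewrite -mulrNN -invrN divr_ge0 ?ler_pdivrMr; lra.
Qed.

(** Induction on the number of loop vertices strictly inside the segment, splitting at one of them;
    the base case lies on a single edge. The split vertex is never [V 0], by [extreme], and this
    makes [jump] additive as well. *)
Lemma pot_seg f a b : seg_additive f -> (forall x, seg a b x -> trace x) ->
  f a b = pot f b - pot f a + circ f * jump a b.
Proof.
move=> F.
have [m] := ubnP #|[pred i : 'I_n | `[< [/\ seg a b (V i), V i <> a & V i <> b] >]]|.
elim: m a b => // m IH a b; rewrite ltnS => cm H.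
have [->|ab] := eqVneq a b.
  by rewrite seg_add0// subrr /jump subrr mulr0 addr0.
case: (pselect (exists i : 'I_n, [/\ seg a b (V i), V i <> a & V i <> b])); last first.
  move=> N; have [|i iN [ia ib]] := trace_seg_edge ab H; last exact: (pot_seg_edge F iN).
  move=> i; rewrite (loop_mod i L); have iN : (i %% n < n)%N by rewrite ltn_mod; lia.
  move=> si; apply: contrapT => /not_orP[h1 h2]; apply: N; by exists (Ordinal iN).
move=> [i [si ia ib]]; set c := V i in si ia ib.
have sub1 x : seg a c x -> seg a b x by apply: seg_conv => //; exact: seg_l.
have sub2 x : seg c b x -> seg a b x by apply: seg_conv => //; exact: seg_r.
have c0 : c != V 0%N.
  apply/eqP => c0; have [|||e|e] := @extreme a b.
  - by apply: H; exact: seg_l.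
  - by apply: H; exact: seg_r.
  - by rewrite -c0.
  - by apply: ia; rewrite e.
  - by apply: ib; rewrite e.
have acb x : seg a b x -> seg a c x -> seg c b x -> x = c.
  move: si ab => [t t01 ->] ab _ [u u01 ->] [v v01] [e1 e2].
  have K : (u * t - (t + v * (1 - t))) * (b.1 - a.1) = 0 by lra.
  have K' : (u * t - (t + v * (1 - t))) * (b.2 - a.2) = 0 by lra.
  have k0 : u * t - (t + v * (1 - t)) = 0.
    apply/eqP; apply: contraNT ab => k0.
    move: K K' => /eqP; rewrite mulf_eq0 (negbTE k0) subr_eq0 /= => /eqP h1.
    move=> /eqP; rewrite mulf_eq0 (negbTE k0) subr_eq0 /= => /eqP h2.
    by rewrite (surjective_pairing a) (surjective_pairing b) h1 h2.
  have k1 : u * t = t by nra.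
  congr (_, _) => /=; first by transitivity (a.1 + u * t * (b.1 - a.1)); [ring|rewrite k1].
  by transitivity (a.2 + u * t * (b.2 - a.2)); [ring|rewrite k1].
have lt1 : (#|[pred j : 'I_n | `[< [/\ seg a c (V j), V j <> a & V j <> c] >]]| <
    #|[pred j : 'I_n | `[< [/\ seg a b (V j), V j <> a & V j <> b] >]]|)%N.
  apply: proper_card; apply/properP; split.
    apply/fintype.subsetP => j; rewrite !inE => -[h1 h2 h3]; split => //.
      exact: sub1.
    move=> e; apply: h3; apply: acb => //; [exact: sub1|rewrite e; exact: seg_r].
  exists i; first by rewrite inE.
  by apply/negP; rewrite inE => -[].
have lt2 : (#|[pred j : 'I_n | `[< [/\ seg c b (V j), V j <> c & V j <> b] >]]| <
    #|[pred j : 'I_n | `[< [/\ seg a b (V j), V j <> a & V j <> b] >]]|)%N.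
  apply: proper_card; apply/properP; split.
    apply/fintype.subsetP => j; rewrite !inE => -[h1 h2 h3]; split => //.
      exact: sub2.
    move=> e; apply: h2; apply: acb => //; [exact: sub2|rewrite e; exact: seg_l].
  exists i; first by rewrite inE.
  by apply/negP; rewrite inE => -[].
have -> : jump a b = jump a c + jump c b.
  (* [overlap] depends only on the direction of arrival. If the witness lies between [d] and [c],
     then [c] lies between it and [V 0], and [c] itself is a witness. *)
  have O d : seg d (V 0%N) c -> `[< overlap d >] = `[< overlap c >].
    move=> dc; apply/asboolP/asboolP => -[x [x0 x1 x2]]; last first.
      by exists x; split => //; apply: seg_conv x1; [exact: dc|exact: seg_r].
    have [xc|cx] := seg_split dc x1; last by exists x.
    exists c; split => //; first exact: seg_l.
    have : seg x (V 0%N) c.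
      move: dc xc => [t t01 e] [s s01 ->]; rewrite e.
      have [d0|d0] := eqVneq (1 - s * t) 0.
        have -> : t = 1 by nra.
        exists 1; first by rewrite ler01 lexx.
        by congr (_, _) => /=; ring.
      have dp : 0 < 1 - s * t by rewrite lt0r d0; nra.
      exists (t * (1 - s) / (1 - s * t)).
        by rewrite divr_ge0 ?ler_pdivrMr// ?(ltW dp)//; nra.
      by congr (_, _) => /=; field.
    by apply: seg_conv => //; exact: seg_r.
  rewrite /jump (negbTE c0) /= sub0r subr0.
  have [b0|_] := eqVneq b (V 0%N); have [a0|_] := eqVneq a (V 0%N) => //=.
  - by rewrite a0 b0 eqxx in ab.
  - by rewrite (O a) -?b0//; lra.
  - by rewrite (O b) -?a0; [lra|exact: seg_sym].
  - by rewrite subrr oppr0 addr0.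
rewrite (seg_add F si) (IH a c) ?(IH c b)//.
- lra.
- exact: leq_trans lt2 cm.
- by move=> x /sub2; exact: H.
- exact: leq_trans lt1 cm.
- by move=> x /sub1; exact: H.
Qed.

End Potential.
End Chain.

(** * Interior angles and winding angles *)

Section PolygonLoop.
Variable R : realType.
Notation pt := (R * R)%type.
Implicit Types (p : seq pt) (u v w a b c x : pt).

Lemma vtx_mod p i : vtx p (i %% size p)%N = vtx p i.
Proof. by rewrite /vtx modn_mod. Qed.

Lemma vtx_modS p i : vtx p (i %% size p)%N.+1 = vtx p i.+1.
Proof. by rewrite /vtx -addn1 modnDml addn1. Qed.

Lemma edge_mod p i : edge p (i %% size p)%N = edge p i.
Proof. by rewrite /edge vtx_mod vtx_modS. Qed.

Lemma simple_loop_vtx p k : simple_polygon p ->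
  simple_loop (size p) (fun i => vtx p (k + i)).
Proof.
move=> [n3 un H]; set n := size p in n3 H *.
have n0 : (0 < n)%N by lia.
have mod_lt i : (i %% n < n)%N by rewrite ltn_mod.
have modK i j : (i < n)%N -> (j < n)%N -> ((k + i) %% n)%N = ((k + j) %% n)%N -> i = j.
  by move=> iN jN /eqP; rewrite eqn_modDl !modn_small// => /eqP.
split => //.
- by move=> i; rewrite addnA -vtx_mod modnDr vtx_mod.
- move=> i j iN jN /eqP; rewrite /vtx nth_uniq// => /eqP; exact: modK.
- move=> i x; rewrite !addnS => xi xj.
  have := H ((k + i) %% n)%N ((k + i).+1 %% n)%N (mod_lt _) (mod_lt _).
  have -> : ((k + i) %% n != (k + i).+1 %% n)%N.
    apply/eqP => /eqP; rewrite -addn1 -{1}[(k + i)%N]addn0 eqn_modDl mod0n modn_small//.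
    by lia.
  move=> /(_ isT); rewrite -[(_ %% n).+1]addn1 modnDml addn1 eqxx !edge_mod vtx_mod => e.
  by have : [set vtx p (k + i).+1] x by rewrite -e.
move=> i j ij jN nb x; rewrite !addnS => xi xj.
have := H ((k + i) %% n)%N ((k + j) %% n)%N (mod_lt _) (mod_lt _).
have -> : ((k + i) %% n != (k + j) %% n)%N.
  by apply/eqP => /modK; lia.
have S l : (((k + l) %% n).+1 %% n = (k + l.+1) %% n)%N.
  by rewrite -addn1 modnDml addn1 addnS.
move=> /(_ isT); rewrite !S !edge_mod.
have -> : ((k + j) %% n == (k + i.+1) %% n)%N = false.
  by apply/eqP => /modK; lia.
have -> : ((k + i) %% n == (k + j.+1) %% n)%N = false.
  have [e|e] := eqVneq j.+1 n; last by apply/eqP => /modK; lia.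
  rewrite e modnDr -{2}[k]addn0; apply/eqP => /modK => /(_ ltac:(lia) n0) i0.
  by move: nb; rewrite i0 -e /= eqxx.
by move=> e; have : (edge p (k + i) `&` edge p (k + j)) x by []; rewrite e.
Qed.

Lemma boundary_trace p k : (0 < size p)%N ->
  forall x, boundary p x <-> trace (size p) (fun i => vtx p (k + i)) x.
Proof.
move=> n0 x; have mod_lt i : (i %% size p < size p)%N by rewrite ltn_mod.
split=> -[i iN xi].
  exists ((i + (size p - k %% size p)) %% size p)%N => //.
  have E : ((k + ((i + (size p - k %% size p)) %% size p)) %% size p = i)%N.
    rewrite modnDmr; have := mod_lt k => h.
    have -> : (k + (i + (size p - k %% size p)) = (k %/ size p).+1 * size p + i)%N.
      by rewrite {1}(divn_eq k (size p)) mulSn; lia.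
    by rewrite modnMDl modn_small.
  by move: xi; rewrite addnS -/(edge p (k + _)) -[in edge p (k + _)]edge_mod E.
exists ((k + i) %% size p)%N => //; rewrite edge_mod /edge.
by rewrite -addnS.
Qed.

Lemma sum_periodic (g : nat -> R) n k : (forall i, g (i + n)%N = g i) ->
  \sum_(i < n) g (k + i)%N = \sum_(i < n) g i.
Proof.
move=> P; elim: k => // k <-.
case: n P => [|n] P; first by rewrite !big_ord0.
rewrite big_ord_recr big_ord_recl /= addrC; congr (_ + _).
  by rewrite addn0 addSnnS P.
by apply: eq_bigr => i _; rewrite addSnnS.
Qed.

Lemma far_vertex p : (0 < size p)%N -> exists2 k, (k < size p)%N &
  forall i, dot (vtx p i) (vtx p i) <= dot (vtx p k) (vtx p k).
Proof.
move=> n0; pose g i := dot (vtx p i) (vtx p i).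
have [k kN H] : exists2 k, (k < size p)%N & forall i, (i < size p)%N -> g i <= g k.
  rewrite -(prednK n0); elim: (size p).-1 => [|m [k kN H]].
    by exists 0%N => // -[].
  case: (leP (g m.+1) (g k)) => h.
    exists k; first exact: ltnW.
    by move=> i; rewrite ltnS leq_eqVlt => /orP[/eqP->//|]; exact: H.
  exists m.+1 => // i; rewrite ltnS leq_eqVlt => /orP[/eqP->//|/H].
  by move/le_trans; apply; exact: ltW.
by exists k => // i; rewrite -vtx_mod; apply: H; rewrite ltn_mod.
Qed.

(** With [D] the difference of the two vertices, comparing their squared lengths gives
    [-2 (dot (vtx p k) D) >= dot D D > 0]. So the inward radial direction at a farthest vertex
    serves as the normal [(n1, n2)]. *)
Lemma far_vertex_half p k : simple_polygon p -> (k < size p)%N ->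
  (forall i, dot (vtx p i) (vtx p i) <= dot (vtx p k) (vtx p k)) ->
  forall t, (0 < t < size p)%N ->
  0 < - (vtx p k).1 * (vsub (vtx p (k + t)) (vtx p (k + 0))).1 +
      - (vtx p k).2 * (vsub (vtx p (k + t)) (vtx p (k + 0))).2.
Proof.
move=> P kN M t tN; have L := simple_loop_vtx k P.
have D : vsub (vtx p (k + t)) (vtx p k) != (0, 0).
  apply/eqP => -[/eqP]; rewrite subr_eq0 => /eqP h1 /eqP; rewrite subr_eq0 => /eqP h2.
  have := loop_inj L (i := t) (j := 0%N); rewrite addn0.
  rewrite (surjective_pairing (vtx p k)) -h1 -h2 -surjective_pairing.
  by move=> /(_ _ _ erefl); lia.
rewrite addn0; have := vnorm_gt0 D; have := sqr_vnorm (vsub (vtx p (k + t)) (vtx p k)).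
have := M (k + t)%N; rewrite /dot /vsub /= => h e N.
have : 0 < vnorm (vsub (vtx p (k + t)) (vtx p k)) ^+ 2 by rewrite exprn_gt0.
by rewrite e; lra.
Qed.

Lemma ccw_angle_spec u w : u != (0, 0) -> w != (0, 0) ->
  [/\ vnorm u * vnorm w * cos (ccw_angle u w) = dot u w,
      vnorm u * vnorm w * sin (ccw_angle u w) = cross u w &
      0 <= ccw_angle u w < 2 * pi].
Proof.
move=> u0 w0; have P : 0 < vnorm u * vnorm w by rewrite mulr_gt0 ?vnorm_gt0.
have r := cos_ratio u w; have p0 := pi_gt0 R.
have c1 : vnorm u * vnorm w * cos (acos (dot u w / (vnorm u * vnorm w))) = dot u w.
  by rewrite acosK ?in_itv//= mulrC divfK// gt_eqF.
have s1 : vnorm u * vnorm w * sin (acos (dot u w / (vnorm u * vnorm w))) = `|cross u w|.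
  by rewrite sin_acos// sqrt_ratio// mulrC divfK// gt_eqF.
have a0 := acos_ge0 r; have a1 := acos_lepi r.
rewrite /ccw_angle /=; case: (leP 0 (cross u w)) => c0.
  by split => //; [rewrite s1 ger0_norm|lra].
split.
- by rewrite addrC mulr_natl cosD2pi cosN.
- by rewrite addrC mulr_natl sinD2pi sinN mulrN s1 ltr0_norm// opprK.
- suff : 0 < acos (dot u w / (vnorm u * vnorm w)) by lra.
  rewrite lt_neqAle a0 andbT; apply/eqP => e; move: s1; rewrite -e sin0 mulr0.
  by move/esym/eqP; rewrite normr_eq0 lt_eqF.
Qed.

Lemma vsub0K u : vsub (0, 0) (vsub (0, 0) u) = u.
Proof. by rewrite /vsub /= !sub0r !opprK -surjective_pairing. Qed.

(** The exterior angle, from the incoming direction [- w] to the outgoing [u]. The condition on the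
    collinear case excludes a spike of angle 0, where the left side would be [pi] but [ang] has its
    default value 0. *)
Lemma ccw_angle_turn u w : u != (0, 0) -> w != (0, 0) ->
  (cross u w = 0 -> dot u w <= 0) ->
  pi - ccw_angle u w = ang (vsub (0, 0) w) u.
Proof.
move=> u0 w0 H.
have cE : cross (vsub (0, 0) w) u = cross u w by rewrite /cross /vsub /=; ring.
case: (ltrgtP (cross u w) 0) => c0.
- have c' : 0 < cross w u by rewrite crossC oppr_gt0.
  have := ang_suppl c'; rewrite (angC (vsub (0, 0) w)) (angC u w).
  have -> : ang u w = - acos (dot u w / (vnorm u * vnorm w)).
    by rewrite /ang ltr0_sg// mulN1r.
  by rewrite /ccw_angle leNgt c0 /=; lra.
- have c' : 0 < cross w (vsub (0, 0) u) by rewrite /cross /vsub /=; move: c0; rewrite /cross; lra.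
  rewrite -[ang (vsub (0,0) w) u]angNN.
  by rewrite vsub0K ang_suppl// /ccw_angle (ltW c0) /ang gtr0_sg// mul1r.
have d0 := H c0.
rewrite ang_collinear ?cE// /ccw_angle c0 lexx.
have P : 0 < vnorm u * vnorm w by rewrite mulr_gt0 ?vnorm_gt0.
have -> : dot u w = - (vnorm u * vnorm w).
  rewrite -[LHS]opprK; congr (- _); rewrite -ler0_norm//.
  apply/eqP; rewrite -(@eqrXn2 _ 2) ?(ltW P)// real_normK ?num_real//.
  by rewrite -lagrange c0 expr0n/= addr0.
by rewrite mulNr divff ?gt_eqF// acosN1 subrr.
Qed.

Definition orientation p : R := if 0 < area2 p then 1 else -1.

Section Corner.
Variables (p : seq pt) (P : simple_polygon p).
Let n := size p.
Let n3 : (3 <= n)%N. Proof. by case: P. Qed.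

Lemma corner_edges i :
  let u := vsub (vtx p i.+1) (vtx p i) in
  let w := vsub (vtx p (i + n).-1) (vtx p i) in
  [/\ u != (0, 0), w != (0, 0) & (cross u w = 0 -> dot u w <= 0)].
Proof.
have L := simple_loop_vtx (i + n).-1 P.
have e0 : vtx p ((i + n).-1 + 0) = vtx p (i + n).-1 by rewrite addn0.
have e1 : vtx p ((i + n).-1 + 1) = vtx p i.
  by rewrite addn1 prednK; [rewrite -vtx_mod modnDr vtx_mod|lia].
have e2 : vtx p ((i + n).-1 + 2) = vtx p i.+1.
  by rewrite addn2 prednK; [rewrite -addSn -vtx_mod modnDr vtx_mod|lia].
have vz (a b : pt) : a != b -> vsub b a != (0, 0).
  move=> ab; apply/eqP => -[/eqP]; rewrite subr_eq0 => /eqP h1 /eqP; rewrite subr_eq0 => /eqP h2.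
  by move: ab; rewrite (surjective_pairing a) (surjective_pairing b) h1 h2 eqxx.
have n01 := loop_neq 0 L; have n12 := loop_neq 1 L.
rewrite e0 e1 in n01; rewrite e1 e2 in n12.
split; [exact: vz|by apply: vz; rewrite eq_sym|].
apply: seg_ray => // x; rewrite -e0 -e1 -e2; exact: (loop_adj L (i := 0%N)).
Qed.

Lemma interior_angle_turn i :
  pi - interior_angle p i = orientation p *
   ang (vsub (vtx p i) (vtx p (i + n).-1)) (vsub (vtx p i.+1) (vtx p i)).
Proof.
have [u0 w0 H] := corner_edges i; rewrite /interior_angle /orientation -/n.
set u := vsub (vtx p i.+1) _ in u0 H *; set w := vsub (vtx p (i + n).-1) _ in w0 H *.
have -> : vsub (vtx p i) (vtx p (i + n).-1) = vsub (0, 0) w.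
  by rewrite /w /vsub /= !sub0r !opprB.
case: ifP => _; first by rewrite ccw_angle_turn// mul1r.
rewrite ccw_angle_turn//; last first.
  by move=> c0; rewrite dotC; apply: H; rewrite crossC c0 oppr0.
by rewrite -[in RHS]angNN vsub0K mulN1r -angC.
Qed.

Lemma sum_interior_turn k :
  \sum_(i < n) (pi - interior_angle p i) =
  orientation p * \sum_(i < n) turn (fun i => vtx p (k + i)) i.
Proof.
rewrite big_distrr /=.
(* The shift is [k.+1] because [turn] at index [i] sits at the vertex [i.+1]. *)
rewrite -(@sum_periodic (fun i => pi - interior_angle p i) n k.+1); last first.
  move=> i; rewrite /interior_angle -/n.
  have -> : vtx p (i + n).+1 = vtx p i.+1 by rewrite -addSn -vtx_mod modnDr vtx_mod.
  have -> : vtx p (i + n) = vtx p i by rewrite -vtx_mod modnDr vtx_mod.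
  have -> // : vtx p (i + n + n).-1 = vtx p (i + n).-1.
  have -> : ((i + n + n).-1 = (i + n).-1 + n)%N by lia.
  by rewrite -vtx_mod modnDr vtx_mod.
apply: eq_bigr => i _; rewrite interior_angle_turn /turn; congr (_ * ang _ _).
  rewrite addSnnS; congr (vsub _ _).
  have -> : ((k + i.+1 + n).-1 = (k + i) + n)%N by lia.
  by rewrite -vtx_mod modnDr vtx_mod.
by rewrite addSnnS !addnS.
Qed.

End Corner.

(* [2 pi] times the winding number off the boundary; since the degenerate terms
   vanish, it is [pi] modulo [2 pi] inside an edge and the angle between the two
   incident edges, modulo [2 pi], at a vertex. *)
Definition wind p x := \sum_(i < size p) ang (vsub (vtx p i) x) (vsub (vtx p i.+1) x).

Lemma wind_shift p x k : wind p x =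
  \sum_(i < size p) ang (vsub (vtx p (k + i)) x) (vsub (vtx p (k + i.+1)) x).
Proof.
under [RHS]eq_bigr => i _ do rewrite addnS.
rewrite (@sum_periodic (fun i => ang (vsub (vtx p i) x) (vsub (vtx p i.+1) x)))//.
move=> i; have -> : vtx p (i + size p).+1 = vtx p i.+1 by rewrite -addSn -vtx_mod modnDr vtx_mod.
by have -> : vtx p (i + size p) = vtx p i by rewrite -vtx_mod modnDr vtx_mod.
Qed.

Lemma nonanti_seg a b x : ~ seg a b x -> nonanti (vsub a x) (vsub b x).
Proof.
move=> H; apply: (@nonanti_hull _ _ _ (vsub a x)) => -[k [l [m [k0 l0 m0 s [e1 e2]]]]].
apply: H; have s0 : k + l + m != 0 by rewrite gt_eqF.
move: e1 e2; rewrite /vsub /= => e1 e2.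
exists (l / (k + l + m)); first by rewrite divr_ge0 ?ler_pdivrMr// ?(ltW s)//; lra.
rewrite [LHS]surjective_pairing; congr (_, _); apply: (mulfI s0); apply/eqP; rewrite -subr_eq0;
    apply/eqP.
  by rewrite -[RHS]oppr0 -e1; field.
by rewrite -[RHS]oppr0 -e2; field.
Qed.

Lemma vsub_eq0 a b : vsub a b = (0, 0) -> a = b.
Proof.
move=> -[/eqP]; rewrite subr_eq0 => /eqP h1 /eqP; rewrite subr_eq0 => /eqP h2.
by rewrite (surjective_pairing a) (surjective_pairing b) h1 h2.
Qed.

Lemma wind_out p x : simple_polygon p -> ~ boundary p x ->
  cos (wind p x) = 1 /\ sin (wind p x) = 0.
Proof.
move=> P H; have n3 : (3 <= size p)%N by case: P.
have N i : ~ seg (vtx p i) (vtx p i.+1) x.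
  rewrite -/(edge p i) -edge_mod => h; apply: H; exists (i %% size p)%N => //.
  by rewrite ltn_mod; lia.
pose W i := vsub (vtx p i) x.
have W0 : W 0%N != (0, 0).
  by apply/eqP => /vsub_eq0 e; apply: (N 0%N); rewrite -e; exact: seg_l.
have [] := @path_ang _ W (size p) W0 (fun i _ => nonanti_seg (N i)).
have -> : W (size p) = W 0%N by rewrite /W -vtx_mod modnn.
rewrite -/(wind p x) -expr2 sqr_vnorm.
have D : dot (W 0%N) (W 0%N) != 0.
  by rewrite -sqr_vnorm expf_neq0// gt_eqF// vnorm_gt0.
move=> h1 h2; split; apply: (mulfI D); first by rewrite h1 mulr1.
by rewrite h2 mulr0 /cross; ring.
Qed.

Lemma seg_dot_le0 a b x : seg a b x -> dot (vsub b x) (vsub a x) <= 0.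
Proof.
case=> t /andP[t0 t1] ->; rewrite /dot /vsub /=.
rewrite (_ : _ + _ = - (t * (1 - t) * ((b.1 - a.1) ^+ 2 + (b.2 - a.2) ^+ 2))); last by ring.
by rewrite oppr_le0 mulr_ge0 ?addr_ge0 ?sqr_ge0// mulr_ge0// subr_ge0.
Qed.

(** The edge through [x] contributes 0. Along the remaining edges the direction from [x] never jumps
    to its opposite, and it runs from one end of that edge to the other, which is a half turn modulo
    [2 * pi]. *)
Lemma wind_edge p i x : simple_polygon p -> edge p i x ->
  x <> vtx p i -> x <> vtx p i.+1 -> cos (wind p x) = -1 /\ sin (wind p x) = 0.
Proof.
move=> P xi x0 x1; have L := simple_loop_vtx i P; have n3 := loop_size L.
set V := fun j => vtx p (i + j) in L.
have nE : (size p).-1.+1 = size p by lia.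
have V0 : V 0%N = vtx p i by rewrite /V addn0.
have V1 : V 1%N = vtx p i.+1 by rewrite /V addn1.
have Vn : V (size p) = V 0%N by rewrite -[size p]add0n (loop_periodic L).
have x01 : seg (V 0%N) (V 1%N) x by rewrite V0 V1.
have N j : (0 < j < size p)%N -> ~ seg (V j) (V j.+1) x.
  move=> jN xj; have [e|j1] := eqVneq j 1%N.
    by rewrite e in xj; apply: x1; rewrite -V1; exact: (loop_adj L (i := 0%N) x01 xj).
  have [e|jn] := eqVneq j (size p).-1.
    apply: x0; rewrite -V0 -Vn -nE; apply: (loop_adj L (i := (size p).-1)).
      by rewrite -e.
    by rewrite nE -[(size p).+1]add1n (loop_periodic L) Vn.
  by apply: (loop_far L (i := 0%N) (j := j) _ _ _ x01 xj); lia.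
pose W j := vsub (V j.+1) x.
have W0 : W 0%N != (0, 0) by apply/eqP => /vsub_eq0; rewrite V1 => /esym.
have W1 : W (size p).-1 != (0, 0).
  by apply/eqP => /vsub_eq0; rewrite nE Vn V0 => /esym.
have [] := @path_ang _ W (size p).-1 W0.
  by move=> j jN; apply/nonanti_seg/N; lia.
have -> : \sum_(j < (size p).-1) ang (W j) (W j.+1) = wind p x.
  rewrite (wind_shift p x i) -nE big_ord_recl /= ang_collinear ?add0r; last first.
    by case: xi => t _ ->; rewrite addn0 addn1 /cross /vsub /=; ring.
  by apply: eq_bigr => j _; rewrite /W /V /bump.
have c0 : cross (W 0%N) (W (size p).-1) = 0.
  by rewrite /W nE Vn V0 V1; case: xi => t _ ->; rewrite /cross /vsub /=; ring.
have d0 : dot (W 0%N) (W (size p).-1) <= 0.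
  by rewrite /W nE Vn V0 V1; exact: seg_dot_le0.
have P0 : 0 < vnorm (W 0%N) * vnorm (W (size p).-1) by rewrite mulr_gt0 ?vnorm_gt0.
have := lagrange (W 0%N) (W (size p).-1); rewrite c0 expr0n /= addr0.
set Q := vnorm _ * vnorm _ in P0 * => e h1 h2; split; last first.
  by apply: (mulfI (lt0r_neq0 P0)); rewrite h2 mulr0.
apply: (mulfI (lt0r_neq0 P0)); rewrite h1 mulrN1.
rewrite -[LHS]opprK; congr (- _); rewrite -ler0_norm//.
by apply/eqP; rewrite -(@eqrXn2 _ 2) ?(ltW P0)// real_normK ?num_real// e.
Qed.

(** Both edges at the vertex contribute 0; the remaining path carries the direction of [u] to that
    of [w]. *)
Lemma wind_vertex p i : simple_polygon p ->
  let u := vsub (vtx p i.+1) (vtx p i) in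
  let w := vsub (vtx p (i + size p).-1) (vtx p i) in
  vnorm u * vnorm w * cos (wind p (vtx p i)) = dot u w /\
  vnorm u * vnorm w * sin (wind p (vtx p i)) = cross u w.
Proof.
move=> P u w; have L := simple_loop_vtx i P; have n3 := loop_size L.
set V := fun j => vtx p (i + j) in L; set x := vtx p i in u w *.
have nE : (size p).-1.+1 = size p by lia.
have V0 : V 0%N = x by rewrite /V addn0.
have V1 : V 1%N = vtx p i.+1 by rewrite /V addn1.
have Vn : V (size p) = V 0%N by rewrite -[size p]add0n (loop_periodic L).
have x01 : seg (V 0%N) (V 1%N) x by rewrite V0; exact: seg_l.
have N j : (0 < j < (size p).-1)%N -> ~ seg (V j) (V j.+1) x.
  move=> jN xj; have [e|j1] := eqVneq j 1%N.
    rewrite e in xj; have := loop_adj L (i := 0%N) x01 xj; rewrite -V0 => e'.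
    by have := loop_inj L (i := 0%N) (j := 1%N) ltac:(lia) ltac:(lia) e'.
  by apply: (loop_far L (i := 0%N) (j := j) _ _ _ x01 xj); lia.
pose W j := vsub (V j.+1) x.
have [u0 _ _] := corner_edges P i.
have nE2 : (size p).-2.+1 = (size p).-1 by lia.
have [] := @path_ang _ W (size p).-2; first by rewrite /W V1.
  by move=> j jN; apply/nonanti_seg/N; lia.
have -> : \sum_(j < (size p).-2) ang (W j) (W j.+1) = wind p x.
  rewrite (wind_shift p x i) -nE big_ord_recl /= ang_collinear ?add0r; last first.
    by rewrite addn0 /cross /vsub /= -/x; ring.
  rewrite -nE2 big_ord_recr /= [X in _ = _ + X]ang_collinear ?addr0; last first.
    by rewrite /bump /= !add1n nE2 nE -/(V (size p)) Vn V0 /cross /vsub /=; ring.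
  by apply: eq_bigr => j _; rewrite /W /V /bump.
rewrite /W nE2 V1 -/u.
have -> : V (size p).-1 = vtx p (i + size p).-1 by rewrite /V; congr vtx; lia.
by [].
Qed.

(* The two angles agree modulo [2 pi]. *)
Lemma interior_angle_wind p i (th : R) : simple_polygon p ->
  th = orientation p * wind p (vtx p i) -> 0 <= th <= 2 * pi ->
  0 < interior_angle p i -> th = interior_angle p i.
Proof.
move=> P thE thb ip.
have [] := wind_vertex i P; have [u0 w0 _] := corner_edges P i.
move: ip; rewrite /interior_angle; move: thE; rewrite /orientation.
set u := vsub (vtx p i.+1) _ in u0 *; set w := vsub (vtx p (i + size p).-1) _ in w0 *.
set wd := wind p _ => thE ip h1 h2.
have Q0 : vnorm u * vnorm w != 0 by rewrite gt_eqF// mulr_gt0 ?vnorm_gt0.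
suff fin (A : R) : 0 < A < 2 * pi -> cos A = cos th -> sin A = sin th -> th = A.
  case: ifP ip thE => _ ip; [rewrite mul1r|rewrite mulN1r] => thE.
    have [c s b] := ccw_angle_spec u0 w0; apply: fin; first lra.
      by apply: (mulfI Q0); rewrite c thE.
    by apply: (mulfI Q0); rewrite s thE.
  have [c s b] := ccw_angle_spec w0 u0; apply: fin; first lra.
    by apply: (mulfI Q0); rewrite [in LHS](mulrC (vnorm u)) c thE cosN dotC.
  by apply: (mulfI Q0); rewrite [in LHS](mulrC (vnorm u)) s thE sinN mulrN crossC h2.
move=> Ab c s; suff : th - A = 0 by lra.
apply: cos_eq1_0; last lra.
by rewrite cosB c s -!expr2 cos2Dsin2.
Qed.

End PolygonLoop.

(** * Regions of convex quadrilaterals *)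

Section Regions.
Variable R : realType.
Notation pt := (R * R)%type.
Implicit Types (p q : seq pt) (u v w a b c d x y : pt).

Lemma lerp_continuous a b :
  continuous (fun t : R => (a.1 + t * (b.1 - a.1), a.2 + t * (b.2 - a.2)) : pt).
Proof.
move=> t.
by apply: (@cvg_pair _ _ _ (nbhs t) (nbhs (a.1 + t * (b.1 - a.1)))
    (nbhs (a.2 + t * (b.2 - a.2))));
  (apply: cvgD; [exact: cvg_cst|apply: cvgM; [exact: cvg_id|exact: cvg_cst]]).
Qed.

Lemma seg_image a b : seg a b =
  [set ((a.1 + t * (b.1 - a.1), a.2 + t * (b.2 - a.2)) : pt) | t in `[0, 1]].
Proof.
by apply/seteqP; split => x [t t01 e]; exists t; rewrite //= ?in_itv.
Qed.

Lemma seg_closed a b : @closed (R * R)%type (seg a b).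
Proof.
apply: compact_closed; first exact: norm_hausdorff.
rewrite seg_image; apply: continuous_compact; last exact: segment_compact.
exact/continuous_subspaceT/lerp_continuous.
Qed.

Lemma seg_connected a b : @connected (R * R)%type (seg a b).
Proof.
rewrite seg_image; apply: connected_continuous_connected.
  exact: segment_connected.
exact/continuous_subspaceT/lerp_continuous.
Qed.

Lemma boundary_closed p : @closed (R * R)%type (boundary p).
Proof.
have -> : boundary p = \bigcup_(i in `I_(size p)) edge p i.
  by apply/seteqP; split => x [i iN xi]; exists i.
by apply: closed_bigcup => // i _; exact: seg_closed.
Qed.

Lemma boundary_nbhd p x : ~ boundary p x -> exists2 e : R, 0 < e &
  forall y, `|y.1 - x.1| < e -> `|y.2 - x.2| < e -> ~ boundary p y.
Proof.
move=> xb; have : @nbhs _ (R * R)%type x (~` boundary p).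
  apply: open_nbhs_nbhs; split => //; apply: closed_openC; exact: boundary_closed.
move=> /nbhs_ballP[e /= e0 H]; exists e => // y y1 y2.
by apply: H; split; rewrite /ball /= -normrN opprB.
Qed.

(** Short segments from [x] avoid the boundary, so nearby points lie in the same bounded
    component. *)
Lemma region_nbhd p x : region p x -> ~ boundary p x ->
  exists2 e : R, 0 < e &
  forall y, `|y.1 - x.1| < e -> `|y.2 - x.2| < e -> region p y.
Proof.
case=> [//|[_ bx]] xb.
have [e e0 H] := boundary_nbhd xb; exists e => // y y1 y2.
have yb z : seg x y z -> ~ boundary p z.
  move=> [t /andP[t0 t1] ->]; apply: H => /=; rewrite addrC addKr normrM ger0_norm//.
    by apply: le_lt_trans y1; rewrite ler_piMl.
  by apply: le_lt_trans y2; rewrite ler_piMl.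
have xy : @connected_component (R * R)%type (~` boundary p) x y.
  apply: (@connected_component_max _ _ (seg x y)); first exact: seg_l.
  - by move=> z; exact: yb.
  - exact: seg_connected.
  - exact: seg_r.
right; split; first exact/yb/seg_r.
by rewrite -(same_connected_component xy).
Qed.

Definition orient a b x := cross (vsub b a) (vsub x a).

Lemma orient_continuous a b : continuous (orient a b : R * R -> R).
Proof.
move=> x; rewrite /orient /cross /vsub /=.
apply: cvgB; apply: cvgM; try exact: cvg_cst; apply: cvgB; try exact: cvg_cst.
  exact: cvg_snd.
exact: cvg_fst.
Qed.

Definition qedges q := zip q (rot 1 q).

Definition hull q x := forall e, e \in qedges q -> 0 <= orient e.1 e.2 x.
Definition interior_pt q x := forall e, e \in qedges q -> 0 < orient e.1 e.2 x.

(** Strict left turns at all four corners. For four points this means convexity: the turns are below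
    [pi] each, so they cannot add up to more than one full turn. *)
Definition ccw4 a b c d :=
  [/\ 0 < orient a b c, 0 < orient b c d, 0 < orient c d a & 0 < orient d a b].

Lemma hull4 a b c d x : hull [:: a; b; c; d] x <->
  [/\ 0 <= orient a b x, 0 <= orient b c x, 0 <= orient c d x & 0 <= orient d a x].
Proof.
split=> [H|[h1 h2 h3 h4] e].
  by split; apply: (H (_, _)); rewrite /qedges /= !inE eqxx ?orbT.
by rewrite /qedges /= !inE => /or4P[] /eqP->.
Qed.

Lemma interior4 a b c d x : interior_pt [:: a; b; c; d] x <->
  [/\ 0 < orient a b x, 0 < orient b c x, 0 < orient c d x & 0 < orient d a x].
Proof.
split=> [H|[h1 h2 h3 h4] e].
  by split; apply: (H (_, _)); rewrite /qedges /= !inE eqxx ?orbT.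
by rewrite /qedges /= !inE => /or4P[] /eqP->.
Qed.

Lemma boundary4 a b c d x : boundary [:: a; b; c; d] x <->
  exists2 e, e \in qedges [:: a; b; c; d] & seg e.1 e.2 x.
Proof.
split=> [[[|[|[|[|//]]]] _]|[e]]; rewrite /edge /vtx /=.
- by exists (a, b) => //; rewrite inE eqxx.
- by exists (b, c) => //; rewrite !inE eqxx orbT.
- by exists (c, d) => //; rewrite !inE eqxx !orbT.
- by exists (d, a) => //; rewrite !inE eqxx !orbT.
rewrite /qedges /= !inE => /or4P[] /eqP-> /= h.
- by exists 0%N.
- by exists 1%N.
- by exists 2%N.
- by exists 3%N.
Qed.

Lemma orient_cyc a b x : orient b x a = orient a b x.
Proof. by rewrite /orient /cross /vsub /=; ring. Qed.

Lemma orient_seg a b x : seg a b x -> orient a b x = 0.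
Proof. by case=> t _ ->; rewrite /orient /cross /vsub /=; ring. Qed.

Lemma orient_lerp e f a b (t : R) :
  orient e f (a.1 + t * (b.1 - a.1), a.2 + t * (b.2 - a.2)) =
  (1 - t) * orient e f a + t * orient e f b.
Proof. by rewrite /orient /cross /vsub /=; ring. Qed.

Lemma orientll a b : orient a b a = 0.
Proof. by rewrite /orient /cross /vsub /=; ring. Qed.
Lemma orientlr a b : orient a b b = 0.
Proof. by rewrite /orient /cross /vsub /=; ring. Qed.

Lemma ccw4_rot a b c d : ccw4 a b c d -> ccw4 b c d a.
Proof. by case. Qed.

Lemma hull_edge a b c d x : ccw4 a b c d -> orient a b x = 0 ->
  0 <= orient b c x -> 0 <= orient d a x -> seg a b x.
Proof.
move=> [h1 h2 h3 h4] e bc da.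
have [t xE] : exists t : R, x = (a.1 + t * (b.1 - a.1), a.2 + t * (b.2 - a.2)).
  have N0 : (b.1 - a.1) ^+ 2 + (b.2 - a.2) ^+ 2 != 0.
    apply/eqP => /eqP; rewrite paddr_eq0 ?sqr_ge0// !sqrf_eq0 !subr_eq0 => /andP[/eqP k1 /eqP k2].
    by move: h1; rewrite /orient /cross /vsub /= k1 k2 !subrr !mul0r subrr ltxx.
  exists (((x.1 - a.1) * (b.1 - a.1) + (x.2 - a.2) * (b.2 - a.2)) /
    ((b.1 - a.1) ^+ 2 + (b.2 - a.2) ^+ 2)).
  move: e; rewrite /orient /cross /vsub /= => e.
  rewrite [LHS]surjective_pairing; congr (_, _); apply: (mulfI N0);
    apply/eqP; rewrite -subr_eq0; apply/eqP.
    transitivity (- (b.2 - a.2) * ((b.1 - a.1) * (x.2 - a.2) - (b.2 - a.2) * (x.1 - a.1))).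
      by field.
    by rewrite e mulr0.
  transitivity ((b.1 - a.1) * ((b.1 - a.1) * (x.2 - a.2) - (b.2 - a.2) * (x.1 - a.1))).
    by field.
  by rewrite e mulr0.
move: bc da; rewrite xE !orient_lerp orientll orientlr !mulr0 add0r addr0.
rewrite orient_cyc => bc da; exists t => //.
rewrite -(pmulr_lge0 _ h4) da /= -subr_ge0.
by move: bc; rewrite pmulr_lge0.
Qed.

Lemma edge_hull a b c d x : ccw4 a b c d -> seg a b x -> hull [:: a; b; c; d] x.
Proof.
move=> [h1 h2 h3 h4] [t /andP[t0 t1] ->]; apply/hull4.
have s0 : 0 <= 1 - t by rewrite subr_ge0.
split; rewrite orient_lerp ?orientll ?orientlr ?mulr0 ?addr0 ?add0r//.
- by rewrite mulr_ge0// orient_cyc ltW.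
- by rewrite addr_ge0// mulr_ge0 ?(ltW h3)// orient_cyc ltW.
- by rewrite mulr_ge0// ltW.
Qed.

Lemma edge_strict a b c d x : ccw4 a b c d -> seg a b x -> x != a -> x != b ->
  [/\ 0 < orient b c x, 0 < orient c d x & 0 < orient d a x].
Proof.
move=> [h1 h2 h3 h4] [t /andP[t0 t1] ->] xa xb.
have t0' : 0 < t.
  rewrite lt0r t0 andbT; apply: contraNneq xa => ->.
  by rewrite !mul0r !addr0 -surjective_pairing.
have t1' : 0 < 1 - t.
  rewrite subr_gt0 lt_neqAle t1 andbT; apply: contraNneq xb => ->.
  by rewrite !mul1r !subrKC -surjective_pairing.
split; rewrite orient_lerp ?orientll ?orientlr ?mulr0 ?addr0 ?add0r//.
- by rewrite mulr_gt0// orient_cyc.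
- by rewrite addr_gt0// mulr_gt0// orient_cyc.
- by rewrite mulr_gt0.
Qed.

Lemma hull_cases a b c d x : ccw4 a b c d -> hull [:: a; b; c; d] x ->
  boundary [:: a; b; c; d] x \/ interior_pt [:: a; b; c; d] x.
Proof.
move=> C /hull4[h1 h2 h3 h4].
have C2 := ccw4_rot C; have C3 := ccw4_rot C2; have C4 := ccw4_rot C3.
have [e1|n1] := eqVneq (orient a b x) 0.
  by left; exists 0%N => //; exact: (hull_edge C).
have [e2|n2] := eqVneq (orient b c x) 0.
  by left; exists 1%N => //; exact: (hull_edge C2).
have [e3|n3] := eqVneq (orient c d x) 0.
  by left; exists 2%N => //; exact: (hull_edge C3).
have [e4|n4] := eqVneq (orient d a x) 0.
  by left; exists 3%N => //; exact: (hull_edge C4).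
by right; apply/interior4; split; rewrite lt0r ?n1 ?n2 ?n3 ?n4.
Qed.

Lemma interior_not_boundary a b c d x : interior_pt [:: a; b; c; d] x ->
  ~ boundary [:: a; b; c; d] x.
Proof.
by move=> H /boundary4[e eq /orient_seg e0]; have := H _ eq; rewrite e0 ltxx.
Qed.

Lemma boundary_hull a b c d x : ccw4 a b c d -> boundary [:: a; b; c; d] x ->
  hull [:: a; b; c; d] x.
Proof.
move=> C; have C2 := ccw4_rot C; have C3 := ccw4_rot C2; have C4 := ccw4_rot C3.
move=> [[|[|[|[|//]]]] _]; rewrite /edge /vtx /=.
- exact: edge_hull.
- by move=> /(edge_hull C2)/hull4[? ? ? ?]; apply/hull4.
- by move=> /(edge_hull C3)/hull4[? ? ? ?]; apply/hull4.
- by move=> /(edge_hull C4)/hull4[? ? ? ?]; apply/hull4.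
Qed.

(** Divided by their sum, the three [orient] values are the barycentric coordinates of [x]. *)
Lemma triangle_bounded a b c x : 0 < orient a b c -> 0 <= orient a b x ->
  0 <= orient b c x -> 0 <= orient c a x ->
  `|x.1| <= `|a.1| + `|b.1| + `|c.1| /\ `|x.2| <= `|a.2| + `|b.2| + `|c.2|.
Proof.
move=> S h1 h2 h3.
have sum : orient a b x + orient b c x + orient c a x = orient a b c.
  by rewrite /orient /cross /vsub /=; ring.
have bd (k1 k2 k3 z1 z2 z3 y : R) : 0 <= k1 -> 0 <= k2 -> 0 <= k3 -> 0 < k1 + k2 + k3 ->
    (k1 + k2 + k3) * y = k2 * z1 + k3 * z2 + k1 * z3 -> `|y| <= `|z1| + `|z2| + `|z3|.
  move=> k10 k20 k30 kp e; rewrite -(ler_pM2l kp) -{1}(ger0_norm (ltW kp)) -normrM e.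
  apply: le_trans (ler_normD _ _) _; apply: le_trans (lerD (ler_normD _ _) (lexx _)) _.
  rewrite !normrM !(ger0_norm k10) !(ger0_norm k20) !(ger0_norm k30).
  have := normr_ge0 z1; have := normr_ge0 z2; have := normr_ge0 z3.
  by nra.
by split; apply: (bd _ _ _ _ _ _ _ h1 h2 h3); rewrite ?sum//;
  rewrite /orient /cross /vsub /=; ring.
Qed.

Lemma hull_bounded a b c d : ccw4 a b c d ->
  exists M : R, forall x, hull [:: a; b; c; d] x -> `|x.1| <= M /\ `|x.2| <= M.
Proof.
move=> [h1 h2 h3 h4].
exists (`|a.1| + `|b.1| + `|c.1| + `|d.1| + (`|a.2| + `|b.2| + `|c.2| + `|d.2|)).
move=> x /hull4[k1 k2 k3 k4].
have := normr_ge0 a.1; have := normr_ge0 b.1; have := normr_ge0 c.1; have := normr_ge0 d.1.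
have := normr_ge0 a.2; have := normr_ge0 b.2; have := normr_ge0 c.2; have := normr_ge0 d.2.
(* The diagonal through [a] and [c] decides which of the two triangles contains [x]. *)
case: (leP 0 (orient c a x)) => ca.
  by have [] := triangle_bounded h1 k1 k2 ca; lra.
have ac : 0 <= orient a c x.
  by move: ca; rewrite /orient /cross /vsub /=; lra.
have h3' : 0 < orient a c d by rewrite -orient_cyc.
by have [] := triangle_bounded h3' ac k3 k4; lra.
Qed.

(* A ray leaving through a violated edge line never meets the quadrilateral. *)
Lemma region_hull a b c d : ccw4 a b c d ->
  region [:: a; b; c; d] = hull [:: a; b; c; d].
Proof.
move=> C; apply/seteqP; split => x.
  case=> [|[xb [M HM]]]; first exact: boundary_hull.
  apply: contrapT => /existsNP[[e f] /not_implyP[eq /negP]]; rewrite -ltNge /= => neg.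
  (* The outward normal of the violated edge: moving along it makes [orient e f] only more
     negative. *)
  pose r : pt := (f.2 - e.2, - (f.1 - e.1)).
  have r0 : r.1 != 0 \/ r.2 != 0.
    have [z|] := eqVneq r.1 0; last by left.
    have [z'|] := eqVneq r.2 0; last by right.
    move: neg z z'; rewrite /r /orient /cross /vsub /= => neg /eqP; rewrite subr_eq0 => /eqP E /eqP.
    by rewrite oppr_eq0 subr_eq0 => /eqP E'; move: neg; rewrite E E' !subrr !mul0r subrr ltxx.
  have ray T : 0 <= T -> ~ hull [:: a; b; c; d] (x.1 + T * r.1, x.2 + T * r.2).
    move=> T0 /(_ _ eq); apply/negP; rewrite -ltNge /=.
    have -> : orient e f (x.1 + T * r.1, x.2 + T * r.2) =
        orient e f x - T * ((f.1 - e.1) ^+ 2 + (f.2 - e.2) ^+ 2).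
      by rewrite /orient /cross /vsub /=; ring.
    rewrite subr_lt0; apply: lt_le_trans neg _.
    by rewrite mulr_ge0 ?addr_ge0 ?sqr_ge0.
  have comp T : 0 <= T -> `|x.1 + T * r.1| <= M /\ `|x.2 + T * r.2| <= M.
    move=> T0; apply: (HM (x.1 + T * r.1, x.2 + T * r.2)).
    apply: (@connected_component_max _ _ (seg x (x.1 + T * r.1, x.2 + T * r.2))).
    - exact: seg_l.
    - move=> z [t /andP[t0 t1] ->] /(boundary_hull C) /=.
      rewrite ![_ + _ * _ - _]addrC !addKr !mulrA => /ray; apply.
      exact: mulr_ge0.
    - exact: seg_connected.
    - exact: seg_r.
  have M0 : 0 <= M by apply: le_trans (proj1 (comp 0 _)).
  have key (k z : R) : k != 0 -> (forall T, 0 <= T -> `|z + T * k| <= M) -> False.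
    move=> k0 H; have kp : 0 < `|k| by rewrite normr_gt0.
    have := H ((M + `|z| + 1) / `|k|); rewrite divr_ge0 ?addr_ge0// => /(_ isT) h.
    have : `|(M + `|z| + 1) / `|k| * k| <= M + `|z|.
      rewrite -[X in `|X|](addKr z) addrC; apply: le_trans (ler_normB _ _) _.
      by rewrite lerD2r.
    rewrite normrM normf_div normr_id divfK ?gt_eqF// ger0_norm ?addr_ge0//.
    by apply/negP; rewrite -ltNge ltrDl.
  by case: r0 => r0; [apply: (key _ x.1 r0)|apply: (key _ x.2 r0)] => T /comp[].
move=> H; case: (hull_cases C H) => [|xi]; first by left.
right; split; first exact: interior_not_boundary.
have [M HM] := hull_bounded C; exists M => y [B [Bx BN Bc] By]; apply: HM.
(* A connected set [B] avoiding the boundary meets the open [interior_pt] and the closed [hull] in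
   the same points. This part is open and closed in [B] and contains [x], hence is all of [B]. *)
pose I : set (R * R)%type := interior_pt [:: a; b; c; d].
have BI : B `&` I = B `&` hull [:: a; b; c; d].
  apply/seteqP; split => z [zB zI]; split => //; first by move=> e eq; exact/ltW/zI.
  by case: (hull_cases C zI) => // /BN; exact.
have oc e f : @open (R * R)%type [set z | 0 < orient e f z].
  apply: (@open_comp _ _ (orient e f) [set t | 0 < t]); last exact: open_gt.
  by move=> z _; exact: orient_continuous.
have cc e f : @closed (R * R)%type [set z | 0 <= orient e f z].
  apply: (@closed_comp _ _ (orient e f) [set t | 0 <= t]); last exact: closed_ge.
  by move=> z _; exact: orient_continuous.
suff e : B `&` I = B by move: By; rewrite -e BI => -[].
apply: Bc; first by exists x.
  exists I => //.
  rewrite (_ : I = [set z | 0 < orient a b z] `&` [set z | 0 < orient b c z] `&`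
    ([set z | 0 < orient c d z] `&` [set z | 0 < orient d a z])).
    by do !apply: openI.
  by apply/seteqP; split => z; [move=> /interior4[]|move=> [[? ?] [? ?]]; apply/interior4].
exists (hull [:: a; b; c; d]) => //.
rewrite (_ : hull _ = [set z | 0 <= orient a b z] `&` [set z | 0 <= orient b c z] `&`
    ([set z | 0 <= orient c d z] `&` [set z | 0 <= orient d a z])).
  by do !apply: closedI.
by apply/seteqP; split => z; [move=> /hull4[]|move=> [[? ?] [? ?]]; apply/hull4].
Qed.

End Regions.

(** * Edges, corners and angle sums of convex quadrilaterals *)

Section Quads.
Variable R : realType.
Notation pt := (R * R)%type.
Implicit Types (p q : seq pt) (u v w a b c d x y z : pt) (e f : pt * pt).

Definition ccw_quad q := exists a b c d, q = [:: a; b; c; d] /\ ccw4 a b c d.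

(** The winding angle around [x], with value the corner angle at a vertex and 0 outside. As a sum
    over directed edges it ignores rotations of the list and fits the chain argument. *)
Definition qwind q x := \sum_(e <- qedges q) ang (vsub e.1 x) (vsub e.2 x).

(** Normal form by rotating the list until a given edge comes first; it replaces case distinctions
    over the four edges. *)
Lemma quad_edge q e : ccw_quad q -> e \in qedges q -> exists c d,
  [/\ ccw4 e.1 e.2 c d, perm_eq (qedges q) (qedges [:: e.1; e.2; c; d]) &
      perm_eq q [:: e.1; e.2; c; d]].
Proof.
move=> [a [b [c [d [-> C]]]]]; have C2 := ccw4_rot C; have C3 := ccw4_rot C2.
have C4 := ccw4_rot C3.
rewrite {1}/qedges /= !inE => /or4P[] /eqP-> /=.
- by exists c, d.
- exists d, a; split => //; rewrite perm_sym; apply/permPl; last exact: (perm_rot 1 [:: a; b; c;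
    d]).
  exact: (perm_rot 1 [:: (a, b); (b, c); (c, d); (d, a)]).
- exists a, b; split => //; rewrite perm_sym; apply/permPl; last exact: (perm_rot 2 [:: a; b; c;
    d]).
  exact: (perm_rot 2 [:: (a, b); (b, c); (c, d); (d, a)]).
- exists b, c; split => //; rewrite perm_sym; apply/permPl; last exact: (perm_rot 3 [:: a; b; c;
    d]).
  exact: (perm_rot 3 [:: (a, b); (b, c); (c, d); (d, a)]).
Qed.

Lemma quad_vertex q v : ccw_quad q -> v \in q -> exists b c d,
  [/\ ccw4 v b c d, perm_eq (qedges q) (qedges [:: v; b; c; d]) &
      perm_eq q [:: v; b; c; d]].
Proof.
move=> Q vq; have [b bq] : exists b, (v, b) \in qedges q.
  case: Q vq => a [b [c [d [-> _]]]]; rewrite /qedges /= !inE => /or4P[] /eqP->.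
  - by exists b; rewrite !inE eqxx.
  - by exists c; rewrite !inE eqxx ?orbT.
  - by exists d; rewrite !inE eqxx ?orbT.
  - by exists a; rewrite !inE eqxx ?orbT.
by have [c [d H]] := quad_edge Q bq; exists b, c, d.
Qed.

Lemma hull_perm q q' x : perm_eq (qedges q) (qedges q') -> hull q x <-> hull q' x.
Proof. by move=> P; split => H e eq; apply: H; rewrite ?(perm_mem P)// -(perm_mem P). Qed.

Lemma interior_perm q q' x : perm_eq (qedges q) (qedges q') ->
  interior_pt q x <-> interior_pt q' x.
Proof. by move=> P; split => H e eq; apply: H; rewrite ?(perm_mem P)// -(perm_mem P). Qed.

Lemma qwind_perm q q' x : perm_eq (qedges q) (qedges q') -> qwind q x = qwind q' x.
Proof. by move=> P; rewrite /qwind (perm_big _ P). Qed.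

Lemma qwindE a b c d x : qwind [:: a; b; c; d] x =
  ang (vsub a x) (vsub b x) + ang (vsub b x) (vsub c x) +
  ang (vsub c x) (vsub d x) + ang (vsub d x) (vsub a x).
Proof. by rewrite /qwind /qedges /= !big_cons big_nil addr0 !addrA. Qed.

Lemma edge_in_hull q e x : ccw_quad q -> e \in qedges q -> seg e.1 e.2 x -> hull q x.
Proof.
move=> Q eq xe; have [c [d [C P _]]] := quad_edge Q eq.
by apply/(hull_perm _ P); exact: edge_hull.
Qed.

Lemma vertex_in_hull q v : ccw_quad q -> v \in q -> hull q v.
Proof.
move=> Q vq; have [b [c [d [C P _]]]] := quad_vertex Q vq.
by apply/(hull_perm _ P); apply: edge_hull => //; exact: seg_l.
Qed.

Lemma ccw4_neq a b c d : ccw4 a b c d ->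
  [/\ a != b, a != c, a != d, b != c & (b != d) && (c != d)].
Proof.
move=> [h1 h2 h3 h4].
have N (e f g : pt) : 0 < orient e f g -> [&& e != f, f != g & g != e].
  move=> h; apply/and3P; split; apply: contraTneq h => ->;
    rewrite -leNgt /orient /cross /vsub /=; nra.
have /and3P[n1 n2 n3] := N _ _ _ h1; have /and3P[_ _ n6] := N _ _ _ h2.
have /and3P[n7 n8 n9] := N _ _ _ h3.
by rewrite n1 n9 (eq_sym a d) n8 n2 (eq_sym b d) n6 n7.
Qed.

Lemma quad_uniq q : ccw_quad q -> uniq q.
Proof.
move=> [a [b [c [d [-> C]]]]]; have [n1 n2 n3 n4 /andP[n5 n6]] := ccw4_neq C.
by rewrite /= !inE !negb_or n1 n2 n3 n4 n5 n6.
Qed.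

Lemma qedges_uniq q : ccw_quad q -> uniq (qedges q).
Proof.
move=> Q; apply: (@map_uniq _ _ fst).
have -> : map fst (qedges q) = q.
  by case: Q => a [b [c [d [-> _]]]].
exact: quad_uniq.
Qed.

Lemma edge_neq q e : ccw_quad q -> e \in qedges q -> e.1 != e.2.
Proof.
by move=> Q eq; have [c [d [C _ _]]] := quad_edge Q eq; have [] := ccw4_neq C.
Qed.

Lemma edge_vertices q e : ccw_quad q -> e \in qedges q -> e.1 \in q /\ e.2 \in q.
Proof.
move=> Q eq; have [c [d [_ _ P]]] := quad_edge Q eq.
by rewrite !(perm_mem P) !inE !eqxx orbT.
Qed.

Lemma edge_open_unique q e f x : ccw_quad q -> e \in qedges q -> f \in qedges q ->
  seg e.1 e.2 x -> x != e.1 -> x != e.2 -> seg f.1 f.2 x -> f = e.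
Proof.
move=> Q eq fq xe x1 x2 xf; have [c [d [C P _]]] := quad_edge Q eq.
have [k1 k2 k3] := edge_strict C xe x1 x2.
move: fq; rewrite (perm_mem P) /qedges /= !inE => /or4P[] /eqP E.
- by rewrite E; case: (e).
- by move: (orient_seg xf) k1; rewrite E => ->; rewrite ltxx.
- by move: (orient_seg xf) k2; rewrite E => ->; rewrite ltxx.
- by move: (orient_seg xf) k3; rewrite E => ->; rewrite ltxx.
Qed.

Lemma vertex_on_edge q e v : ccw_quad q -> e \in qedges q -> v \in q ->
  seg e.1 e.2 v -> v = e.1 \/ v = e.2.
Proof.
move=> Q eq vq ve; have [c [d [[h1 h2 h3 h4] P P']]] := quad_edge Q eq.
move: vq; rewrite (perm_mem P') !inE => /or4P[] /eqP E; [by left|by right| |].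
- by move: (orient_seg ve) h1; rewrite E => ->; rewrite ltxx.
- by move: h4; rewrite 2!orient_cyc -E (orient_seg ve) ltxx.
Qed.

Lemma lin_pos (al k : R) : 0 < al ->
  exists2 dl : R, 0 < dl & forall t, 0 < t -> t < dl -> 0 < al + t * k.
Proof.
move=> a0; have k0 : 0 < `|k| + 1 by rewrite ltr_pwDr.
exists (al / (`|k| + 1)); first by rewrite divr_gt0.
move=> t t0; rewrite ltr_pdivlMr// => h.
have : - `|k| <= k by rewrite lerNl ler_normr lexx orbT.
by have := mulr_ge0 (ltW t0) (normr_ge0 k); nra.
Qed.

Definition shift z (t : R) y : pt := (z.1 + t * y.1, z.2 + t * y.2).

Lemma orient_shift a b z t y :
  orient a b (shift z t y) = orient a b z + t * cross (vsub b a) y.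
Proof. by rewrite /orient /shift /cross /vsub /=; ring. Qed.

Definition normal e : pt := (- (e.2.2 - e.1.2), e.2.1 - e.1.1).

Lemma cross_normal e : e.1 != e.2 -> 0 < cross (vsub e.2 e.1) (normal e).
Proof.
move=> ne; have v0 : vsub e.2 e.1 != (0, 0).
  by apply: contraNneq ne => /vsub_eq0 ->.
have := vnorm_gt0 v0; have := sqr_vnorm (vsub e.2 e.1); move: (vnorm _) => N E N0.
have : 0 < N ^+ 2 by rewrite exprn_gt0.
by rewrite E /normal /cross /dot /vsub /=; lra.
Qed.

Lemma left_interior q e z : ccw_quad q -> e \in qedges q -> seg e.1 e.2 z ->
  z != e.1 -> z != e.2 -> exists2 dl : R, 0 < dl &
  forall t, 0 < t -> t < dl -> interior_pt q (shift z t (normal e)).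
Proof.
move=> Q eq ze z1 z2; have [c [d [C P _]]] := quad_edge Q eq.
have [k1 k2 k3] := edge_strict C ze z1 z2.
have [d1 p1 H1] := lin_pos (cross (vsub c e.2) (normal e)) k1.
have [d2 p2 H2] := lin_pos (cross (vsub d c) (normal e)) k2.
have [d3 p3 H3] := lin_pos (cross (vsub e.1 d) (normal e)) k3.
exists (Num.min d1 (Num.min d2 d3)); first by rewrite !lt_min p1 p2.
move=> t t0; rewrite !lt_min => /and3P[t1 t2 t3].
apply/(interior_perm _ P)/interior4; split; rewrite orient_shift; [|exact: H1|exact: H2|exact: H3].
by rewrite (orient_seg ze) add0r mulr_gt0// cross_normal// (edge_neq Q).
Qed.

Lemma right_outside q e z t : ccw_quad q -> e \in qedges q -> seg e.1 e.2 z ->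
  0 < t -> ~ hull q (shift z (- t) (normal e)).
Proof.
move=> Q eq ze t0 /(_ _ eq); rewrite orient_shift (orient_seg ze) add0r mulNr oppr_ge0.
by apply/negP; rewrite -ltNge mulr_gt0// cross_normal// (edge_neq Q).
Qed.

Lemma wedge_interior a b c d y : ccw4 a b c d ->
  0 < cross (vsub b a) y -> 0 < cross y (vsub d a) ->
  exists2 dl : R, 0 < dl &
  forall t, 0 < t -> t < dl -> interior_pt [:: a; b; c; d] (shift a t y).
Proof.
move=> [h1 h2 h3 h4] y1 y2.
have h2' : 0 < orient b c a by rewrite orient_cyc.
have [d1 p1 H1] := lin_pos (cross (vsub c b) y) h2'.
have [d2 p2 H2] := lin_pos (cross (vsub d c) y) h3.
exists (Num.min d1 d2); first by rewrite lt_min p1.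
move=> t t0; rewrite lt_min => /andP[t1 t2].
apply/interior4; split; rewrite orient_shift; [|exact: H1|exact: H2|].
  by rewrite orientll add0r mulr_gt0.
rewrite orientlr add0r mulr_gt0//.
by move: y2; rewrite /cross /vsub /=; lra.
Qed.

Lemma corner_angle a b c d : ccw4 a b c d ->
  ang (vsub b a) (vsub c a) + ang (vsub c a) (vsub d a) = ang (vsub b a) (vsub d a).
Proof.
move=> [h1 h2 h3 h4].
(* The normal of the diagonal from [b] to [d]: by convexity [b], [c] and [d] lie strictly on one
   side of its parallel through [a]. *)
by apply: (ang3_half (n1 := d.2 - b.2) (n2 := - (d.1 - b.1)));
  move: h1 h2 h3 h4; rewrite /orient /cross /vsub /=; lra.
Qed.

Lemma qwind_corner a b c d : ccw4 a b c d ->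
  qwind [:: a; b; c; d] a = ang (vsub b a) (vsub d a).
Proof.
move=> C; rewrite qwindE ang_collinear ?add0r; last by rewrite /cross /vsub /=; ring.
rewrite [X in _ + X]ang_collinear ?addr0; last by rewrite /cross /vsub /=; ring.
exact: corner_angle.
Qed.

(** The three edge directions make left turns that add up to [2 * pi], and each interior angle is
    the supplement of such a turn. *)
Lemma triangle_angles a b c : 0 < orient a b c ->
  ang (vsub b a) (vsub c a) + ang (vsub c b) (vsub a b) + ang (vsub a c) (vsub b c) = pi.
Proof.
move=> h.
have h1 : 0 < cross (vsub b a) (vsub c b) by move: h; rewrite /orient /cross /vsub /=; lra.
have h2 : 0 < cross (vsub c b) (vsub a c) by move: h; rewrite /orient /cross /vsub /=; lra.
have h3 : 0 < cross (vsub a c) (vsub b a) by move: h; rewrite /orient /cross /vsub /=; lra.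
have N (e f : pt) : vsub (0, 0) (vsub e f) = vsub f e :> pt.
  by rewrite /vsub /= !sub0r !opprB.
have := ang3_pos h1 h2 h3; have := ang_suppl h1; have := ang_suppl h2; have := ang_suppl h3.
by rewrite !N; lra.
Qed.

(** The diagonal from [a] to [c] splits two of the angles and leaves two triangles. *)
Lemma qwind_sum q : ccw_quad q -> \sum_(v <- q) qwind q v = 2 * pi.
Proof.
move=> [a [b [c [d [-> C]]]]]; have C2 := ccw4_rot C; have C3 := ccw4_rot C2.
have C4 := ccw4_rot C3; rewrite !big_cons big_nil addr0.
rewrite qwind_corner//.
have -> : qwind [:: a; b; c; d] b = qwind [:: b; c; d; a] b by rewrite !qwindE; ring.
have -> : qwind [:: a; b; c; d] c = qwind [:: c; d; a; b] c by rewrite !qwindE; ring.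
have -> : qwind [:: a; b; c; d] d = qwind [:: d; a; b; c] d by rewrite !qwindE; ring.
rewrite !qwind_corner// -(corner_angle C) -(corner_angle C3).
case: C => h1 h2 h3 h4; have := triangle_angles h1; have := triangle_angles h3.
lra.
Qed.

(** From beyond a violated edge line all four vertices are seen within an open half-plane, where
    angles add up, so the closed sum telescopes to 0. *)
Lemma qwind_out q x : ccw_quad q -> ~ hull q x -> qwind q x = 0.
Proof.
move=> Q /existsNP[e /not_implyP[eq /negP]]; rewrite -ltNge => neg.
have [c [d [[h1 h2 h3 h4] P _]]] := quad_edge Q eq.
rewrite (qwind_perm _ P) qwindE.
have H v : 0 <= orient e.1 e.2 v ->
    0 < - (e.2.2 - e.1.2) * (vsub v x).1 + (e.2.1 - e.1.1) * (vsub v x).2.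
  by move: neg; rewrite /orient /cross /vsub /=; lra.
have Ha := H e.1; have Hb := H e.2; rewrite orientll lexx in Ha; rewrite orientlr lexx in Hb.
have Hd : 0 <= orient e.1 e.2 d by rewrite -orient_cyc -orient_cyc ltW.
rewrite (ang3_half (Ha isT) (Hb isT) (H c (ltW h1))).
rewrite (ang3_half (Ha isT) (H c (ltW h1)) (H d Hd)).
by rewrite (angC (vsub e.1 x)) subrr.
Qed.

Lemma qwind_vertex_gt0 q v : ccw_quad q -> v \in q -> 0 < qwind q v.
Proof.
move=> Q vq; have [b [c [d [C P _]]]] := quad_vertex Q vq.
rewrite (qwind_perm _ P) qwind_corner//.
have h : 0 < cross (vsub b v) (vsub d v).
  by case: C => _ _ _; rewrite /orient /cross /vsub /=; lra.
by have /andP[] := ang_gt0 h.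
Qed.

Lemma area_gt0 q : ccw_quad q -> 0 < \sum_(e <- qedges q) cross e.1 e.2.
Proof.
move=> [a [b [c [d [-> [h1 h2 h3 h4]]]]]].
rewrite /qedges /= !big_cons big_nil /=.
by move: h1 h3; rewrite /orient /cross /vsub /=; lra.
Qed.

Definition ccw_of q := if 0 < area2 q then q else rev q.

(** Angle 0 is excluded by the condition on collinear edges, and [2 * pi / 3] is below [pi]; so the
    sine is positive. This makes the quadrilaterals of the mesh convex. *)
Lemma ccw_angle_small u w : u != (0, 0) -> w != (0, 0) ->
  (cross u w = 0 -> dot u w <= 0) -> ccw_angle u w < 2 * pi / 3 ->
  0 < cross u w /\ ang u w = ccw_angle u w.
Proof.
move=> u0 w0 H A; have p0 := pi_gt0 R.
have P0 : 0 < vnorm u * vnorm w by rewrite mulr_gt0 ?vnorm_gt0.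
have [c s /andP[A0 _]] := ccw_angle_spec u0 w0.
suff cp : 0 < cross u w.
  by split => //; rewrite /ang /ccw_angle gtr0_sg// mul1r (ltW cp).
have [e|An] := eqVneq (ccw_angle u w) 0.
  move: c s; rewrite e cos0 sin0 mulr1 mulr0 => c s.
  by have := H (esym s); rewrite -c leNgt P0.
rewrite -s mulr_gt0// sin_gt0_pi// lt0r An A0 /=; lra.
Qed.

Lemma wind4 a b c d x : wind [:: a; b; c; d] x = qwind [:: a; b; c; d] x.
Proof. by rewrite /wind qwindE !big_ord_recr big_ord0 /= add0r. Qed.

Lemma qwind_rev a b c d x : qwind (rev [:: a; b; c; d]) x = - qwind [:: a; b; c; d] x.
Proof.
rewrite /rev /= !qwindE (angC (vsub c x) (vsub d x)) (angC (vsub b x) (vsub c x)).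
by rewrite (angC (vsub a x) (vsub b x)) (angC (vsub d x) (vsub a x)); ring.
Qed.

Lemma boundary_rev a b c d : boundary (rev [:: a; b; c; d]) = boundary [:: a; b; c; d].
Proof.
have S (e f : pt) : seg e f = seg f e :> set pt by apply/seteqP; split => x; exact: seg_sym.
apply/seteqP; split => x /boundary4[e]; rewrite /qedges /= !inE => /or4P[] /eqP-> /=;
  rewrite S => H; apply/boundary4; rewrite /qedges /=.
- by exists (c, d) => //; rewrite !inE eqxx ?orbT.
- by exists (b, c) => //; rewrite !inE eqxx ?orbT.
- by exists (a, b) => //; rewrite !inE eqxx ?orbT.
- by exists (d, a) => //; rewrite !inE eqxx ?orbT.
- by exists (b, a) => //; rewrite !inE eqxx ?orbT.
- by exists (c, b) => //; rewrite !inE eqxx ?orbT.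
- by exists (d, c) => //; rewrite !inE eqxx ?orbT.
- by exists (a, d) => //; rewrite !inE eqxx ?orbT.
Qed.

Lemma ccw_ofP q : size q = 4%N -> simple_polygon q ->
  (forall k, (k < 4)%N -> interior_angle q k < 2 * pi / 3) ->
  [/\ ccw_quad (ccw_of q), forall v, v \in ccw_of q -> qwind (ccw_of q) v < 2 * pi / 3 &
      region q = hull (ccw_of q)].
Proof.
move=> sq P H; have CE := corner_edges P.
case: q sq P H CE => [|a [|b [|c [|d []]]]] //= _ P H CE.
have {}H k : (k < 4)%N -> let u := vsub (vtx [:: a; b; c; d] k.+1) (vtx [:: a; b; c; d] k) in
    let w := vsub (vtx [:: a; b; c; d] (k + 4).-1) (vtx [:: a; b; c; d] k) in
    if 0 < area2 [:: a; b; c; d] then 0 < cross u w /\ ang u w < 2 * pi / 3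
    else 0 < cross w u /\ ang w u < 2 * pi / 3.
  move=> kN u w; have := H k kN; rewrite /interior_angle /= -/u -/w.
  have [u0 w0 uw] := CE k; case: ifP => _ A.
    by have [h1 h2] := ccw_angle_small u0 w0 uw A; rewrite h2.
  have wu : cross w u = 0 -> dot w u <= 0.
    by rewrite (dotC u w) (crossC u w) => /eqP; rewrite oppr_eq0 => /eqP; exact: uw.
  by have [h1 h2] := ccw_angle_small w0 u0 wu A; rewrite h2.
have := (H 0%N isT, H 1%N isT, H 2%N isT, H 3%N isT).
rewrite /ccw_of; case: ifP => area [[[]]]; rewrite /vtx /= => -[A0 A0'] [A1 A1'] [A2 A2'] [A3 A3'].
  have C : ccw4 a b c d.
    by move: A0 A1 A2 A3; rewrite /ccw4 /orient /cross /vsub /= => *; split; lra.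
  split; [by exists a, b, c, d| |exact: region_hull].
  have C2 := ccw4_rot C; have C3 := ccw4_rot C2; have C4 := ccw4_rot C3.
  move=> v; rewrite !inE => /or4P[] /eqP->.
  - by rewrite qwind_corner.
  - have -> : qwind [:: a; b; c; d] b = qwind [:: b; c; d; a] b by rewrite !qwindE; ring.
    by rewrite qwind_corner.
  - have -> : qwind [:: a; b; c; d] c = qwind [:: c; d; a; b] c by rewrite !qwindE; ring.
    by rewrite qwind_corner.
  - have -> : qwind [:: a; b; c; d] d = qwind [:: d; a; b; c] d by rewrite !qwindE; ring.
    by rewrite qwind_corner.
have C : ccw4 d c b a.
  by move: A0 A1 A2 A3; rewrite /ccw4 /orient /cross /vsub /= => *; split; lra.
have C2 := ccw4_rot C; have C3 := ccw4_rot C2; have C4 := ccw4_rot C3.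
split; [by exists d, c, b, a| |].
  move=> v; rewrite /rev /= !inE => /or4P[] /eqP->.
  - by rewrite qwind_corner.
  - have -> : qwind [:: d; c; b; a] c = qwind [:: c; b; a; d] c by rewrite !qwindE; ring.
    by rewrite qwind_corner.
  - have -> : qwind [:: d; c; b; a] b = qwind [:: b; a; d; c] b by rewrite !qwindE; ring.
    by rewrite qwind_corner.
  - have -> : qwind [:: d; c; b; a] a = qwind [:: a; d; c; b] a by rewrite !qwindE; ring.
    by rewrite qwind_corner.
by rewrite -(region_hull C) /region boundary_rev.
Qed.

Lemma mem_ccw_of q : ccw_of q =i q.
Proof. by move=> v; rewrite /ccw_of; case: ifP => // _; rewrite mem_rev. Qed.

Lemma ccw_of_edge q k : size q = 4%N -> (k < 4)%N ->
  exists2 e, e \in qedges (ccw_of q) & edge q k = seg e.1 e.2.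
Proof.
have S (e f : pt) : seg e f = seg f e :> set pt by apply/seteqP; split => x; exact: seg_sym.
case: q => [|a [|b [|c [|d []]]]] //= _; rewrite /ccw_of; case: ifP => _.
  case: k => [|[|[|[|]]]] // _; rewrite /edge /vtx /qedges /=.
  - by exists (a, b) => //; rewrite !inE eqxx ?orbT.
  - by exists (b, c) => //; rewrite !inE eqxx ?orbT.
  - by exists (c, d) => //; rewrite !inE eqxx ?orbT.
  - by exists (d, a) => //; rewrite !inE eqxx ?orbT.
case: k => [|[|[|[|]]]] // _; rewrite /edge /vtx /qedges /= S.
- by exists (b, a) => //; rewrite !inE eqxx ?orbT.
- by exists (c, b) => //; rewrite !inE eqxx ?orbT.
- by exists (d, c) => //; rewrite !inE eqxx ?orbT.
- by exists (a, d) => //; rewrite !inE eqxx ?orbT.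
Qed.

(** Seen from a point that is no vertex, a quadrilateral winds by a multiple of [pi]. This serves at
    corners of P through which a mesh edge passes. *)
Lemma sin_qwind q x : size q = 4%N -> simple_polygon q -> x \notin q ->
  sin (qwind (ccw_of q) x) = 0.
Proof.
move=> sq P xq.
have : sin (wind q x) = 0.
  case: (pselect (boundary q x)) => [[i iN xi]|h]; last by case: (wind_out P h).
  have V k : x <> vtx q k.
    by move=> e; move: xq; rewrite e /vtx mem_nth// ltn_mod sq.
  by have [] := wind_edge P xi (V i) (V i.+1).
case: q sq xq P => [|a [|b [|c [|d []]]]] //= _ _ _; rewrite wind4 /ccw_of.
by case: ifP => // _; rewrite qwind_rev sinN => ->; rewrite oppr0.
Qed.

(** The ends of a segment are its extreme points: an end lying between two points of the segment is
    one of them. *)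
Lemma seg_inj a b c d : seg a b = seg c d -> (a = c /\ b = d) \/ (a = d /\ b = c).
Proof.
have ext (e f x y : pt) : seg e f x -> seg e f y -> seg x y e -> e = x \/ e = y.
  move=> [s s01 ->] [t t01 ->] [r r01 E].
  have h1 := congr1 fst E; have h2 := congr1 snd E; rewrite /= {E} in h1 h2.
  have [ef|ef] := eqVneq e f.
    by left; rewrite ef !subrr !mulr0 !addr0 -surjective_pairing.
  have k : s + r * (t - s) = 0.
    apply/eqP; apply: contraNT ef => k.
    have z (i j : R) : i = i + s * (j - i) + r * (i + t * (j - i) - (i + s * (j - i))) -> i = j.
      move=> h; have : (s + r * (t - s)) * (j - i) = 0 by lra.
      by move/eqP; rewrite mulf_eq0 (negbTE k) subr_eq0 /= => /eqP.
    by rewrite (surjective_pairing e) (surjective_pairing f) (z _ _ h1) (z _ _ h2).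
  have [s0|s0] := eqVneq s 0.
    by left; rewrite s0 !mul0r !addr0 -surjective_pairing.
  right; suff -> : t = 0 by rewrite !mul0r !addr0 -surjective_pairing.
  have p1 : 0 <= s * (1 - r) by apply: mulr_ge0; lra.
  have p2 : 0 <= r * t by apply: mulr_ge0; lra.
  have /eqP : s * (1 - r) = 0 by lra.
  rewrite mulf_eq0 (negbTE s0) /= => /eqP r1.
  by have -> : t = r * t by [rewrite (_ : r = 1) ?mul1r//; lra]; lra.
move=> E.
have ac : seg c d a by rewrite -E; exact: seg_l.
have bc : seg c d b by rewrite -E; exact: seg_r.
have ca : seg a b c by rewrite E; exact: seg_l.
have da : seg a b d by rewrite E; exact: seg_r.
have h1 : a = c \/ a = d by apply: (ext a b) => //; rewrite -E; exact: seg_l.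
have h2 : b = c \/ b = d.
  by apply: (ext b a); [exact: seg_sym|exact: seg_sym|rewrite -E; exact: seg_r].
have h3 : c = a \/ c = b by apply: (ext c d) => //; rewrite E; exact: seg_l.
have h4 : d = a \/ d = b.
  by apply: (ext d c); [exact: seg_sym|exact: seg_sym|rewrite E; exact: seg_r].
case: h1 => h1; case: h2 => h2; [|by left|by right|].
  by subst; case: h4 => ->; left.
by subst; case: h3 => ->; left.
Qed.

End Quads.

(** * Disjoint wedges at a point *)

Section Packing.
Variable R : realType.
Notation pt := (R * R)%type.
Implicit Types (u v y : pt) (w : pt * pt).

(** Entries are pairs of a left end and a length. The head divides the others into those to its left
    and those to its right, and both groups are bounded by induction. *)
Lemma interval_packing (s : seq (R * R)) (lo up : R) : lo <= up ->
  (forall x, x \in s -> lo <= x.1 /\ x.1 + x.2 <= up) ->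
  pairwise (fun x y => (x.1 + x.2 <= y.1) || (y.1 + y.2 <= x.1)) s ->
  \sum_(x <- s) x.2 <= up - lo.
Proof.
have [m] := ubnP (size s); elim: m s lo up => // m IH [|a s] lo up sm lu H.
  by rewrite big_nil subr_ge0.
rewrite /= => /andP[/allP ha pw]; rewrite big_cons.
rewrite (bigID (fun x => x.1 + x.2 <= a.1)) /=.
rewrite -big_filter -[X in _ + (_ + X)]big_filter.
have [a1 a2] := H a (mem_head _ _).
have sub (P : pred (R * R)) : {subset seq.filter P s <= a :: s}.
  by move=> x; rewrite mem_filter inE => /andP[_ ->]; rewrite orbT.
have h1 : \sum_(x <- s | x.1 + x.2 <= a.1) x.2 <= a.1 - lo.
  rewrite -big_filter; apply: IH.
  - by rewrite size_filter; apply: leq_ltn_trans (count_size _ _) _; exact: sm.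
  - exact: a1.
  - move=> x xs; split; first by have [] := H x (sub _ _ xs).
    by move: xs; rewrite mem_filter => /andP[].
  - exact: pairwise_filter.
have h2 : \sum_(x <- s | ~~ (x.1 + x.2 <= a.1)) x.2 <= up - (a.1 + a.2).
  rewrite -big_filter; apply: IH.
  - by rewrite size_filter; apply: leq_ltn_trans (count_size _ _) _; exact: sm.
  - exact: a2.
  - move=> x xs; split; last by have [] := H x (sub _ _ xs).
    move: xs; rewrite mem_filter => /andP[xa xs].
    by have := ha x xs; rewrite (negbTE xa) orbF.
  - exact: pairwise_filter.
by rewrite !big_filter; lra.
Qed.

(** An argument of [u] in the period starting at [phi0]. The implication stands below the
    existential so that [choice] yields a function of all vectors. *)
Lemma polar (phi0 : R) u : exists phi : R, u != (0, 0) ->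
  [/\ phi0 <= phi < phi0 + 2 * pi, u.1 = vnorm u * cos phi & u.2 = vnorm u * sin phi].
Proof.
have [u0|u0] := eqVneq u (0, 0); first by exists 0.
pose e : pt := (cos phi0, sin phi0).
have ee : dot e e = 1 by rewrite /dot /= -!expr2 cos2Dsin2.
have e0 : e != (0, 0).
  by apply/eqP => E; move: ee; rewrite E /dot /= !mul0r addr0 => /eqP; rewrite eq_sym oner_eq0.
have ne : vnorm e = 1 by rewrite /vnorm ee sqrtr1.
have [c s b] := ccw_angle_spec e0 u0; rewrite ne !mul1r in c s.
exists (phi0 + ccw_angle e u) => _; split; first lra.
  rewrite cosD mulrBr ![vnorm u * (_ * _)]mulrCA c s /dot /cross /e /=.
  by transitivity (u.1 * (cos phi0 ^+ 2 + sin phi0 ^+ 2)); [rewrite cos2Dsin2 mulr1|ring].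
rewrite sinD mulrDr ![vnorm u * (_ * _)]mulrCA c s /dot /cross /e /=.
by transitivity (u.2 * (cos phi0 ^+ 2 + sin phi0 ^+ 2)); [rewrite cos2Dsin2 mulr1|ring].
Qed.

Definition in_wedge w y := 0 < cross w.1 y /\ 0 < cross y w.2.

Lemma wedge_direction w (phi t : R) : 0 < cross w.1 w.2 ->
  w.1.1 = vnorm w.1 * cos phi -> w.1.2 = vnorm w.1 * sin phi ->
  phi < t -> t < phi + ang w.1 w.2 -> in_wedge w (cos t, sin t).
Proof.
case: w => u v /= c u1 u2 t1 t2.
have na : nonanti u v by left; rewrite gt_eqF.
have u0 := vnorm_gt0 (nonanti_neq0l na); have v0 := vnorm_gt0 (nonanti_neq0r na).
have /andP[a0 a1] := ang_gt0 c.
have ca := cos_ang na; have sa := sin_ang na; set A := ang u v in ca sa a0 a1 t2.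
have v1 : v.1 = vnorm v * cos (phi + A).
  apply: (mulfI (lt0r_neq0 u0)); rewrite cosD.
  transitivity ((vnorm u * vnorm v * cos A) * cos phi - (vnorm u * vnorm v * sin A) * sin phi).
    rewrite ca sa /dot /cross u1 u2.
    by transitivity (vnorm u * v.1 * (cos phi ^+ 2 + sin phi ^+ 2)); [rewrite cos2Dsin2 mulr1|ring].
  by ring.
have v2 : v.2 = vnorm v * sin (phi + A).
  apply: (mulfI (lt0r_neq0 u0)); rewrite sinD.
  transitivity ((vnorm u * vnorm v * cos A) * sin phi + (vnorm u * vnorm v * sin A) * cos phi).
    rewrite ca sa /dot /cross u1 u2.
    by transitivity (vnorm u * v.2 * (cos phi ^+ 2 + sin phi ^+ 2)); [rewrite cos2Dsin2 mulr1|ring].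
  by ring.
split; rewrite /cross /=.
  rewrite u1 u2 (_ : _ - _ = vnorm u * sin (t - phi)); last by rewrite sinB; ring.
  by rewrite mulr_gt0// sin_gt0_pi//; lra.
rewrite v1 v2 (_ : _ - _ = vnorm v * sin (phi + A - t)); last by rewrite [in RHS]sinB; ring.
by rewrite mulr_gt0// sin_gt0_pi//; lra.
Qed.

(* Measuring arguments from the first side of one of the wedges, no other
   wedge wraps around, so they become disjoint intervals. *)
Lemma wedge_packing (ws : seq (pt * pt)) :
  (forall w, w \in ws -> 0 < cross w.1 w.2) ->
  pairwise (fun w w' => `[< forall y, in_wedge w y -> in_wedge w' y -> False >]) ws ->
  \sum_(w <- ws) ang w.1 w.2 <= 2 * pi.
Proof.
have p0 := pi_gt0 R.
case: ws => [_ _|w0 ws H]; first by rewrite big_nil; lra.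
rewrite /= => /andP[/allP h0 pw].
have nz w : 0 < cross w.1 w.2 -> w.1 != (0, 0).
  by move=> c; apply: (@nonanti_neq0l _ _ w.2); left; rewrite gt_eqF.
have H0 := H w0 (mem_head _ _).
have [phi0 /(_ (nz _ H0))[_ w01 w02]] := polar 0 w0.1.
have [st Hst] := choice (polar phi0).
have over w w' (a b : R) : 0 < cross w.1 w.2 -> 0 < cross w'.1 w'.2 ->
    w.1.1 = vnorm w.1 * cos a -> w.1.2 = vnorm w.1 * sin a ->
    w'.1.1 = vnorm w'.1 * cos b -> w'.1.2 = vnorm w'.1 * sin b ->
    (forall y, in_wedge w y -> in_wedge w' y -> False) ->
    (a + ang w.1 w.2 <= b) || (b + ang w'.1 w'.2 <= a).
  move=> c c' a1 a2 b1 b2 D; apply: contrapT => /negP; rewrite negb_or -!ltNge => /andP[h1 h2].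
  have /andP[g1 _] := ang_gt0 c; have /andP[g2 _] := ang_gt0 c'.
  (* The middle of the common part of two overlapping angle intervals is a direction in both
     wedges. *)
  pose m := (Num.max a b + Num.min (a + ang w.1 w.2) (b + ang w'.1 w'.2)) / 2.
  have hm : Num.max a b < Num.min (a + ang w.1 w.2) (b + ang w'.1 w'.2).
    by rewrite gt_max !lt_min h1 h2 !ltrDl g1 g2.
  have m1 : Num.max a b < m by rewrite /m; lra.
  have m2 : m < Num.min (a + ang w.1 w.2) (b + ang w'.1 w'.2) by rewrite /m; lra.
  move: m1 m2; rewrite gt_max lt_min => /andP[k1 k2] /andP[k3 k4].
  by apply: (D (cos m, sin m)); [exact: wedge_direction k1 k3|exact: wedge_direction k2 k4].
have Hw w : w \in ws -> [/\ 0 < cross w.1 w.2,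
    phi0 <= st w.1 < phi0 + 2 * pi, w.1.1 = vnorm w.1 * cos (st w.1) &
    w.1.2 = vnorm w.1 * sin (st w.1)].
  move=> ww; have c : 0 < cross w.1 w.2 by apply: H; rewrite inE ww orbT.
  by have [? ? ?] := Hst w.1 (nz _ c).
pose iv := (phi0, ang w0.1 w0.2) :: [seq (st w.1, ang w.1 w.2) | w <- ws].
have -> : \sum_(w <- w0 :: ws) ang w.1 w.2 = \sum_(x <- iv) x.2.
  by rewrite /iv !big_cons big_map.
have -> : 2 * pi = (phi0 + 2 * pi) - phi0 by ring.
apply: interval_packing; first lra.
  move=> x; rewrite inE => /orP[/eqP->|/mapP[w ww ->]] /=.
    by have := ang_gt0 H0; lra.
  have [c b s1 s2] := Hw w ww; split; first lra.
  (* Comparison with the next turn of [w0], which starts at [phi0 + 2 * pi], shows that [w] ends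
     before it. *)
  have := over w0 w (phi0 + 2 * pi) (st w.1) H0 c.
  rewrite (addrC phi0) mulr_natl !(addrC (pi *+ 2)) cosD2pi sinD2pi => /(_ w01 w02 s1 s2).
  have /asboolP D := h0 w ww; move=> /(_ D); rewrite -mulr_natl.
  by case/orP; have := ang_gt0 H0; lra.
rewrite /iv pairwise_cons; apply/andP; split.
  apply/allP => x /mapP[w ww ->] /=; have [c b s1 s2] := Hw w ww.
  by apply: over => //; apply/asboolP; exact: h0.
rewrite pairwise_map; apply: (@sub_in_pairwise _ (mem ws)) pw; last exact/allP.
move=> w w' ww ww' /asboolP D /=.
have [c b s1 s2] := Hw w ww; have [c' b' s1' s2'] := Hw w' ww'.
exact: over.
Qed.

End Packing.

(** * The boundary chain of a mesh *)

Section Mesh.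
Variable R : realType.
Notation pt := (R * R)%type.
Implicit Types (p q : seq pt) (u v a b c d x y z : pt) (e f : pt * pt).

Definition swap e := (e.2, e.1).

(** The mesh with every quadrilateral listed counterclockwise and regions replaced by hulls. A
    shared edge might a priori run the same way in both; [edge_once] excludes this. *)
Record ccw_mesh (M : seq (seq pt)) (K : set pt) : Prop := CcwMesh {
  mesh_ccw : forall q, q \in M -> ccw_quad q;
  mesh_cover : forall x, K x <-> exists2 q, q \in M & hull q x;
  mesh_meet : forall i j, (i < size M)%N -> (j < size M)%N -> i != j ->
    let A := nth [::] M i in let B := nth [::] M j in
    [\/ forall x, hull A x -> hull B x -> False,
        exists2 v, v \in A /\ v \in B & forall x, hull A x -> hull B x -> x = v |
        exists2 e, e \in qedges A /\ (e \in qedges B \/ swap e \in qedges B) &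
          forall x, hull A x -> hull B x -> seg e.1 e.2 x] }.

Section Fixed.
Variables (p : seq pt) (M : seq (seq pt)).
Hypothesis HM : ccw_mesh M (region p).

Let ccwM i : (i < size M)%N -> ccw_quad (nth [::] M i).
Proof. by move=> iM; apply: (mesh_ccw HM); exact: mem_nth. Qed.

Lemma interior_notin q v : ccw_quad q -> v \in q -> ~ interior_pt q v.
Proof.
move=> Q vq H; have [b [c [d [C P _]]]] := quad_vertex Q vq.
by move/(interior_perm _ P)/interior4: H => [] /[!orientll]; rewrite ltxx.
Qed.

Lemma interior_disjoint i j y : (i < size M)%N -> (j < size M)%N -> i != j ->
  interior_pt (nth [::] M i) y -> hull (nth [::] M j) y -> False.
Proof.
move=> iM jM ij yi yj.
have yi' : hull (nth [::] M i) y by move=> e eq; exact/ltW/yi.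
case: (mesh_meet HM iM jM ij) => [|[v [vi _]]|[e [ei _]]] /(_ y yi' yj) //.
  by move=> e; apply: (interior_notin (ccwM iM) vi); rewrite -e.
by move=> /orient_seg e0; have := yi e ei; rewrite e0 ltxx.
Qed.

(** Both quadrilaterals would lie to the left of the directed edge, so just left of its midpoint
    their interiors would meet. *)
Lemma edge_once i j e : (i < size M)%N -> (j < size M)%N ->
  e \in qedges (nth [::] M i) -> e \in qedges (nth [::] M j) -> i = j.
Proof.
move=> iM jM ei ej; apply/eqP; apply: contraT => ij.
pose z : pt := (e.1.1 + 2^-1 * (e.2.1 - e.1.1), e.1.2 + 2^-1 * (e.2.2 - e.1.2)).
have ze : seg e.1 e.2 z by exists 2^-1 => //; rewrite invr_ge0 ler0n invf_le1 ?ler1n.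
have nq := edge_neq (ccwM iM) ei.
have E (k : R) : k != 0 -> k * (e.2.1 - e.1.1) = 0 -> k * (e.2.2 - e.1.2) = 0 -> False.
  move=> k0 /eqP; rewrite mulf_eq0 (negbTE k0) subr_eq0 /= => /eqP h1.
  move=> /eqP; rewrite mulf_eq0 (negbTE k0) subr_eq0 /= => /eqP h2.
  by move: nq; rewrite (surjective_pairing e.1) (surjective_pairing e.2) h1 h2 eqxx.
have z1 : z != e.1.
  apply/eqP => ez; apply: (E 2^-1); first by rewrite invr_eq0 pnatr_eq0.
    by move: (congr1 fst ez) => /=; lra.
  by move: (congr1 snd ez) => /=; lra.
have z2 : z != e.2.
  apply/eqP => ez; apply: (E 2^-1); first by rewrite invr_eq0 pnatr_eq0.
    by move: (congr1 fst ez) => /=; lra.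
  by move: (congr1 snd ez) => /=; lra.
have [d1 p1 H1] := left_interior (ccwM iM) ei ze z1 z2.
have [d2 p2 H2] := left_interior (ccwM jM) ej ze z1 z2.
pose t := Num.min d1 d2 / 2.
have m0 : 0 < Num.min d1 d2 by rewrite lt_min p1.
have t0 : 0 < t by rewrite divr_gt0.
have : t < Num.min d1 d2 by rewrite /t; lra.
rewrite lt_min => /andP[t1 t2]; exfalso.
apply: (interior_disjoint iM jM ij (H1 t t0 t1)).
by move=> f fj; exact/ltW/H2.
Qed.

(** There are no hanging vertices. Hence the quadrilaterals contributing to the angle at a mesh
    vertex are those counted by its degree. *)
Lemma mesh_vertex i j x : (i < size M)%N -> (j < size M)%N ->
  x \in nth [::] M i -> hull (nth [::] M j) x -> x \in nth [::] M j.
Proof.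
move=> iM jM xi xj; have [<-//|ij] := eqVneq i j.
have xi' := vertex_in_hull (ccwM iM) xi.
case: (mesh_meet HM iM jM ij) => [|[v [_ vj]]|[e [ei ej]]] /(_ x xi' xj) //.
  by move=> ->.
move=> xe; have := vertex_on_edge (ccwM iM) ei xi xe.
by case: ej => /(edge_vertices (ccwM jM)) /= [h1 h2] [->|->].
Qed.

Lemma edge_overlap i j e f y : (i < size M)%N -> (j < size M)%N ->
  e \in qedges (nth [::] M i) -> f \in qedges (nth [::] M j) ->
  seg e.1 e.2 y -> y != e.1 -> y != e.2 ->
  seg f.1 f.2 y -> y != f.1 -> y != f.2 -> f = e \/ f = swap e.
Proof.
move=> iM jM ei fj ye e1 e2 yf f1 f2; have [E|ij] := eqVneq i j.
  by left; rewrite -E in fj; exact: edge_open_unique (ccwM iM) ei fj ye e1 e2 yf.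
have yi := edge_in_hull (ccwM iM) ei ye; have yj := edge_in_hull (ccwM jM) fj yf.
case: (mesh_meet HM iM jM ij) => [/(_ y yi yj)//|[v [vi _] /(_ y yi yj) yv]
    |[g [gi gj] /(_ y yi yj) yg]].
  rewrite yv in ye e1 e2; have := vertex_on_edge (ccwM iM) ei vi ye.
  by case=> E; [move: e1|move: e2]; rewrite E eqxx.
have ge := edge_open_unique (ccwM iM) ei gi ye e1 e2 yg; subst g.
case: gj => gj; first by move/eqP: ij; case; exact: edge_once iM jM ei gj.
right; apply/esym; apply: (edge_open_unique (ccwM jM) fj gj yf f1 f2).
exact: seg_sym.
Qed.

Definition dedges := flatten [seq qedges q | q <- M].

Lemma dedgesP e : e \in dedges ->
  exists2 i, (i < size M)%N & e \in qedges (nth [::] M i).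
Proof.
move=> /flatten_mapP[q qM eq]; exists (index q M); first by rewrite index_mem.
by rewrite nth_index.
Qed.

Lemma mem_dedges i e : (i < size M)%N -> e \in qedges (nth [::] M i) -> e \in dedges.
Proof.
by move=> iM ei; apply/flatten_mapP; exists (nth [::] M i) => //; exact: mem_nth.
Qed.

Lemma dedges_uniq : uniq dedges.
Proof.
have U (T : eqType) (ss : seq (seq T)) : (forall s, s \in ss -> uniq s) ->
    (forall i j (x : T), (i < size ss)%N -> (j < size ss)%N -> x \in nth [::] ss i ->
      x \in nth [::] ss j -> i = j) -> uniq (flatten ss).
  elim: ss => //= s ss IH u d; rewrite cat_uniq u ?mem_head//=.
  rewrite IH ?andbT; last 2 first.
  - by move=> s' s's; apply: u; rewrite inE s's orbT.
  - by move=> i j x iS jS xi xj; apply: succn_inj; exact: (d i.+1 j.+1 x).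
  apply/hasPn => x /flattenP[s' s's xs']; apply/negP => xs.
  have := d 0%N (index s' ss).+1 x isT; rewrite /= ltnS index_mem nth_index//.
  by move=> /(_ s's xs xs').
apply: U.
  by move=> s /mapP[q qM ->]; apply: qedges_uniq; exact: (mesh_ccw HM).
move=> i j e; rewrite !size_map => iM jM; rewrite !(nth_map [::])//.
exact: edge_once.
Qed.

(** The boundary is closed, so an end of the edge that is off the boundary can be pushed slightly
    towards the midpoint and stay off it. *)
Lemma open_point e z : e.1 != e.2 -> seg e.1 e.2 z -> ~ boundary p z ->
  exists y, [/\ seg e.1 e.2 y, y != e.1, y != e.2 & ~ boundary p y].
Proof.
move=> ne [s s01 zE] zb; have [r r0 H] := boundary_nbhd zb.
pose D := `|(e.2.1 - e.1.1) * (2^-1 - s)| + `|(e.2.2 - e.1.2) * (2^-1 - s)| + 1.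
have D0 : 0 < D by rewrite ltr_pwDr// addr_ge0.
pose h := Num.min 2^-1 (r / (2 * D)).
have h0 : 0 < h by rewrite lt_min invr_gt0 ltr0n divr_gt0// mulr_gt0.
have h1 : h <= 2^-1 by rewrite ge_min lexx.
have hD : h * D < r.
  have : h <= r / (2 * D) by rewrite ge_min lexx orbT.
  rewrite ler_pdivlMr ?mulr_gt0//; nra.
pose t := (1 - h) * s + h * 2^-1.
have t0 : 0 < t by rewrite /t; nra.
have t1 : t < 1 by rewrite /t; nra.
exists (e.1.1 + t * (e.2.1 - e.1.1), e.1.2 + t * (e.2.2 - e.1.2)).
have E (k : R) : k != 0 -> k * (e.2.1 - e.1.1) = 0 -> k * (e.2.2 - e.1.2) = 0 -> False.
  move=> k0 /eqP; rewrite mulf_eq0 (negbTE k0) subr_eq0 /= => /eqP g1.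
  move=> /eqP; rewrite mulf_eq0 (negbTE k0) subr_eq0 /= => /eqP g2.
  by move: ne; rewrite (surjective_pairing e.1) (surjective_pairing e.2) g1 g2 eqxx.
split.
- by exists t => //; rewrite !ltW.
- apply/eqP => ez; apply: (E t); first by rewrite gt_eqF.
    by move: (congr1 fst ez) => /=; lra.
  by move: (congr1 snd ez) => /=; lra.
- apply/eqP => ez; apply: (E (1 - t)); first by rewrite gt_eqF// subr_gt0.
    by move: (congr1 fst ez) => /=; lra.
  by move: (congr1 snd ez) => /=; lra.
apply: H; rewrite zE /=; apply: le_lt_trans hD.
  rewrite (_ : _ - _ = h * ((e.2.1 - e.1.1) * (2^-1 - s))); last by rewrite /t; ring.
  rewrite normrM (ger0_norm (ltW h0)) ler_wpM2l ?(ltW h0)// /D -addrA lerDl.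
  by rewrite addr_ge0.
rewrite (_ : _ - _ = h * ((e.2.2 - e.1.2) * (2^-1 - s))); last by rewrite /t; ring.
rewrite normrM (ger0_norm (ltW h0)) ler_wpM2l ?(ltW h0)// /D addrAC lerDr.
by rewrite addr_ge0.
Qed.

(* Just across an interior edge lies another quadrilateral, which must share
   that edge, traversed backwards. *)
Lemma inner_edge e : e \in dedges ->
  ~ (forall x, seg e.1 e.2 x -> boundary p x) -> swap e \in dedges.
Proof.
move=> /dedgesP[i iM ei] /existsNP[z0 /not_implyP[z0e z0b]].
have [z [ze z1 z2 zb]] := open_point (edge_neq (ccwM iM) ei) z0e z0b.
have zi := edge_in_hull (ccwM iM) ei ze.
have zK : region p z by apply/(mesh_cover HM); exists (nth [::] M i) => //; exact: mem_nth.
have [r r0 Hr] := region_nbhd zK zb.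
pose P j t := hull (nth [::] M j) (shift z (- t) (normal e)).
(* By finiteness, a single quadrilateral contains points across the edge that are arbitrarily close
   to [z]; being closed, it contains [z] too. *)
have [j jM Hj] : exists2 j, (j < size M)%N &
    forall h : R, 0 < h -> exists t : R, [/\ 0 < t, t < h & P j t].
  apply: contrapT => N.
  have F m : (m <= size M)%N -> exists2 h : R, 0 < h &
      forall j t, (j < m)%N -> 0 < t -> t < h -> ~ P j t.
    elim: m => [|m IH] mM; first by exists 1.
    have [h h0 H] := IH (ltnW mM).
    have [h' h'0 H'] : exists2 h' : R, 0 < h' & forall t, 0 < t -> t < h' -> ~ P m t.
      apply: contrapT => N'; apply: N; exists m => // h' h'0.
      apply: contrapT => N''; apply: N'; exists h' => // t t0 t1 Pt.
      by apply: N''; exists t.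
    exists (Num.min h h'); first by rewrite lt_min h0.
    move=> j t; rewrite ltnS leq_eqVlt => /orP[/eqP->|jm] t0; rewrite lt_min => /andP[k1 k2].
      exact: H'.
    exact: H.
  have [h h0 H] := F (size M) (leqnn _).
  pose D := `|(normal e).1| + `|(normal e).2| + 1.
  have D0 : 0 < D by rewrite ltr_pwDr// addr_ge0.
  pose t := Num.min (h / 2) (r / (2 * D)).
  have t0 : 0 < t by rewrite lt_min !divr_gt0// mulr_gt0.
  have th : t < h.
    have : t <= h / 2 by rewrite ge_min lexx.
    by lra.
  have tD : t * D < r.
    have : t <= r / (2 * D) by rewrite ge_min lexx orbT.
    by rewrite ler_pdivlMr ?mulr_gt0//; nra.
  have : region p (shift z (- t) (normal e)).
    apply: Hr; rewrite /shift /= addrC addKr normrM normrN (ger0_norm (ltW t0));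
      apply: le_lt_trans tD; rewrite ler_wpM2l ?(ltW t0)// /D.
      by rewrite -addrA lerDl addr_ge0.
    by rewrite addrAC lerDr addr_ge0.
  move=> /(mesh_cover HM)[q qM hq]; apply: (H (index q M) t) => //.
    by rewrite index_mem.
  by rewrite /P nth_index.
have zj : hull (nth [::] M j) z.
  move=> f fj; rewrite leNgt; apply/negP => neg.
  have neg' : 0 < - orient f.1 f.2 z by rewrite oppr_gt0.
  have [h h0 H] := lin_pos (cross (vsub f.2 f.1) (normal e)) neg'.
  have [t [t0 t1 /(_ f fj)]] := Hj h h0.
  by rewrite orient_shift; have := H t t0 t1; lra.
have ij : i != j.
  apply/eqP => E; have [t [t0 _]] := Hj 1 ltr01; rewrite /P -E.
  exact: (right_outside (ccwM iM) ei ze t0).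
case: (mesh_meet HM iM jM ij) => [/(_ z zi zj)//|[v [vi _] /(_ z zi zj) zv]
    |[g [gi gj] /(_ z zi zj) zg]].
  rewrite zv in ze z1 z2; have := vertex_on_edge (ccwM iM) ei vi ze.
  by case=> E; [move: z1|move: z2]; rewrite E eqxx.
have ge := edge_open_unique (ccwM iM) ei gi ze z1 z2 zg; subst g.
case: gj => gj; last exact: mem_dedges gj.
by move/eqP: ij; case; exact: edge_once iM jM ei gj.
Qed.

Section ChainTheorem.
Variables (n : nat) (V : nat -> pt) (n1 n2 : R).
Hypothesis L : simple_loop n V.
Hypothesis half : forall t, (0 < t < n)%N ->
  0 < n1 * (vsub (V t) (V 0%N)).1 + n2 * (vsub (V t) (V 0%N)).2.
Hypothesis bdE : forall x, boundary p x <-> trace n V x.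

Lemma sum_dedges (F : pt * pt -> R) :
  \sum_(e <- dedges) F e = \sum_(q <- M) \sum_(e <- qedges q) F e.
Proof. by rewrite /dedges big_flatten /= big_map. Qed.

Lemma sum_boundary (g : pt -> R) : \sum_(e <- dedges) (g e.2 - g e.1) = 0.
Proof.
rewrite sum_dedges big_seq big1// => q qM.
have [a [b [c [d [-> _]]]]] := mesh_ccw HM qM.
by rewrite /qedges /= !big_cons big_nil /=; ring.
Qed.

Lemma swapK e : swap (swap e) = e.
Proof. by case: e. Qed.

(* Inner edges are traversed once in each direction and cancel. *)
Lemma sum_anti (h : pt -> pt -> R) : (forall a b, h b a = - h a b) ->
  (forall a b, (forall x, seg a b x -> boundary p x) -> h a b = 0) ->
  \sum_(e <- dedges) h e.1 e.2 = 0.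
Proof.
move=> anti bd0.
pose onb e := `[< forall x, seg e.1 e.2 x -> boundary p x >].
rewrite (bigID onb) /= big1 ?add0r; last by move=> e /asboolP; exact: bd0.
rewrite -big_filter; set D := seq.filter _ _.
have DU : uniq D by rewrite filter_uniq// dedges_uniq.
have swD e : e \in D -> swap e \in D.
  rewrite !mem_filter => /andP[/asboolPn nb eD]; rewrite inner_edge// andbT.
  apply/asboolPn => H; apply: nb => x xe; apply: H; exact: seg_sym.
have P : perm_eq (map swap D) D.
  apply: uniq_perm => //.
    by rewrite map_inj_uniq// => e f E; rewrite -(swapK e) E swapK.
  move=> e; apply/mapP/idP => [[f fD ->]|eD]; first exact: swD.
  by exists (swap e); [exact: swD|rewrite swapK].
suff : \sum_(e <- D) h e.1 e.2 = - \sum_(e <- D) h e.1 e.2 by lra.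
rewrite -{1}(perm_big _ P) /= big_map -sumrN; apply: eq_bigr => e _ /=.
exact: anti.
Qed.

Lemma jump_anti a b : jump n V b a = - jump n V a b.
Proof. by rewrite /jump opprB. Qed.

(** Subtracting from [f] the differences of its primitive, which cancel around each quadrilateral,
    and the multiple of [jump] leaves an antisymmetric function vanishing on boundary edges; its sum
    is 0 by [sum_anti]. *)
Lemma chain_jump (f : pt -> pt -> R) : seg_additive f -> \sum_(e <- dedges) f e.1 e.2 =
  circ n V f * \sum_(e <- dedges) jump n V e.1 e.2.
Proof.
move=> F; pose h a b := f a b - (pot n V f b - pot n V f a) - circ n V f * jump n V a b.
suff : \sum_(e <- dedges) h e.1 e.2 = 0.
  move=> h0; have := sum_boundary (pot n V f); move: h0.
  rewrite /h 2!sumrB -big_distrr /=; lra.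
apply: sum_anti => a b; first by rewrite /h (seg_anti F a b) jump_anti; ring.
move=> H; rewrite /h (@pot_seg _ n V n1 n2 L half f a b F); first by ring.
by move=> x /H /bdE.
Qed.

(** Both segments contain the stretch of the last edge near [V 0]. The midpoint between [V 0] and
    the nearer of the two witnesses is interior to both. *)
Lemma overlap_point a b : overlap n V a -> overlap n V b -> exists y,
  [/\ seg a (V 0%N) y /\ seg b (V 0%N) y, y != V 0%N, y != a & y != b].
Proof.
move=> [x [x0 xa xV]] [x' [x'0 xb x'V]].
wlog xx' : a b x x' x0 xa xV x'0 xb x'V / seg (V 0%N) x' x.
  move=> W.
  have [h|h] : seg (V 0%N) x' x \/ seg (V 0%N) x x'.
    have [] := seg_split (seg_sym x'V) (seg_sym xV); first by left.
    move=> h; right; move: (seg_sym x'V) h => [t t01 ->] [s s01 ->].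
    set v := V n.-1; set w := V 0%N.
    have [k0|k0] := eqVneq (t + s * (1 - t)) 0.
      exists 0; first by rewrite lexx ler01.
      have -> : t = 0 by nra.
      by congr (_, _) => /=; ring.
    have kp : 0 < t + s * (1 - t) by rewrite lt0r k0; nra.
    exists (t / (t + s * (1 - t))).
      by rewrite divr_ge0 ?ler_pdivrMr ?(ltW kp)//; nra.
    by congr (_, _) => /=; field.
    exact: (W a b x x').
  have [y [[y1 y2] y3 y4 y5]] := W b a x' x x'0 xb x'V x0 xa xV h.
  by exists y.
have mid c z : seg c (V 0%N) z -> z != V 0%N ->
    let y : pt := ((V 0%N).1 + 2^-1 * (x.1 - (V 0%N).1), (V 0%N).2 + 2^-1 * (x.2 - (V 0%N).2)) in
    seg (V 0%N) z x -> [/\ seg c (V 0%N) y, y != V 0%N & y != c].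
  move=> cz z0 y zx.
  have cx : seg c (V 0%N) x.
    by apply: (seg_conv _ cz zx); exact: seg_r.
  have nz (k : R) g g' : g != g' -> k != 0 -> k * (g.1 - g'.1) = 0 -> k * (g.2 - g'.2) = 0 -> False.
    move=> gg k0 /eqP; rewrite mulf_eq0 (negbTE k0) subr_eq0 /= => /eqP g1.
    move=> /eqP; rewrite mulf_eq0 (negbTE k0) subr_eq0 /= => /eqP g2.
    by move: gg; rewrite (surjective_pairing g) (surjective_pairing g') g1 g2 eqxx.
  have half0 : 2^-1 != 0 :> R by rewrite invr_eq0 pnatr_eq0.
  split.
  - apply: (seg_conv (seg_r _ _) cx); exists 2^-1 => //.
    by rewrite invr_ge0 ler0n invf_le1 ?ler1n.
  - apply/eqP => E; apply: (nz 2^-1 x (V 0%N)) => //.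
      by move: (congr1 fst E) => /=; lra.
    by move: (congr1 snd E) => /=; lra.
  - apply/eqP => E; move: cx E; rewrite /y => -[t t01 ->] /= E.
    have c0 : c != V 0%N.
      by apply: contraNneq z0 => c0; move: cz; rewrite c0 => /seg_refl ->.
    apply: (nz (2^-1 * (1 + t)) _ _ c0).
    + by rewrite mulf_neq0// gt_eqF//; lra.
    + by move: (congr1 fst E) => /=; lra.
    + by move: (congr1 snd E) => /=; lra.
have [y1 y2 y3] := mid a x xa x0 (seg_r _ _).
have [y4 _ y5] := mid b x' xb x'0 xx'.
by eexists; split; [split; [exact: y1|exact: y4]|..].
Qed.

Lemma count_le1 (P : pred (pt * pt)) :
  (forall e f, e \in dedges -> f \in dedges -> P e -> P f -> e = f) ->
  (count P dedges <= 1)%N.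
Proof.
move=> H; rewrite -size_filter.
have : uniq (seq.filter P dedges) by rewrite filter_uniq// dedges_uniq.
case E : (seq.filter P dedges) => [|a [|b s]] //= /andP[].
have : a \in seq.filter P dedges by rewrite E inE eqxx.
have : b \in seq.filter P dedges by rewrite E !inE eqxx orbT.
rewrite !mem_filter => /andP[Pb bD] /andP[Pa aD].
by rewrite (H a b)// inE eqxx.
Qed.

(** Two mesh edges arriving at [V 0] along the last edge share an interior point, so by
    [edge_overlap] they agree up to direction, and having the same end they coincide. The same holds
    for departing edges, so [m] is a difference of two counts that are 0 or 1. *)
Lemma jump_total : exists2 m : R, [\/ m = -1, m = 0 | m = 1] &
  \sum_(e <- dedges) jump n V e.1 e.2 = m.
Proof.
pose P1 e := (e.2 == V 0%N) && `[< overlap n V e.1 >].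
pose P2 e := (e.1 == V 0%N) && `[< overlap n V e.2 >].
have c1 : (count P1 dedges <= 1)%N.
  apply: count_le1 => e f /dedgesP[i iM ei] /dedgesP[j jM fj].
  move=> /andP[/eqP e0 /asboolP oe] /andP[/eqP f0 /asboolP of_].
  have [y [[y1 y2] y3 y4 y5]] := overlap_point oe of_.
  rewrite -e0 in y1 y3; rewrite -f0 in y2.
  have y3' : y != f.2 by rewrite f0 -e0.
  have [->//|E] := edge_overlap iM jM ei fj y1 y4 y3 y2 y5 y3'.
  by move: (edge_neq (ccwM iM) ei) f0; rewrite E /= -e0 => /eqP.
have c2 : (count P2 dedges <= 1)%N.
  apply: count_le1 => e f /dedgesP[i iM ei] /dedgesP[j jM fj].
  move=> /andP[/eqP e0 /asboolP oe] /andP[/eqP f0 /asboolP of_].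
  have [y [[y1 y2] y3 y4 y5]] := overlap_point oe of_.
  rewrite -e0 in y1 y3; rewrite -f0 in y2.
  have y3' : y != f.1 by rewrite f0 -e0.
  have [->//|E] := edge_overlap iM jM ei fj (seg_sym y1) y3 y4 (seg_sym y2) y3' y5.
  by move: (edge_neq (ccwM iM) ei) f0; rewrite E /= -e0 eq_sym => /eqP.
have S (P : pred (pt * pt)) : \sum_(e <- dedges) (P e)%:R = (count P dedges)%:R :> R.
  by rewrite -sum1_count natr_sum [in RHS]big_mkcond; apply: eq_bigr => e _; case: (P e).
exists ((count P1 dedges)%:R - (count P2 dedges)%:R); last first.
  by rewrite -!S -sumrB.
by case: (count P1 dedges) c1 => [|[|]] //; case: (count P2 dedges) c2 => [|[|]] // _ _;
  rewrite ?subrr ?sub0r ?subr0; [constructor 2|constructor 1|constructor 3|constructor 2].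
Qed.

End ChainTheorem.
End Fixed.
End Mesh.

(** * Counting angles *)

Section Count.
Variable R : realType.
Notation pt := (R * R)%type.
Implicit Types (p q : seq pt) (u v a b c d x y z : pt) (e f : pt * pt).

Lemma ang_ge0 u v : 0 <= cross u v -> 0 <= ang u v.
Proof.
rewrite le_eqVlt => /orP[/eqP c0|/ang_gt0/andP[/ltW]//].
by rewrite ang_collinear.
Qed.

Lemma qwind_ge0 q x : ccw_quad q -> 0 <= qwind q x.
Proof.
move=> Q; case: (pselect (hull q x)) => [H|/(qwind_out Q)->//].
rewrite /qwind big_seq sumr_ge0// => e eq; apply: ang_ge0.
by have := H e eq; rewrite /orient /cross /vsub /=; lra.
Qed.

Lemma sin_sum0 (T : eqType) (s : seq T) (g : T -> R) :
  (forall t, t \in s -> sin (g t) = 0) -> sin (\sum_(t <- s) g t) = 0.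
Proof.
move=> H; rewrite big_seq; elim/big_ind: _ => //; first exact: sin0.
by move=> s1 s2 h1 h2; rewrite sinD h1 h2 mul0r mulr0 addr0.
Qed.

Variables (p : seq pt) (M : seq (seq pt)).
Hypothesis P : simple_polygon p.
Hypothesis HM : ccw_mesh M (region p).
Hypothesis small : forall q v, q \in M -> v \in q -> qwind q v < 2 * pi / 3.
Hypothesis flat : forall q x, q \in M -> x \notin q -> sin (qwind q x) = 0.
Hypothesis wide : forall i, (i < size p)%N -> 2 * pi / 3 <= interior_angle p i.

Let n3 : (3 <= size p)%N. Proof. by case: P. Qed.

Definition mesh_angle x := \sum_(q <- M) qwind q x.

(* As a 1-cycle carried by the polygon, the sum of the boundaries of the
   quadrilaterals is a multiple [m] of the polygon itself. *)
Lemma mesh_chain : exists2 m : R, [\/ m = -1, m = 0 | m = 1] &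
  forall f : pt -> pt -> R, seg_additive f ->
  \sum_(q <- M) \sum_(e <- qedges q) f e.1 e.2 =
  m * \sum_(i < size p) f (vtx p i) (vtx p i.+1).
Proof.
have n0 : (0 < size p)%N by lia.
have [k kN far] := far_vertex n0.
have L := simple_loop_vtx k P; have half := far_vertex_half P kN far.
have bdE := boundary_trace k n0.
have [m m1 mE] := jump_total HM (size p) (fun i => vtx p (k + i)%N).
exists m => // f F; rewrite -sum_dedges (chain_jump HM L half bdE F) mE mulrC; congr (_ * _).
rewrite /circ; under eq_bigr => i _ do rewrite addnS.
rewrite (@sum_periodic _ (fun i => f (vtx p i) (vtx p i.+1)))//.
move=> i; have -> : vtx p (i + size p).+1 = vtx p i.+1 by rewrite -addSn -vtx_mod modnDr vtx_mod.
by have -> : vtx p (i + size p) = vtx p i by rewrite -vtx_mod modnDr vtx_mod.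
Qed.

Lemma mesh_nonempty : exists q, q \in M.
Proof.
have : region p (vtx p 0).
  by left; exists 0%N; [lia|exact: seg_l].
by move/(mesh_cover HM) => [q qM _]; exists q.
Qed.

Lemma mesh_angle_wind x : mesh_angle x = orientation p * wind p x.
Proof.
have [m m1 H] := mesh_chain.
have A : 0 < \sum_(q <- M) \sum_(e <- qedges q) cross e.1 e.2.
  have [q qM] := mesh_nonempty.
  rewrite (big_rem q)//=; apply: ltr_pwDl; first exact/area_gt0/(mesh_ccw HM).
  rewrite big_seq sumr_ge0// => q' /mem_rem q'M; exact/ltW/area_gt0/(mesh_ccw HM).
rewrite (H _ (cross_additive R)) -/(area2 p) in A.
rewrite /mesh_angle /qwind (H _ (ang_additive x)) -/(wind p x); congr (_ * _).
rewrite /orientation; case: ltP => area.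
  by case: m1 A => -> //; rewrite ?mul0r ?ltxx// mulN1r oppr_gt0 ltNge (ltW area).
by case: m1 A => -> //; rewrite ?mul0r ?ltxx// mul1r ltNge area.
Qed.

Definition mesh_vertices := undup (flatten M).

Lemma mesh_verticesP x : reflect (exists2 q, q \in M & x \in q) (x \in mesh_vertices).
Proof. by rewrite mem_undup; apply: flattenP. Qed.

Lemma qwind_off q x : q \in M -> x \in mesh_vertices -> x \notin q -> qwind q x = 0.
Proof.
move=> qM /mesh_verticesP[q' q'M xq'] xq; apply: qwind_out; first exact: (mesh_ccw HM).
move=> h; move/negP: xq; apply.
have := @mesh_vertex _ p M HM (index q' M) (index q M) x.
by rewrite !index_mem !nth_index//; apply.
Qed.

Definition degree x := count (fun q => x \in q) M.

Lemma mesh_angle_filter x : x \in mesh_vertices ->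
  mesh_angle x = \sum_(q <- M | x \in q) qwind q x.
Proof.
move=> xS; rewrite /mesh_angle (bigID (fun q => x \in q)) /= -[RHS]addr0; congr (_ + _).
by rewrite big_seq_cond big1// => q /andP[qM xq]; exact: qwind_off.
Qed.

Lemma mesh_angle_lt x : x \in mesh_vertices -> mesh_angle x < (2 * pi / 3) * (degree x)%:R.
Proof.
move=> xS; rewrite mesh_angle_filter//.
have -> : (2 * pi / 3) * (degree x)%:R = \sum_(q <- M | x \in q) (2 * pi / 3) :> R.
  by rewrite big_const_seq iter_addr_0 mulr_natr.
move/mesh_verticesP: (xS) => [q qM xq].
rewrite (big_rem q)//= xq [in X in _ < X](big_rem q)//= xq.
rewrite ltr_leD ?small// [X in X <= _]big_seq_cond [X in _ <= X]big_seq_cond.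
by apply: ler_sum => q' /andP[/mem_rem q'M xq']; rewrite ltW// small.
Qed.

Lemma mesh_angle_gt0 x : x \in mesh_vertices -> 0 < mesh_angle x.
Proof.
move/mesh_verticesP => [q qM xq]; rewrite /mesh_angle (big_rem q)//=; apply: ltr_pwDl.
  exact: qwind_vertex_gt0 (mesh_ccw HM qM) xq.
by rewrite big_seq sumr_ge0// => q' /mem_rem q'M; exact/qwind_ge0/(mesh_ccw HM).
Qed.

Lemma mesh_angle_ge0 x : 0 <= mesh_angle x.
Proof.
by rewrite /mesh_angle big_seq sumr_ge0// => q qM; exact/qwind_ge0/(mesh_ccw HM).
Qed.

(** The tangent wedges at [x] of different quadrilaterals are disjoint: a common direction would
    lead, at a small distance from [x], to a common interior point. *)
Lemma mesh_angle_le x : x \in mesh_vertices -> mesh_angle x <= 2 * pi.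
Proof.
move=> xS; rewrite mesh_angle_filter// -big_filter.
have /choice[W HW] : forall q, exists w : pt * pt, ccw_quad q -> x \in q ->
    [/\ 0 < cross w.1 w.2, qwind q x = ang w.1 w.2 &
     forall y, in_wedge w y -> exists2 dl : R, 0 < dl &
       forall t, 0 < t -> t < dl -> interior_pt q (shift x t y)].
  move=> q; case: (pselect (ccw_quad q /\ x \in q)) => [[Q xq]|N]; last first.
    by exists ((0, 0), (0, 0)) => Q xq; case: N.
  have [b [c [d [C E _]]]] := quad_vertex Q xq.
  exists (vsub b x, vsub d x) => _ _ /=; split.
  - by case: C => _ _ _; rewrite /orient /cross /vsub /=; lra.
  - by rewrite (qwind_perm _ E) qwind_corner.
  move=> y [y1 y2]; have [dl dl0 H] := wedge_interior C y1 y2.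
  by exists dl => // t t0 t1; apply/(interior_perm _ E)/H.
have -> : \sum_(q <- [seq q <- M | x \in q]) qwind q x =
    \sum_(w <- [seq W q | q <- M & x \in q]) ang w.1 w.2.
  rewrite big_map big_seq [RHS]big_seq; apply: eq_bigr => q.
  by rewrite mem_filter => /andP[xq qM]; have [] := HW q (mesh_ccw HM qM) xq.
apply: wedge_packing.
  move=> w /mapP[q]; rewrite mem_filter => /andP[xq qM] ->.
  by have [] := HW q (mesh_ccw HM qM) xq.
rewrite pairwise_map.
have : pairwise (fun q q' => `[< forall y, interior_pt q y -> hull q' y -> False >])
    [seq q <- M | x \in q].
  apply: pairwise_filter; apply/(pairwiseP [::]) => i j iM jM ij; apply/asboolP => y.
  by apply: (interior_disjoint HM iM jM); rewrite ltn_eqF.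
apply: (@sub_in_pairwise _ (mem [seq q <- M | x \in q])); last exact/allP.
have F q : q \in mem [seq q <- M | x \in q] -> x \in q /\ q \in M.
  by move=> qF; apply/andP; rewrite -(mem_filter (fun q => x \in q)); exact: qF.
move=> q q' /F[xq qM] /F[xq' q'M] /asboolP D.
apply/asboolP => y wy wy'.
have [_ _ /(_ y wy)[d1 d10 H1]] := HW q (mesh_ccw HM qM) xq.
have [_ _ /(_ y wy')[d2 d20 H2]] := HW q' (mesh_ccw HM q'M) xq'.
have m0 : 0 < Num.min d1 d2 by rewrite lt_min d10.
have t0 : 0 < Num.min d1 d2 / 2 by rewrite divr_gt0.
have : Num.min d1 d2 / 2 < Num.min d1 d2 by lra.
rewrite lt_min => /andP[t1 t2].
by apply: (D _ (H1 _ t0 t1)) => e eq; exact/ltW/H2.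
Qed.

Lemma sum_mesh_angle : \sum_(x <- mesh_vertices) mesh_angle x = (2 * pi) * (size M)%:R.
Proof.
have -> : 2 * pi * (size M)%:R = \sum_(q <- M) (2 * pi) :> R.
  by rewrite big_const_seq iter_addr_0 count_predT mulr_natr.
rewrite /mesh_angle exchange_big /=.
rewrite big_seq [RHS]big_seq; apply: eq_bigr => q qM.
rewrite -(qwind_sum (mesh_ccw HM qM)) (bigID (fun x => x \in q)) /=.
rewrite [X in _ + X]big_seq_cond [X in _ + X]big1 ?addr0; last first.
  by move=> x /andP[xS xq]; exact: qwind_off.
rewrite -big_filter; apply: perm_big; apply: uniq_perm.
- by rewrite filter_uniq// undup_uniq.
- exact/quad_uniq/(mesh_ccw HM).
move=> x; rewrite mem_filter; case xq : (x \in q) => //=.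
by apply/mesh_verticesP; exists q.
Qed.

Lemma sum_degree : \sum_(x <- mesh_vertices) (degree x)%:R = 4 * (size M)%:R :> R.
Proof.
have -> : 4 * (size M)%:R = \sum_(q <- M) 4 :> R.
  by rewrite big_const_seq iter_addr_0 count_predT mulr_natr.
have E x : (degree x)%:R = \sum_(q <- M) (if x \in q then 1 else 0) :> R.
  by rewrite -big_mkcond big_const_seq iter_addr_0.
under eq_bigr => x _ do rewrite E.
rewrite exchange_big /=.
rewrite big_seq [RHS]big_seq; apply: eq_bigr => q qM; rewrite -big_mkcond /=.
have -> : \sum_(x <- mesh_vertices | x \in q) 1 = \sum_(x <- q) 1 :> R.
  rewrite -big_filter; apply: perm_big; apply: uniq_perm.
  - by rewrite filter_uniq// undup_uniq.
  - exact/quad_uniq/(mesh_ccw HM).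
  move=> x; rewrite mem_filter; case xq : (x \in q) => //=.
  by apply/mesh_verticesP; exists q.
have [a [b [c [d [-> _]]]]] := mesh_ccw HM qM.
by rewrite !big_cons big_nil /=; ring.
Qed.

Lemma index_vtx x : x \in p -> (index x p < size p)%N /\ vtx p (index x p) = x.
Proof. by move=> xp; rewrite index_mem /vtx modn_small ?nth_index ?index_mem. Qed.

Lemma mesh_angle_inner x : x \in mesh_vertices -> ~ boundary p x -> mesh_angle x = 2 * pi.
Proof.
move=> xS xb; have [c s] := wind_out P xb.
have tp := mesh_angle_gt0 xS; have tl := mesh_angle_le xS; have p0 := pi_gt0 R.
suff : mesh_angle x - 2 * pi = 0 by lra.
apply: cos_eq1_0; last lra.
rewrite -[LHS]cosD2pi mulr_natl subrK mesh_angle_wind /orientation.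
by case: ifP => _; rewrite ?mul1r ?mulN1r ?cosN.
Qed.

Lemma mesh_angle_edge x : x \in mesh_vertices -> boundary p x -> x \notin p -> mesh_angle x = pi.
Proof.
move=> xS [i iN xi] xp.
have V j : x <> vtx p j.
  by move=> e; move: xp; rewrite e /vtx mem_nth// ltn_mod; lia.
have [c s] := wind_edge P xi (V i) (V i.+1).
have tp := mesh_angle_gt0 xS; have tl := mesh_angle_le xS; have p0 := pi_gt0 R.
suff : mesh_angle x - pi = 0 by lra.
apply: cos_eq1_0; last lra.
rewrite cosB cospi sinpi mulr0 addr0 mesh_angle_wind /orientation.
by case: ifP => _; rewrite ?mul1r ?mulN1r ?cosN c mulrNN mulr1.
Qed.

Lemma mesh_angle_corner x : x \in mesh_vertices -> x \in p ->
  mesh_angle x = interior_angle p (index x p).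
Proof.
move=> xS /index_vtx[iN xE]; apply: interior_angle_wind => //.
- by rewrite xE mesh_angle_wind.
- by rewrite (ltW (mesh_angle_gt0 xS)) mesh_angle_le.
- by apply: lt_le_trans (wide iN); rewrite divr_gt0// mulr_gt0// pi_gt0.
Qed.

(** All contributions to the local angle are multiples of [pi], so the winding angle is one too and
    the two edges at the corner are collinear. Their turn is then 0, a spike being impossible. *)
Lemma missing_corner x : x \in p -> x \notin mesh_vertices ->
  interior_angle p (index x p) = pi.
Proof.
move=> /index_vtx[iN xE] xS.
have : sin (mesh_angle x) = 0.
  apply: sin_sum0 => q qM; apply: flat => //; apply: contra xS => xq.
  by apply/mesh_verticesP; exists q.
rewrite mesh_angle_wind => s0; have [_] := wind_vertex (index x p) P; rewrite xE.
have -> : sin (wind p x) = 0.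
  move: s0; rewrite /orientation; case: ifP => _; rewrite ?mul1r// mulN1r sinN.
  by move/eqP; rewrite oppr_eq0 => /eqP.
rewrite mulr0 => /esym c0; have := interior_angle_turn P (index x p); rewrite xE.
rewrite ang_collinear; first by rewrite mulr0; lra.
by rewrite -[RHS]c0 /cross /vsub /=; ring.
Qed.

Lemma degree_defect x : x \in mesh_vertices -> x \notin p ->
  2 * mesh_angle x <= pi * (degree x)%:R.
Proof.
move=> xS xp; have := mesh_angle_lt xS; have p0 := pi_gt0 R.
(* For a local angle of [k] right angles the strict angle bound reads [3 k < 4 degree]. With [k = 2]
   it gives degree at least 2, with [k = 4] at least 4. *)
have K (k : nat) (th : R) : th * 2 = pi * k%:R ->
    th < 2 * pi / 3 * (degree x)%:R -> (k%:R * 3 < 4 * (degree x)%:R :> R).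
  move=> e h; rewrite -(ltr_pM2l p0); lra.
case: (pselect (boundary p x)) => [xb|xb].
  rewrite (mesh_angle_edge xS xb xp) => /(K 2) => /(_ ltac:(ring)).
  rewrite -!natrM ltr_nat => d2; have : (2 <= degree x)%N by lia.
  rewrite -(ler_nat R) => h; have := ler_wpM2l (ltW p0) h; lra.
rewrite (mesh_angle_inner xS xb) => /(K 4%N) => /(_ ltac:(ring)).
rewrite -!natrM ltr_nat => d2; have : (4 <= degree x)%N by lia.
rewrite -(ler_nat R) => h; have := ler_wpM2l (ltW p0) h; lra.
Qed.

(** A single angle below [2 * pi / 3] cannot fill an interior angle of at least [2 * pi / 3]; here
    the bounds for P and for the mesh meet. *)
Lemma degree_corner x : x \in mesh_vertices -> x \in p -> (2 <= degree x)%N.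
Proof.
move=> xS xp; have := mesh_angle_lt xS; rewrite mesh_angle_corner//.
have [iN _] := index_vtx xp; have := wide iN; have p0 := pi_gt0 R.
case: (degree x) => [|[|//]]; rewrite ?mulr0 ?mulr1; lra.
Qed.

(** The sign required by [hopf] comes from the mesh: its nonnegative angle at the farthest vertex is
    [orientation p] times the winding angle there, which telescopes in the half-plane to the angle
    between the first and the last edge. *)
Lemma total_turning : \sum_(i < size p) (pi - interior_angle p i) = 2 * pi.
Proof.
have n0 : (0 < size p)%N by lia.
have [k kN far] := far_vertex n0.
have L := simple_loop_vtx k P; have half := far_vertex_half P kN far.
rewrite (sum_interior_turn P k); apply: (hopf L half).
  by rewrite /orientation; case: ifP => _; rewrite ?mulr1// mulrNN mulr1.
have := mesh_angle_ge0 (vtx p k); rewrite mesh_angle_wind (wind_shift p _ k).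
have kl : (0 < (size p).-1 < size p)%N by lia.
have := sum_ang_half half kl.
have nE : size p = (size p).-2.+2 by lia.
rewrite addn0 => <-.
suff -> : \sum_(i < size p) ang (vsub (vtx p (k + i)) (vtx p k))
    (vsub (vtx p (k + i.+1)) (vtx p k)) =
  \sum_(1 <= t < (size p).-1) ang (vsub (vtx p (k + t)) (vtx p k))
    (vsub (vtx p (k + t.+1)) (vtx p k)) by [].
pose g i := ang (vsub (vtx p (k + i)) (vtx p k)) (vsub (vtx p (k + i.+1)) (vtx p k)).
rewrite -(big_mkord xpredT g) big_ltn//.
have -> : g 0%N = 0 by rewrite /g addn0 ang_collinear// /cross /vsub /=; ring.
rewrite add0r [in LHS](_ : size p = (size p).-1.+1); last by lia.
rewrite big_nat_recr /=; last by lia.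
have -> : g (size p).-1 = 0; last by rewrite addr0.
rewrite /g prednK// -[vtx p (k + size p)]vtx_mod modnDr vtx_mod.
by rewrite ang_collinear// /cross /vsub /=; ring.
Qed.

(* The summand [pi * degree - 2 * angle] has sum [0] over the mesh vertices, but
   it is nonnegative off the corners and at least [2 (pi - angle)] at a corner. *)
Lemma mesh_contradiction : False.
Proof.
have p0 := pi_gt0 R; have up : uniq p by case: P.
pose G x := 2 * (pi - interior_angle p (index x p)).
have T : \sum_(x <- p) G x = 4 * pi.
  rewrite -big_distrr /= (big_nth (0, 0)) big_mkord.
  under eq_bigr => i _ do rewrite index_uniq ?ltn_ord//.
  by rewrite total_turning; ring.
have Z : \sum_(x <- mesh_vertices) (pi * (degree x)%:R - 2 * mesh_angle x) = 0.
  by rewrite sumrB -!big_distrr /= sum_degree sum_mesh_angle; ring.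
have : \sum_(x <- mesh_vertices | x \in p) G x <= 0.
  rewrite -[X in _ <= X]Z [X in _ <= X](bigID (fun x => x \in p)) /= -[leLHS]addr0; apply: lerD.
    rewrite big_seq_cond [X in _ <= X]big_seq_cond. apply: ler_sum => x /andP[xS xp].
    rewrite /G mesh_angle_corner//; have := degree_corner xS xp.
    rewrite -(ler_nat R) => h; have := ler_wpM2l (ltW p0) h; lra.
  rewrite big_seq_cond sumr_ge0// => x /andP[xS xp].
  by rewrite subr_ge0; exact: degree_defect.
(* Corners that are not mesh vertices have angle [pi], so leaving them out changes nothing. *)
have -> : \sum_(x <- mesh_vertices | x \in p) G x = \sum_(x <- p) G x.
  rewrite [RHS](bigID (fun x => x \in mesh_vertices)) /=.
  rewrite [X in _ = _ + X]big_seq_cond [X in _ = _ + X]big1 ?addr0; last first.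
    by move=> x /andP[xp xS]; rewrite /G missing_corner// subrr mulr0.
  rewrite -big_filter -[RHS]big_filter; apply: perm_big; apply: uniq_perm.
  - by rewrite filter_uniq// undup_uniq.
  - by rewrite filter_uniq.
  by move=> x; rewrite !mem_filter andbC.
by rewrite T; lra.
Qed.

End Count.

(** * From the given mesh to a counterclockwise one, and the conclusion *)

Lemma ccw_mesh_of (R : realType) (p : seq (R * R)) (Qs : seq (seq (R * R))) :
  quad_mesh p Qs ->
  (forall q, q \in Qs -> forall k, (k < 4)%N -> interior_angle q k < 2 * pi / 3) ->
  ccw_mesh [seq ccw_of q | q <- Qs] (region p).
Proof.
move=> [HQ HK HI] HA.
have C q : q \in Qs -> [/\ ccw_quad (ccw_of q),
    forall v, v \in ccw_of q -> qwind (ccw_of q) v < 2 * pi / 3 & region q = hull (ccw_of q)].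
  by move=> qQ; have [s4 sp] := HQ q qQ; apply: ccw_ofP => //; exact: HA.
split.
- by move=> q /mapP[q' q'Q ->]; case: (C q' q'Q).
- move=> x; rewrite -HK; split => [[q qQ xq]|[q /mapP[q' q'Q ->] xq]].
    exists (ccw_of q); first exact: map_f.
    by case: (C q qQ) => _ _ <-.
  by exists q' => //; case: (C q' q'Q) => _ _ ->.
move=> i j; rewrite size_map => iQ jQ ij A B.
have qi := mem_nth [::] iQ; have qj := mem_nth [::] jQ.
have AE : A = ccw_of (nth [::] Qs i) by rewrite /A (nth_map [::]).
have BE : B = ccw_of (nth [::] Qs j) by rewrite /B (nth_map [::]).
have [s4 _] := HQ _ qi; have [s4' _] := HQ _ qj.
have [_ _ ri] := C _ qi; have [_ _ rj] := C _ qj.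
have I x : hull A x -> hull B x ->
    (region (nth [::] Qs i) `&` region (nth [::] Qs j)) x.
  by rewrite ri rj -AE -BE.
case: (HI i j iQ jQ ij) => [E|[[k [l [k4 l4 kl E]]]|[k [l [k4 l4 kl E]]]]].
- by constructor 1 => x xA xB; have := I x xA xB; rewrite E.
- constructor 2; exists (vtx (nth [::] Qs i) k); last first.
    by move=> x xA xB; have := I x xA xB; rewrite E.
  split; first by rewrite AE mem_ccw_of /vtx mem_nth// ltn_mod s4.
  by rewrite kl BE mem_ccw_of /vtx mem_nth// ltn_mod s4'.
constructor 3.
have [e eA ee] := ccw_of_edge s4 k4; have [f fB ff] := ccw_of_edge s4' l4.
exists e; last by move=> x xA xB; have := I x xA xB; rewrite E ee.
rewrite AE BE; split => //.
(* A shared edge is given as an equality of point sets; [seg_inj] recovers the directed edge up to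
   reversal. *)
have := kl; rewrite ee ff => /seg_inj[[h1 h2]|[h1 h2]].
  by left; rewrite (surjective_pairing e) h1 h2 -surjective_pairing.
by right; rewrite /swap h1 h2 -surjective_pairing.
Qed.

Theorem theorem5 (R : realType) (p : seq (R * R)) :
  simple_polygon p ->
  (forall i, (i < size p)%N -> 2 * pi / 3 <= interior_angle p i) ->
  ~ exists Qs : seq (seq (R * R)),
      quad_mesh p Qs /\
      (forall q, q \in Qs -> forall k, (k < 4)%N -> interior_angle q k < 2 * pi / 3).
Proof.
move=> P wide [Qs [HQ HA]].
have HM := ccw_mesh_of HQ HA; case: HQ => HQ _ _.
apply: (mesh_contradiction P HM) => // q.
  move=> v /mapP[q' q'Q ->]; have [s4 sp] := HQ q' q'Q.
  by have [_ + _] := ccw_ofP s4 sp (HA q' q'Q); apply.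
move=> x /mapP[q' q'Q ->]; have [s4 sp] := HQ q' q'Q.
by rewrite mem_ccw_of; exact: sin_qwind.
Qed.
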